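(* Let $\Omega\subset\mathbb{R}^d$ be a bounded Lipschitz domain, $T>0$, let $B=(b_{ij})\in[0,\infty)^{n\times n}$ be symmetric positive semidefinite with $b_{ii}>0$ for all $i$, and let $u^{\rm in}\in L^2(\Omega;[0,\infty)^n)$. Let $v\in C^1(\overline\Omega\times[0,T];[0,\infty)^n)$ be a positive solution (in the weak sense) to $$\partial_t u_i=\operatorname{div}(u_i\nabla(Bu)_i)\ \text{in }\Omega,\qquad u_i\nabla(Bu)_i\cdot\nu=0\ \text{on }\partial\Omega,\qquad i=1,\dots,n,\tag{P}$$ with initial datum $v(0)=u^{\rm in}>0$, and let $\mu$ be a dissipative measure-valued solution to (P) with initial datum $u^{\rm in}$. Then $$\mu_{x,t}=\delta_{v(x,t)}\otimes\delta_{\nabla\widehat v(x,t)}\quad\text{for a.e. }(x,t)\in\Omega\times(0,T).$$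
   Context: $v$ is a positive $C^1$ weak solution: $v_i>0$ on $\overline\Omega\times[0,T]$ and, for all $t\in(0,T)$ and all $\phi\in C^1(\overline\Omega)$, $\int_\Omega\partial_tv_i\,\phi\,dx=-\int_\Omega v_i\nabla(Bv)_i\cdot\nabla\phi\,dx$, $i=1,\dots,n$. Notation. $L=\ker B$, $L^\perp=\operatorname{ran}B$, $P_L,P_{L^\perp}$ orthogonal projections, $\widehat s=P_{L^\perp}s$ for $s\in\mathbb{R}^n$. $W=[0,\infty)^n\times(L^\perp)^d$, with points $(s,p)$, $p$ viewed as an $n\times d$ matrix with columns in $L^\perp$, $(Bp)_i\in\mathbb{R}^d$ the $i$-th row of $Bp$, $|\cdot|$ Euclidean/Frobenius norm, $B^{1/2}$ the positive semidefinite square root. $\mathcal{P}(W)$: probability measures on $W$; $L_w^\infty(\Omega\times[0,\infty);\mathcal{P}(W))$: weakly* measurable families $(\mu_{x,t})$; $\langle\mu_{x,t},f(s,p)\rangle=\int_W f\,d\mu_{x,t}$. $\Omega_T=\Omega\times(0,T)$. Entropies. $H_S(u)=\int_\Omega h_S(u)dx$, $h_S(u)=\sum_{i=1}^n(u_i(\log u_i-1)+1)$ ($0\log 0=0$), $H_R(u)=\frac12\int_\Omega\sum_{i,j}b_{ij}u_iu_j\,dx$. Definition. $\mu\in L^\infty_w(\Omega\times[0,\infty);\mathcal{P}(W))$ with barycenters $u:=\langle\mu,s\rangle$, $y:=\langle\mu,p\rangle$ is a dissipative measure-valued solution (with initial datum $u^{\rm in}\in L^2(\Omega;[0,\infty)^n)$)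 if for all $T>0$: (1) $u\in L^\infty(0,\infty;L^2(\Omega;\mathbb{R}^n))$, $\partial_tu\in L^2(0,\infty;W^{1,4}(\Omega;\mathbb{R}^n)^* )$, $y\in L^2(\Omega_T;(L^\perp)^d)$, $y=\nabla\widehat u$, and $\langle\mu,f(s,p)\rangle=\langle\mu,f(\widehat u+P_Ls,p)\rangle$ for all $f\in C_0(W)$ (continuous functions vanishing at infinity); (2) for a.e. $t>0$: $\int_\Omega\langle\mu_{x,t},h_S(s)\rangle dx+\int_0^t\int_\Omega\langle\mu_{x,\tau},|B^{1/2}p|^2\rangle dxd\tau\le H_S(u^{\rm in})$ and $H_R(u(t))+\sum_{i=1}^n\int_0^t\int_\Omega\langle\mu_{x,\tau},s_i|(Bp)_i|^2\rangle dxd\tau\le H_R(u^{\rm in})$; (3) for all $i$ and $\phi\in C_c^1(\overline\Omega\times[0,T))$: $\int_0^T\int_\Omega u_i\partial_t\phi\,dxdt+\int_\Omega u_i^{\rm in}\phi(0)dx=\int_0^T\int_\Omega\langle\mu_{x,t},s_i(Bp)_i\rangle\cdot\nabla\phi\,dxdt$. *)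

(* Defs.v *)
From HB Require Import structures.
From mathcomp Require Import all_boot all_order all_algebra.
From mathcomp Require Import all_classical all_reals all_analysis.

Set Implicit Arguments.
Unset Strict Implicit.
Unset Printing Implicit Defensive.

Import Order.TTheory GRing.Theory Num.Theory.
Import numFieldNormedType.Exports.

Local Open Scope classical_set_scope.
Local Open Scope ring_scope.

Definition mx_display : measure_display -> measure_display.
Proof. exact. Qed.

(* Matrices carry the sigma-algebra generated by their entries, as tuples do
   in MathComp-Analysis; over R it is the Borel sigma-algebra. *)
Section matrix_measurable.
Context {dT} {T : sigmaRingType dT} (m n : nat).

Definition mx_entry_preimages : set (set 'M[T]_(m, n)) :=
  [set (fun M : 'M[T]_(m, n) => M ij.1 ij.2) @^-1` A
     | ij in [set: 'I_m * 'I_n] & A in measurable].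

Let mx_set0 : <<s mx_entry_preimages >> set0.
Proof. exact: sigma_algebra0. Qed.

Let mx_setC A : <<s mx_entry_preimages >> A -> <<s mx_entry_preimages >> (~` A).
Proof. exact: sigma_algebraC. Qed.

Let mx_bigcup (F : (set 'M[T]_(m, n))^nat) :
  (forall i, <<s mx_entry_preimages >> (F i)) ->
  <<s mx_entry_preimages >> (\bigcup_i F i).
Proof. exact: sigma_algebra_bigcup. Qed.

HB.instance Definition _ := @isMeasurable.Build (mx_display dT)
  'M[T]_(m, n) <<s mx_entry_preimages >> mx_set0 mx_setC mx_bigcup.

End matrix_measurable.

Lemma measurable_mx_entry (R : realType) m n i j :
  measurable_fun [set: 'M[R]_(m, n)] (fun M => M i j).
Proof.
move=> _ A mA; rewrite setTI; apply: sub_sigma_algebra.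
by exists (i, j) => //; exists A.
Qed.

Lemma measurable_fun_mx (R : realType) dX (X : measurableType dX) m n
    (f : X -> 'M[R]_(m, n)) :
  (forall i j, measurable_fun [set: X] (fun x => f x i j)) ->
  measurable_fun [set: X] f.
Proof.
move=> mf.
apply: (@measurability _ _ _ _ _ _ (@mx_entry_preimages _ R m n)) => //.
move=> _ [_ [[i j] _ [A mA <-]] <-].
exact: mf.
Qed.

(* Lebesgue measure on R^d, built one coordinate at a time. *)
Section lebesgue_measure_rV.
Variable R : realType.

Definition rV_cons d (z : 'rV[R]_d * R) : 'rV[R]_d.+1 :=
  row_mx (z.2)%:M z.1.

Lemma measurable_rV_cons d :
  measurable_fun [set: 'rV[R]_d * R] (@rV_cons d).
Proof.
apply: measurable_fun_mx => i j; rewrite /rV_cons.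
case: (@splitP 1 d j) => k jk.
  have -> : j = lshift d k by exact: val_inj.
  apply: (eq_measurable_fun snd) => // z _.
  by rewrite (@row_mxEl _ 1 1 d) mxE !ord1 eqxx mulr1n.
have -> : j = rshift 1 k by exact: val_inj.
apply: (eq_measurable_fun (fun z : 'rV[R]_d * R => z.1 i k)) => [z _|].
  by rewrite (@row_mxEr _ 1 1 d).
exact: (measurableT_comp (measurable_mx_entry (R := R) i k) measurable_fst).
Qed.

Section step.
Context d (mu : {measure set 'rV[R]_d -> \bar R}).

Definition rV_cons_measure : set 'rV[R]_d.+1 -> \bar R :=
  pushforward (mu \x @lebesgue_measure R)%E (@rV_cons d).

Let m0 : rV_cons_measure set0 = 0%E.
Proof. by rewrite /rV_cons_measure /pushforward preimage_set0 measure0. Qed.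

Let mge0 A : (0 <= rV_cons_measure A)%E.
Proof. by rewrite /rV_cons_measure /pushforward measure_ge0. Qed.

Let msigma : semi_sigma_additive rV_cons_measure.
Proof.
move=> F mF tF mUF; rewrite /rV_cons_measure /pushforward preimage_bigcup.
apply: measure_semi_sigma_additive.
- by move=> n; rewrite -[X in measurable X]setTI; exact: measurable_rV_cons.
- apply/trivIsetP => /= i j _ _ ij; rewrite -preimage_setI.
  by move/trivIsetP : tF => /(_ _ _ _ _ ij) ->//; rewrite preimage_set0.
- rewrite -preimage_bigcup -[X in measurable X]setTI.
  exact: measurable_rV_cons.
Qed.

HB.instance Definition _ :=
  isMeasure.Build _ _ _ rV_cons_measure m0 mge0 msigma.

End step.

Fixpoint lebesgue_measure_rV d : {measure set 'rV[R]_d -> \bar R} :=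
  match d with
  | 0 => @dirac _ 'rV[R]_0 0 R
  | d'.+1 => rV_cons_measure (lebesgue_measure_rV d')
  end.

Lemma lebesgue_measure_rV_box d (a b : 'I_d -> R) :
  (forall i, a i <= b i) ->
  lebesgue_measure_rV d [set x | forall i, x 0 i \in `]a i, b i]] =
  (\prod_i (b i - a i))%:E.
Proof.
elim: d a b => [|d IH] a b ab.
  by rewrite big_ord0 /= diracE mem_set//=; case.
rewrite big_ord_recl /= /rV_cons_measure /pushforward.
pose D := [set x : 'rV[R]_d |
  forall i, x 0 i \in `]a (lift ord0 i), b (lift ord0 i)]].
have mD : measurable D.
  have -> : D = \bigcap_(i in [set: 'I_d])
      ((fun x : 'rV[R]_d => x 0 i) @^-1` `]a (lift ord0 i), b (lift ord0 i)]).
    by apply/seteqP; split => x /= H i; [move=> _|]; exact: H.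
  apply: fin_bigcap_measurable => // i _; rewrite -[X in measurable X]setTI.
  exact: measurable_mx_entry.
have rV_cons0 z : rV_cons (d := d) z 0 ord0 = z.2.
  have -> : ord0 = lshift d ord0 :> 'I_(1 + d) by exact: val_inj.
  by rewrite /rV_cons (@row_mxEl _ 1 1 d) mxE mulr1n.
have rV_consS z i : rV_cons (d := d) z 0 (lift ord0 i) = z.1 0 i.
  have -> : lift ord0 i = rshift 1 i :> 'I_(1 + d) by exact: val_inj.
  by rewrite /rV_cons (@row_mxEr _ 1 1 d).
have -> : rV_cons (d:=d) @^-1` [set x | forall i, x 0 i \in `]a i, b i]] =
    D `*` `]a ord0, b ord0].
  apply/seteqP; split => [z /= H|z /= [Dz z0] i].
    by split => [i|]; rewrite ?rV_cons0; [rewrite -rV_consS|rewrite -rV_cons0];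
      exact: H.
  by case: (unliftP ord0 i) => [j|] ->; rewrite ?rV_cons0 ?rV_consS.
rewrite product_measure1E//.
transitivity ((\prod_(i < d) (b (lift ord0 i) - a (lift ord0 i)))%:E *
    @lebesgue_measure R `]a ord0, b ord0]%classic)%E.
  by congr (_ * _)%E; exact: IH.
rewrite lebesgue_measure_itv/= lte_fin muleC.
case: ltP => h; first by rewrite -EFinB EFinM.
have -> : b ord0 = a ord0 by apply/eqP; rewrite eq_le h ab.
by rewrite subrr mul0e mul0r.
Qed.

End lebesgue_measure_rV.

Section euclidean.
Context {R : realType}.

Definition mxdot m n (A B : 'M[R]_(m, n)) : R := \sum_i \sum_j A i j * B i j.

(* Euclidean (Frobenius) norm; the norm `|A| of the library is the maximum of
   the absolute values of the entries. *)
Definition enorm m n (A : 'M[R]_(m, n)) : R := Num.sqrt (mxdot A A).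

Definition psd n (A : 'M[R]_n) : Prop :=
  A^T = A /\ forall x : 'cV[R]_n, 0 <= (x^T *m A *m x) 0 0.

Definition psd_sqrt n (A : 'M[R]_n) : 'M[R]_n :=
  xget 0 [set Q : 'M[R]_n | psd Q /\ Q *m Q = A].

(* Subspaces of R^n are row spaces: L = ker B consists of the transposes s^T
   of the columns s such that B *m s = 0. *)
Definition kerL n (B : 'M[R]_n) : 'M[R]_n := kermx B^T.
Definition Lperp n (B : 'M[R]_n) : 'M[R]_n := kermx (kerL B)^T.

(* Orthogonal projections, acting on columns by left multiplication. *)
Definition projL n (B : 'M[R]_n) : 'M[R]_n := (proj_mx (kerL B) (Lperp B))^T.
Definition projLperp n (B : 'M[R]_n) : 'M[R]_n :=
  (proj_mx (Lperp B) (kerL B))^T.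

End euclidean.

Section function_classes.
Context {R : realType}.

(* For U open and U `<=` E `<=` closure U: f is C^1 in U, and f and its first
   derivatives extend continuously to E. *)
Definition C1 (V : normedModType R) (U E : set V) (f : V -> R) : Prop :=
  [/\ {within E, continuous f},
      forall x, U x -> differentiable f x
    & forall e : V, exists2 g : V -> R,
        {within E, continuous g} & forall x, U x -> 'D_e f x = g x].

Definition C1c (V : normedModType R) (U E : set V) (f : V -> R) : Prop :=
  C1 U E f /\
  exists K : set V, [/\ compact K, K `<=` E & forall x, (E `\` K) x -> f x = 0].

(* Continuous functions on A vanishing at infinity. *)
Definition C0 (V : topologicalType) (A : set V) (f : V -> R) : Prop :=
  {within A, continuous f} /\
  forall e, 0 < e -> exists K : set V,
    [/\ compact K, K `<=` A & forall x, (A `\` K) x -> `|f x| < e].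

Definition inLp dT (T : measurableType dT) (mu : {measure set T -> \bar R})
    (D : set T) (p : nat) m n (f : T -> 'M[R]_(m, n)) : Prop :=
  measurable_fun D f /\ (\int[mu]_(x in D) (enorm (f x) ^+ p)%:E < +oo)%E.

Definition grad d (f : 'rV[R]_d -> R) (x : 'rV[R]_d) : 'rV[R]_d :=
  \row_j 'D_(delta_mx 0 j) f x.

Definition jac d n (F : 'rV[R]_d -> 'cV[R]_n) (x : 'rV[R]_d) : 'M[R]_(n, d) :=
  \matrix_(i, j) 'D_(delta_mx 0 j) (fun y => F y i 0) x.

(* Near each boundary point, after a rotation O of the axes, D is the region
   above the graph of a Lipschitz function of all coordinates but the j-th. *)
Definition lipschitz_domain d (D : set 'rV[R]_d) : Prop :=
  [/\ open D, connected D, D !=set0, bounded_set D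
    & forall x0, (closure D `\` D) x0 ->
      exists (O : 'M[R]_d) (j : 'I_d) (g : 'rV[R]_d.-1 -> R),
        [/\ O *m O^T = 1%:M, lipschitz g
          & \forall x \near x0,
              D x <-> g (col' j (x *m O)) < (x *m O) 0 j]].

End function_classes.

Section cross_diffusion.
Context {R : realType} {d n : nat}.
Variables (Omega : set 'rV[R]_d) (B : 'M[R]_n).

Let leb : {measure set 'rV[R]_d -> \bar R} := lebesgue_measure_rV R d.
Let lebt : {sigma_finite_measure set (measurableTypeR R) -> \bar R} :=
  @lebesgue_measure R.
Let lebxt : {measure set ('rV[R]_d * measurableTypeR R) -> \bar R} :=
  (leb \x lebt)%E.

Definition positive_weak_solution (T : R) (v : 'rV[R]_d * R -> 'cV[R]_n) :
    Prop :=
  [/\ forall i, C1 (Omega `*` `]0, T[) (closure Omega `*` `[0, T])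
        (fun z => v z i 0),
      forall z, (closure Omega `*` `[0, T]) z -> forall i, 0 < v z i 0
    & forall t, 0 < t < T -> forall phi, C1 Omega (closure Omega) phi ->
        forall i,
        \int[leb]_(x in Omega) (derive1 (fun r => v (x, r) i 0) t * phi x) =
        - \int[leb]_(x in Omega)
            (v (x, t) i 0 *
             mxdot (row i (jac (fun y => B *m v (y, t)) x)) (grad phi x))].

Definition state_space : set ('cV[R]_n * 'M[R]_(n, d)) :=
  [set w : 'cV[R]_n * 'M[R]_(n, d) |
     (forall i, 0 <= w.1 i 0) /\ (w.2^T <= Lperp B)%MS].

Definition young_measure
    (mu : 'rV[R]_d * R -> probability ('cV[R]_n * 'M[R]_(n, d))%type R) :
    Prop :=
  (forall z, (Omega `*` `[0, +oo[) z -> mu z state_space = 1%E) /\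
  (forall f, C0 state_space f ->
    measurable_fun
      (Omega `*` `[0, +oo[ : set ('rV[R]_d * measurableTypeR R))
      (fun z => \int[mu z]_(w in state_space) f w)).

Definition hS (s : 'cV[R]_n) : R := \sum_i (s i 0 * (ln (s i 0) - 1) + 1).

Definition HS (u : 'rV[R]_d -> 'cV[R]_n) : \bar R :=
  (\int[leb]_(x in Omega) (hS (u x))%:E)%E.

Definition HR (u : 'rV[R]_d -> 'cV[R]_n) : \bar R :=
  (2^-1%:E * \int[leb]_(x in Omega)
               (\sum_i \sum_j B i j * u x i 0 * u x j 0)%:E)%E.

(* g is the weak gradient of f in Omega. *)
Definition weak_jac (f : 'rV[R]_d -> 'cV[R]_n) (g : 'rV[R]_d -> 'M[R]_(n, d)) :
    Prop :=
  forall phi, C1c Omega Omega phi -> forall i j,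
    \int[leb]_(x in Omega) (f x i 0 * grad phi x 0 j) =
    - \int[leb]_(x in Omega) (g x i j * phi x).

(* phi is in W^{1,4}(Omega; R^n), with weak gradient g. *)
Definition inW14 (phi : 'rV[R]_d -> 'cV[R]_n) (g : 'rV[R]_d -> 'M[R]_(n, d)) :
    Prop :=
  [/\ inLp leb Omega 4 phi, inLp leb Omega 4 g & weak_jac phi g].

Definition W14_norm (phi : 'rV[R]_d -> 'cV[R]_n)
    (g : 'rV[R]_d -> 'M[R]_(n, d)) : R :=
  (\int[leb]_(x in Omega) (enorm (phi x) ^+ 4) +
   \int[leb]_(x in Omega) (enorm (g x) ^+ 4)) `^ 4^-1.

(* l is a linear functional on W^{1,4}(Omega; R^n) of dual norm at most M. *)
Definition W14_functional (l : ('rV[R]_d -> 'cV[R]_n) -> R) (M : R) : Prop :=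
  (forall a phi g phi' g', inW14 phi g -> inW14 phi' g' ->
    l (fun x => a *: phi x + phi' x) = a * l phi + l phi') /\
  (forall phi g, inW14 phi g -> `|l phi| <= M * W14_norm phi g).

(* The distributional time derivative of u is represented by some xi in
   L^2(0, oo; W^{1,4}(Omega; R^n)^* ); as W^{1,4} is separable and reflexive,
   weak* measurability of xi is strong measurability. *)
Definition time_derivative_in_L2_W14dual (u : 'rV[R]_d * R -> 'cV[R]_n) :
    Prop :=
  exists (xi : R -> ('rV[R]_d -> 'cV[R]_n) -> R) (m : R -> R),
    [/\ measurable_fun (`]0, +oo[ : set (measurableTypeR R)) m /\
          (\int[lebt]_(t in `]0%R, +oo[) (m t ^+ 2)%:E < +oo)%E,
        forall phi g, inW14 phi g ->
          measurable_fun (`]0, +oo[ : set (measurableTypeR R)) (xi ^~ phi),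
        {ae lebt, forall t, 0 < t -> W14_functional (xi t) (m t)}
      & forall phi g psi, inW14 phi g -> @C1c R R `]0, +oo[ `]0, +oo[ psi ->
          \int[lebt]_(t in `]0, +oo[)
            ((\int[leb]_(x in Omega) mxdot (u (x, t)) (phi x)) * derive1 psi t) =
          - \int[lebt]_(t in `]0, +oo[) (xi t phi * psi t)].

Section dissipative.
Variables (uin : 'rV[R]_d -> 'cV[R]_n)
  (mu : 'rV[R]_d * R -> probability ('cV[R]_n * 'M[R]_(n, d))%type R).

Definition bary_s (z : 'rV[R]_d * R) : 'cV[R]_n :=
  \col_i \int[mu z]_(w in state_space) w.1 i 0.
Definition bary_p (z : 'rV[R]_d * R) : 'M[R]_(n, d) :=
  \matrix_(i, j) \int[mu z]_(w in state_space) w.2 i j.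

Let u := bary_s.
Let y := bary_p.
Let uhat z := projLperp B *m u z.

(* In the last clause uhat + P_L s may leave [0, oo)^n: f is extended by 0
   outside the state space. *)
Definition dissipative_regularity (T : R) : Prop :=
  [/\ measurable_fun
        (Omega `*` `]0, +oo[ : set ('rV[R]_d * measurableTypeR R)) u /\
        (exists M : R, {ae lebt, forall t, 0 < t ->
          (\int[leb]_(x in Omega) (enorm (u (x, t)) ^+ 2)%:E <= M%:E)%E}),
      time_derivative_in_L2_W14dual u,
      inLp lebxt (Omega `*` `]0, T[) 2 y /\
        {ae lebxt, forall z, (Omega `*` `]0, T[) z ->
          ((y z)^T <= Lperp B)%MS},
      (forall phi, C1c (Omega `*` `]0, T[) (Omega `*` `]0, T[) phi ->
        forall i j,
        \int[lebt]_(t in `]0, T[) \int[leb]_(x in Omega)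
          (uhat (x, t) i 0 * grad (fun a => phi (a, t)) x 0 j) =
        - \int[lebt]_(t in `]0, T[) \int[leb]_(x in Omega)
            (y (x, t) i j * phi (x, t)))
    & forall f, C0 state_space f ->
        {ae lebxt, forall z, (Omega `*` `]0, +oo[) z ->
          \int[mu z]_(w in state_space) f w =
          \int[mu z]_(w in state_space)
            (f \_ state_space) (uhat z + projL B *m w.1, w.2)}].

Definition dissipative_entropy : Prop :=
  {ae lebt, forall t, 0 < t ->
    (\int[leb]_(x in Omega) \int[mu (x, t)]_(w in state_space) (hS w.1)%:E
     + \int[lebt]_(tau in `]0%R, t[) \int[leb]_(x in Omega)
         \int[mu (x, tau)]_(w in state_space)
           (enorm (psd_sqrt B *m w.2) ^+ 2)%:E
     <= HS uin)%E /\
    (HR (fun x => u (x, t))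
     + \sum_(i < n) \int[lebt]_(tau in `]0%R, t[) \int[leb]_(x in Omega)
         \int[mu (x, tau)]_(w in state_space)
           (w.1 i 0 * enorm (row i (B *m w.2)) ^+ 2)%:E
     <= HR uin)%E}.

Definition dissipative_equation (T : R) : Prop :=
  forall i phi, C1c (Omega `*` `]0, T[) (closure Omega `*` `[0, T[) phi ->
    \int[lebt]_(t in `]0, T[) \int[leb]_(x in Omega)
      (u (x, t) i 0 * derive1 (fun r => phi (x, r)) t)
    + \int[leb]_(x in Omega) (uin x i 0 * phi (x, 0)) =
    \int[lebt]_(t in `]0, T[) \int[leb]_(x in Omega)
      mxdot
        (\row_j \int[mu (x, t)]_(w in state_space)
           (w.1 i 0 * (B *m w.2) i j))
        (grad (fun a => phi (a, t)) x).

Definition dissipative_mv_solution : Prop :=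
  young_measure mu /\
  forall T, 0 < T ->
    [/\ dissipative_regularity T, dissipative_entropy
      & dissipative_equation T].

End dissipative.
End cross_diffusion.

(* Main.v *)
From HB Require Import structures.
Require Import Defs.
From mathcomp Require Import all_boot all_order all_algebra.
From mathcomp Require Import spectral complex.
From mathcomp Require Import all_classical all_reals all_analysis.
From mathcomp Require Import measurable_realfun ring lra.
Import Order.TTheory GRing.Theory Num.Theory.
Import numFieldNormedType.Exports.
Local Open Scope classical_set_scope.
Local Open Scope ring_scope.
Set Implicit Arguments.
Unset Strict Implicit.
Unset Printing Implicit Defensive.

(** The proof compares the two solutions through the relative entropy
      < sum_i h(s_i | v_i) > + 1/2 (u - v) . B (u - v),
    where h(s | v) = s log (s / v) - s + v, < > is the mean with respect to the
    Young measure at a point, and u = < s >. It adds up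
    - the two entropy inequalities of the measure-valued solution,
    - the equation for u tested with theta_i = log v_i + (B v)_i, the variational
      derivative of the total entropy at v,
    - the identity d_t b = v . d_t theta for b = sum_i (v_i - 1) + 1/2 v . B v.
    The initial values cancel, and the dissipation and the fluxes form, up to the
    terms (u_i - v_i) d_t theta_i, a quadratic expression in B (p - grad v).

    The time derivative of theta is the delicate point. Formally
      d_t theta_i = div F_i + grad (B v)_i . grad log v_i,
      F = B (grad v + diag(v) B grad v),
    but v is only C^1, so div F is merely the function g for which
    [g phi] = - [F . grad phi] for every phi that is C^1 up to the boundary
    ([weak_div_source]). Pairing it with u, which is only integrable, is the
    Green identity [green]. It holds because the columns of F lie in the range of
    B: the pairing sees only the projection of u to that range, whose weak
    gradient is < p >. The weak gradient is tested with functions of compact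
    support only, the weak divergence with functions that need not vanish on the
    boundary; mollifying along a cone of inward directions, available at each
    boundary point of a Lipschitz domain ([inward_coneP]), reconciles the two
    ([green_chart]), and a partition of unity globalises.

    What remains after this is the mean of
      - (p - P) : B (p - P) - sum_i s_i |q_i - Q_i|^2
      + sum_i (s_i - v_i) (q_i - Q_i) . (grad log v_i - Q_i),
    where q = B p, Q = B grad v and P is grad v projected to the range of B. As
    h(s | v) dominates (sqrt s - sqrt v)^2, this is at most
    C sum_i h(s_i | v_i) - 1/2 (p - P) : B (p - P) ([remainder_bound]).

    In place of a Gronwall argument at almost every time, everything is
    integrated against psi(t) = ((t0 - t)^+)^m with t0 < T. For m > C t0 one has
    C psi < - psi' on (0, t0) ([dpsi_beats]), so that a nonnegative integrand has
    a nonpositive integral ([rel_energy_inequality], [integrand_ge0]). Hence, for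
    almost every (x, t) with t < t0, h(s_i | v_i) = 0 and (p - P) : B (p - P) = 0
    almost surely; the form of B is definite on its range, so s = v and p = P
    ([concentration]). *)

(** * Square roots, row bounds and the range of a positive semidefinite matrix *)

Section LinearAlgebra.
Context {R : realType}.

Lemma mxdotE m n (A B : 'M[R]_(m, n)) : mxdot A B = \tr (A^T *m B).
Proof.
rewrite /mxdot /mxtrace exchange_big /=; apply: eq_bigr => j _.
by rewrite mxE; apply: eq_bigr => i _; rewrite mxE.
Qed.

Lemma mxdotC m n (A B : 'M[R]_(m, n)) : mxdot A B = mxdot B A.
Proof. by rewrite /mxdot; do 2![apply: eq_bigr => ? _]; rewrite mulrC. Qed.

Lemma mxdotDl m n (A B C : 'M[R]_(m, n)) :
  mxdot (A + B) C = mxdot A C + mxdot B C.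
Proof. by rewrite !mxdotE linearD mulmxDl mxtraceD. Qed.

Lemma mxdotNl m n (A C : 'M[R]_(m, n)) : mxdot (- A) C = - mxdot A C.
Proof. by rewrite !mxdotE linearN mulNmx raddfN. Qed.

Lemma mxdotDr m n (A B C : 'M[R]_(m, n)) :
  mxdot C (A + B) = mxdot C A + mxdot C B.
Proof. by rewrite mxdotC mxdotDl ![mxdot _ C]mxdotC. Qed.

Lemma mxdotNr m n (A C : 'M[R]_(m, n)) : mxdot C (- A) = - mxdot C A.
Proof. by rewrite mxdotC mxdotNl mxdotC. Qed.

Lemma mxdot_ge0 m n (A : 'M[R]_(m, n)) : 0 <= mxdot A A.
Proof. by do 2![apply: sumr_ge0 => ? _]; rewrite -expr2 sqr_ge0. Qed.

Lemma mxdot_eq0 m n (A : 'M[R]_(m, n)) : mxdot A A = 0 -> A = 0.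
Proof.
move=> A0; apply/matrixP => i j; rewrite mxE; apply/eqP; rewrite -sqrf_eq0 expr2.
have /psumr_eq0P A0' : forall i, true -> 0 <= \sum_j A i j * A i j.
  by move=> k _; apply: sumr_ge0 => ? _; rewrite -expr2 sqr_ge0.
have /psumr_eq0P : forall j, true -> 0 <= A i j * A i j.
  by move=> k _; rewrite -expr2 sqr_ge0.
by move/(_ (A0' A0 i isT)) => /(_ j isT) ->.
Qed.

Lemma enorm2 m n (A : 'M[R]_(m, n)) : enorm A ^+ 2 = mxdot A A.
Proof. by rewrite /enorm sqr_sqrtr ?mxdot_ge0. Qed.

Lemma mxdot_mull m n k (A : 'M[R]_(m, n)) (B : 'M[R]_(n, k)) (C : 'M[R]_(m, k)) :
  mxdot (A *m B) C = mxdot B (A^T *m C).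
Proof. by rewrite !mxdotE trmx_mul mulmxA. Qed.

(** Interpolation produces a real polynomial taking prescribed values on a
    finite set; evaluated at a real symmetric matrix it stays real, which is
    what brings the complex spectral theorem back to the reals. *)
Lemma real_interpolation (f : R -> R) (s : seq R) :
  exists p : {poly R}, forall x, x \in s -> p.[x] = f x.
Proof.
elim: s => [|a s [p ps]]; first by exists 0.
have [as_|aNs] := boolP (a \in s).
  by exists p => x; rewrite inE => /orP[/eqP ->|]; exact: ps.
pose q := \prod_(b <- s) ('X - b%:P).
have qa : q.[a] != 0.
  by rewrite -[_ != 0]/(~~ root q a) root_prod_XsubC.
exists (p + ((f a - p.[a]) / q.[a]) *: q) => x; rewrite inE => /orP[/eqP ->|xs].
  by rewrite !hornerE divfK// addrC subrK.
rewrite !hornerE ps//; have /rootP -> : root q x by rewrite root_prod_XsubC.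
by rewrite mulr0 addr0.
Qed.

Local Notation toC := (real_complex R).

Lemma complex_form_Re_ge0 n (A : 'M[R]_n) (w : 'rV[R[i]]_n) : psd A ->
  0 <= complex.Re ((w *m map_mx toC A *m (map_mx conjc w)^T) 0 0).
Proof.
move=> [Asym Apos].
pose a : 'cV[R]_n := \col_i complex.Re (w 0 i).
pose b : 'cV[R]_n := \col_i complex.Im (w 0 i).
suff -> : complex.Re ((w *m map_mx toC A *m (map_mx conjc w)^T) 0 0) =
    (a^T *m A *m a) 0 0 + (b^T *m A *m b) 0 0 by rewrite addr_ge0.
rewrite !mxE raddf_sum -big_split /=; apply: eq_bigr => i _.
rewrite !mxE !mulr_suml raddf_sum -big_split /=; apply: eq_bigr => j _.
rewrite !mxE; case: (w 0 j) (w 0 i) => [x1 y1] [x2 y2] /=; ring.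
Qed.

(** Diagonalise over the complex numbers and interpolate the square root on
    the spectrum: the root is a real polynomial in A, hence real itself. *)
Lemma psd_sqrt_exists n (A : 'M[R]_n) : psd A ->
  exists Q : 'M[R]_n, psd Q /\ Q *m Q = A.
Proof.
case: n A => [|n] A Apsd.
  exists 0; split; last by apply/matrixP => -[].
  split=> [|x]; first by apply/matrixP => -[].
  by rewrite mulmx0 mul0mx mxE.
have [Asym Apos] := Apsd.
pose AC := map_mx toC A.
have ACsym : AC \is symmetricmx.
  by apply/is_hermitianmxP; rewrite expr0 scale1r map_mx_id // map_trmx Asym.
have ACreal : AC \is a realmx.
  by apply/mxOverP => i j; rewrite mxE; apply/complex_realP; exists (A i j).
have ACh : AC \is hermsymmx by exact: realsym_hermsym.
have spreal := hermitian_spectral_diag_real ACh.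
have /orthomx_spectralP ACE : AC \is normalmx by exact: hermitian_normalmx.
have Pu := spectral_unitarymx AC.
have Punit := spectral_unit AC.
set P := spectralmx AC in ACE Pu Punit; set sp := spectral_diag AC in ACE spreal.
have spE j : sp 0 j = (complex.Re (sp 0 j))%:C%C.
  by move/mxOverP : spreal => /(_ 0 j) /RRe_real ->.
have sp_ge0 j : 0 <= complex.Re (sp 0 j).
  have := complex_form_Re_ge0 (row j P) Apsd; rewrite -/AC.
  suff -> : (row j P *m AC *m (map_mx conjc (row j P))^T) 0 0 = sp 0 j by [].
  have -> : (map_mx conjc (row j P))^T = col j (P^t*)%sesqui.
    by apply/matrixP => x y; rewrite !mxE.
  rewrite -!row_mul -invmx_unitary// ACE !mulmxA mulmxV// mul1mx.
  by rewrite colE mulmxA mulmxK// -colE !mxE eqxx mulr1n.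
have [p pE] := real_interpolation (fun x => Num.sqrt (Num.sqrt x))
  [seq complex.Re (sp 0 j) | j <- enum 'I_n.+1].
pose M := horner_mx A p.
have MA : M ^+ 4 = A.
  rewrite /M -rmorphXn; apply: (@map_mx_inj _ _ toC); rewrite map_horner_mx -/AC.
  rewrite [in LHS]ACE horner_mx_uconjC// [in RHS]ACE horner_mx_diag.
  congr (_ *m diag_mx _ *m _); apply/rowP => j; rewrite mxE spE horner_map/=.
  rewrite horner_exp pE; last by apply/mapP; exists j; rewrite ?mem_enum.
  by rewrite (exprM _ 2 2) sqr_sqrtr ?sqrtr_ge0// sqr_sqrtr.
have Msym : M^T = M.
  rewrite /M; elim/poly_ind: (p) => [|r c IH]; first by rewrite rmorph0 trmx0.
  rewrite rmorphD rmorphM /= horner_mx_X horner_mx_C linearD /= tr_scalar_mx.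
  rewrite trmx_mul IH Asym; congr (_ + _).
 by have := comm_horner_mx2 A 'X r; rewrite horner_mx_X.
exists (M *m M); split; last by rewrite -[LHS]/(M * M * (M * M)) -!expr2 -exprM MA.
split=> [|x]; first by rewrite trmx_mul Msym.
rewrite mulmxA -mulmxA -[in X in X *m _]Msym -trmx_mul mxE; apply: sumr_ge0 => i _.
by rewrite !mxE -expr2 sqr_ge0.
Qed.

Lemma psd_sqrtP n (A : 'M[R]_n) : psd A ->
  psd (psd_sqrt A) /\ psd_sqrt A *m psd_sqrt A = A.
Proof. by move=> /psd_sqrt_exists[Q hQ]; rewrite /psd_sqrt; case: xgetP => [_ _ //|/(_ Q)]. Qed.

Lemma enorm_psd_sqrt n k (B : 'M[R]_n) (p : 'M[R]_(n, k)) : psd B ->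
  enorm (psd_sqrt B *m p) ^+ 2 = mxdot p (B *m p).
Proof.
move=> /psd_sqrtP[[Qsym _] QQ].
by rewrite enorm2 mxdot_mull Qsym mulmxA QQ.
Qed.

Lemma psd_mxdot_ge0 n k (B : 'M[R]_n) (p : 'M[R]_(n, k)) : psd B ->
  0 <= mxdot p (B *m p).
Proof. by move=> pB; rewrite -enorm_psd_sqrt// sqr_ge0. Qed.

(** Cauchy-Schwarz for the form of B, applied to the basis vector e_i. *)
Lemma psd_row_bound n k (B : 'M[R]_n) (X : 'M[R]_(n, k)) i : psd B ->
  mxdot (row i (B *m X)) (row i (B *m X)) <= B i i * mxdot X (B *m X).
Proof.
move=> Bpsd; have [Qpsd QQ] := psd_sqrtP Bpsd; have [Qsym _] := Qpsd.
set Q := psd_sqrt B in QQ Qsym Qpsd.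
have -> : mxdot X (B *m X) = mxdot (Q *m X) (Q *m X).
  by rewrite mxdot_mull Qsym mulmxA QQ.
have -> : B i i = \sum_k Q i k ^+ 2.
  rewrite -QQ mxE; apply: eq_bigr => j _; rewrite expr2.
  by rewrite -[in X in _ * X]Qsym mxE.
rewrite -QQ -mulmxA; move: (Q *m X) => Y; rewrite row_mul.
rewrite /mxdot big_ord1 [X in _ <= _ * X]exchange_big mulr_sumr.
apply: ler_sum => j _; rewrite !mxE.
have CS (I : finType) (a b : I -> R) :
    (\sum_k a k * b k) * (\sum_k a k * b k) <= (\sum_k a k ^+ 2) * \sum_k b k * b k.
  rewrite -subr_ge0.
  suff -> : (\sum_k a k ^+ 2) * (\sum_k b k * b k) -
      (\sum_k a k * b k) * (\sum_k a k * b k) =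
      2^-1 * \sum_k \sum_l (a k * b l - a l * b k) ^+ 2.
    by rewrite mulr_ge0// ?invr_ge0//; do 2![apply: sumr_ge0 => ? _]; rewrite sqr_ge0.
  have -> : \sum_k \sum_l (a k * b l - a l * b k) ^+ 2 =
     \sum_k \sum_l (a k ^+ 2 * (b l * b l)) + \sum_k \sum_l (a l ^+ 2 * (b k * b k))
     - 2 * \sum_k \sum_l ((a k * b k) * (a l * b l)).
    rewrite mulr_sumr -big_split -sumrB /=; apply: eq_bigr => x _.
    rewrite mulr_sumr -big_split -sumrB /=; apply: eq_bigr => y _; ring.
  rewrite [X in _ + X - _]exchange_big /= !mulr_suml.
  under [X in _ = 2^-1 * (X + _ - _)]eq_bigr do rewrite -mulr_sumr.
  under [X in _ = 2^-1 * (_ + X - _)]eq_bigr do rewrite -mulr_sumr.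
  under [X in _ = 2^-1 * (_ - 2 * X)]eq_bigr do rewrite -mulr_sumr.
  lra.
have -> : \sum_k row i Q ord0 k * Y k j = \sum_k Q i k * Y k j.
  by apply: eq_bigr => l _; rewrite mxE.
exact: (CS _ (fun k => Q i k) (fun k => Y k j)).
Qed.

Section projections.
Context n (B : 'M[R]_n).

Lemma kerL_Lperp0 : (kerL B :&: Lperp B = 0)%MS.
Proof.
apply/eqP/rowV0P => w; rewrite sub_capmx => /andP[/submxP[a wE] /sub_kermxP w0].
have : w *m w^T = 0 by rewrite {2}wE trmx_mul mulmxA w0 mul0mx.
move/matrixP/(_ 0 0); rewrite !mxE => ww0; apply: mxdot_eq0.
by rewrite /mxdot big_ord1 -[RHS]ww0; apply: eq_bigr => j _; rewrite mxE.
Qed.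

Lemma Lperp_kerL_full : (1%:M <= Lperp B + kerL B)%MS.
Proof.
rewrite sub1mx; apply/eqP.
have := mxrank_sum_cap (Lperp B) (kerL B).
rewrite capmxC kerL_Lperp0 mxrank0 addn0 => ->.
by rewrite /Lperp mxrank_ker mxrank_tr subnK// rank_leq_row.
Qed.

Lemma mul_projLperp : B *m projLperp B = B.
Proof.
apply: trmx_inj; rewrite trmx_mul trmxK.
set pr := proj_mx _ _.
have := @add_proj_mx _ _ _ _ _ 1%:M _ Lperp_kerL_full.
rewrite capmxC kerL_Lperp0 => /(_ erefl); rewrite !mul1mx -/pr => E.
rewrite -[RHS]mul1mx -E mulmxDl.
have /submxP[a ->] : (proj_mx (kerL B) (Lperp B) <= kerL B)%MS.
  by rewrite -[proj_mx _ _]mul1mx proj_mx_sub.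
by rewrite -[a *m _ *m _]mulmxA mulmx_ker mulmx0 addr0.
Qed.

Lemma projLperp_sub k (X : 'M[R]_(n, k)) : ((projLperp B *m X)^T <= Lperp B)%MS.
Proof. by rewrite trmx_mul trmxK proj_mx_sub. Qed.

(** The form of B only vanishes on the kernel of B, which meets its orthogonal
    complement trivially. *)
Lemma Lperp_form_eq0 k (X : 'M[R]_(n, k)) : psd B ->
  (X^T <= Lperp B)%MS -> mxdot X (B *m X) = 0 -> X = 0.
Proof.
move=> Bpsd XL X0; apply: trmx_inj; rewrite trmx0; apply/eqP.
rewrite -submx0 -kerL_Lperp0 sub_capmx XL andbT; apply/sub_kermxP.
rewrite -trmx_mul; apply: trmx_inj; rewrite trmxK trmx0.
apply/row_matrixP => i; rewrite row0; apply: mxdot_eq0; apply/eqP.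
by rewrite eq_le mxdot_ge0 andbT (le_trans (psd_row_bound _ _ Bpsd))// X0 mulr0.
Qed.

End projections.

End LinearAlgebra.

(** * Lebesgue measure on row vectors *)

Section LebesgueRV.
Context {R : realType}.

Definition mpreserving d (T : measurableType d) (m : set T -> \bar R)
    (f : T -> T) : Prop :=
  measurable_fun setT f /\ forall A, measurable A -> m (f @^-1` A) = m A.

Lemma mpreserving_prod d1 d2 (T1 : measurableType d1) (T2 : measurableType d2)
    (m1 : {sigma_finite_measure set T1 -> \bar R})
    (m2 : {sigma_finite_measure set T2 -> \bar R}) f1 f2 :
  mpreserving m1 f1 -> mpreserving m2 f2 ->
  mpreserving (m1 \x m2)%E (fun z => (f1 z.1, f2 z.2)).
Proof.
move=> [mf1 pf1] [mf2 pf2].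
have mf : measurable_fun setT (fun z : T1 * T2 => (f1 z.1, f2 z.2)).
  by apply: measurable_fun_pair; apply: measurableT_comp.
split => // A mA; apply/esym.
rewrite (@product_measure_unique _ _ _ _ _ m1 m2
  (pushforward (m1 \x m2)%E (fun z => (f1 z.1, f2 z.2))))//.
move=> A1 A2 mA1 mA2.
transitivity ((m1 \x m2)%E ((f1 @^-1` A1) `*` (f2 @^-1` A2))) => //.
have m1A : measurable (f1 @^-1` A1) by rewrite -[X in measurable X]setTI; exact: mf1.
have m2A : measurable (f2 @^-1` A2) by rewrite -[X in measurable X]setTI; exact: mf2.
by rewrite product_measure1E//; congr (_ * _)%E; [exact: pf1|exact: pf2].
Qed.

Lemma mpreserving_shift (a : R) :
  mpreserving (@lebesgue_measure R) (fun x : measurableTypeR R => (x + a : measurableTypeR R)).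
Proof.
have ms : measurable_fun setT (fun x : measurableTypeR R => (x + a : measurableTypeR R)).
  exact: (@measurable_funD _ _ _ setT (fun x : measurableTypeR R => x) (cst a)).
split => // A mA.
rewrite [RHS](@lebesgue_measure_unique _
   (pushforward (@lebesgue_measure R) (fun x : measurableTypeR R => (x + a : measurableTypeR R))))//.
move=> _ [[x y] _ <-].
transitivity (@lebesgue_measure R `](x - a), (y - a)]%classic); last first.
  congr (lebesgue_measure _); apply/seteqP.
  by split=> z /=; rewrite !in_itv/= lerBrDr ltrBlDr.
rewrite !lebesgue_measure_itv/= !lte_fin ltrD2r; case: ifP => // _.
by rewrite -!EFinD; congr EFin; ring.
Qed.

Lemma lebesgue_measure_rV_sigma_finite d :
  sigma_finite setT (lebesgue_measure_rV R d).
Proof.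
exists (fun k => [set x : 'rV[R]_d | forall i, x 0 i \in `](- k%:R), k%:R]]).
  apply/esym/seteqP; split => // x _.
  exists (Num.truncn `|x|).+1 => //= i.
  have : `|x 0 i| < (Num.truncn `|x|).+1%:R.
    apply: le_lt_trans (truncnS_gt _).
    by rewrite [leRHS]/Num.Def.normr/= mx_normrE (le_bigmax _ (fun ij : 'I_1 * 'I_d => `|x ij.1 ij.2|) (0, i)).
  by rewrite in_itv/= ltr_norml => /andP[-> /ltW].
move=> k; split; last first.
  rewrite lebesgue_measure_rV_box ?ltry// => i.
  by rewrite (le_trans (_ : _ <= 0))// ?oppr_le0.
rewrite (_ : mkset _ = \bigcap_(i in [set: 'I_d])
      ((fun x : 'rV[R]_d => x 0 i) @^-1` `](- k%:R), k%:R])).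
  apply: fin_bigcap_measurable => // i _; rewrite -[X in measurable X]setTI.
  exact: measurable_mx_entry.
by apply/seteqP; split => x /= H i; [move=> _|]; exact: H.
Qed.

Definition lebV d : set 'rV[R]_d -> \bar R := lebesgue_measure_rV R d.

HB.instance Definition _ d := Measure.on (@lebV d).
HB.instance Definition _ d := Measure_isSigmaFinite.Build _ _ _ (@lebV d)
  (lebesgue_measure_rV_sigma_finite d).

Lemma mpreserving_rV_shift d (a : 'rV[R]_d) :
  mpreserving (@lebV d) (fun x => x + a).
Proof.
have ms k (b : 'rV[R]_k) : measurable_fun setT (fun x : 'rV[R]_k => x + b).
  apply: measurable_fun_mx => i j.
  under eq_fun do rewrite mxE.
  by apply: measurable_funD => //; exact: measurable_mx_entry.
split; first exact: ms.
elim: d a => [|d IH] a A mA.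
  apply: (congr1 (@lebV 0)); apply/seteqP.
  by split=> x /=; rewrite [x + a]thinmx0 [x]thinmx0.
rewrite /lebV /= /rV_cons_measure /pushforward.
pose a' : 'rV[R]_d := \row_i a 0 (lift ord0 i).
have mA' : measurable (@rV_cons R d @^-1` A).
  by rewrite -[X in measurable X]setTI; exact: measurable_rV_cons.
have := mpreserving_prod (conj (ms _ a') (IH a')) (mpreserving_shift (a 0 ord0)).
move=> [_ /(_ _ mA')]; apply: etrans.
suff -> : rV_cons (R := R) (d := d) @^-1` ((fun x => x + a) @^-1` A) = (fun z => (z.1 + a', z.2 + a 0 ord0)) @^-1` (rV_cons (R := R) (d := d) @^-1` A) by [].
apply/seteqP.
suff E z : rV_cons z + a = rV_cons (z.1 + a', (z.2 + a 0 ord0) : R).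
  by split => z /=; rewrite E.
apply/rowP => i; rewrite mxE; case: (unliftP ord0 i) => [j|] ->.
  have -> : lift ord0 j = rshift 1 j :> 'I_(1 + d) by exact: val_inj.
  rewrite /rV_cons !(@row_mxEr _ 1 1 d) !mxE; congr (_ + a _ _).
  exact: val_inj.
have -> : ord0 = lshift d ord0 :> 'I_(1 + d) by exact: val_inj.
rewrite /rV_cons !(@row_mxEl _ 1 1 d) !mxE !mulr1n; congr (_ + a _ _).
Qed.

End LebesgueRV.

(** * Borel measurability of continuous functions *)

Section MeasurableOpen.
Context {R : realType}.

Lemma mpreserving_ge0_integral d (T : measurableType d) (m : {measure set T -> \bar R})
    (phi : T -> T) (f : T -> \bar R) :
  mpreserving m phi -> measurable_fun setT f -> (forall x, 0 <= f x)%E ->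
  (\int[m]_x f (phi x) = \int[m]_x f x)%E.
Proof.
move=> [mphi pphi] mf f0.
transitivity (\int[pushforward m phi]_x f x)%E; first by rewrite (ge0_integral_pushforward mphi).
by apply: eq_measure_integral => A mA _; exact: pphi.
Qed.

(** An open set is the union of the balls it contains with centre in a countable
    dense set and radius 1/k. *)
Lemma open_measurable_balls d (T : measurableType d) (I : countType)
    (c : I -> T) (B : T -> R -> set T) (U : set T) :
  (forall x e, 0 < e -> exists i, B x e (c i)) ->
  (forall i e, measurable (B (c i) e)) ->
  (forall x y e, B x e y -> B y e x) ->
  (forall x y z e1 e2, B x e1 y -> B y e2 z -> B x (e1 + e2) z) ->
  (forall x e1 e2 y, e1 <= e2 -> B x e1 y -> B x e2 y) ->
  (forall x, U x -> exists2 e, 0 < e & B x e `<=` U) ->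
  measurable U.
Proof.
move=> Bd mB Bs Bt Bm Uo.
pose F (ik : I * nat) := if pselect (B (c ik.1) ik.2.+1%:R^-1 `<=` U)
  then B (c ik.1) ik.2.+1%:R^-1 else set0.
have -> : U = \bigcup_ik F ik.
  apply/seteqP; split => [x Ux|x [[i k] _]]; last first.
    by rewrite /F; case: pselect => //= BU; exact: BU.
  have [e e0 BU] := Uo x Ux.
  pose k := Num.truncn (e^-1 * 2).
  have ke : k.+1%:R^-1 + k.+1%:R^-1 <= e.
    have : e^-1 * 2 < k.+1%:R by exact: truncnS_gt.
    rewrite mulrC ltr_pdivrMr// => /ltW k2.
    have -> : k.+1%:R^-1 + k.+1%:R^-1 = 2 / k.+1%:R :> R by ring.
    by rewrite ler_pdivrMr ?ltr0n// mulrC.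
  have [i Bxi] := Bd x k.+1%:R^-1 ltac:(by rewrite invr_gt0).
  exists (i, k) => //; rewrite /F; case: pselect => [BU'|]; first exact: Bs.
  by case=> y /= Biy; apply: BU; apply: (Bm _ _ _ _ ke (Bt _ _ _ _ _ Bxi Biy)).
apply: countable_bigcupT_measurable; first exact: countableP.
move=> -[i k]; rewrite /F /=.
by case: (pselect _) => H; [exact: mB|exact: measurable0].
Qed.

Lemma rat_mx_dense m n (M : 'M[R]_(m, n)) (e : R) : 0 < e ->
  exists Q : 'M[rat]_(m, n), ball M e (map_mx ratr Q).
Proof.
move=> e0.
have H i j : exists q : rat, ball (M i j) e (ratr q : R).
  have [q] := @rat_in_itvoo R (M i j - e) (M i j + e) ltac:(lra).
  by rewrite in_itv/= => qM; exists q; rewrite /ball/= ltr_norml; lra.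
pose Q := \matrix_(i, j) projT1 (cid (H i j)).
exists Q; split => // i j; rewrite !mxE.
by case: cid.
Qed.

Lemma measurable_mx_ball m n (M : 'M[R]_(m, n)) e : measurable (ball M e).
Proof.
have [e0|e0] := ltP 0 e; last first.
  rewrite (_ : ball M e = set0)// -subset0 => N [e0' _].
  by move: e0'; rewrite ltNge e0.
rewrite (_ : ball M e = \bigcap_(ij in [set: 'I_m * 'I_n])
    ((fun N : 'M[R]_(m, n) => N ij.1 ij.2) @^-1` ball (M ij.1 ij.2) e)).
  apply: fin_bigcap_measurable => // ij _; rewrite -[X in measurable X]setTI.
  by apply: measurable_mx_entry => //; exact: measurable_ball.
apply/seteqP; split => [N [_ H] [i j] _|N H]; first exact: H.
by split => // i j; exact: (H (i, j)).
Qed.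

Lemma rat_dense (x : R) (e : R) : 0 < e -> exists q : rat, ball x e (ratr q : R).
Proof.
move=> e0; have [q] := @rat_in_itvoo R (x - e) (x + e) ltac:(lra).
by rewrite in_itv/= => qM; exists q; rewrite /ball/= ltr_norml; lra.
Qed.

Lemma open_sub_ball (V : pseudoMetricType R) (U : set V) : open U ->
  forall x, U x -> exists2 e, 0 < e & ball x e `<=` U.
Proof. by rewrite openE => Uo x /Uo /nbhs_ballP[e /= e0 ?]; exists e. Qed.

Lemma measurable_open_rV d (U : set 'rV[R]_d) : open U -> measurable U.
Proof.
move=> Uo.
apply: (@open_measurable_balls _ 'rV[R]_d 'rV[rat]_d (map_mx ratr) (fun x e => ball x e)).
- by move=> x e e0; exact: rat_mx_dense.
- by move=> *; exact: measurable_mx_ball.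
- by move=> x y e; exact: ball_sym.
- by move=> x y z e1 e2; exact: ball_triangle.
- by move=> x e1 e2 y e12; exact: le_ball.
- exact: open_sub_ball.
Qed.

Lemma measurable_open_rVR d (U : set ('rV[R]_d * R)) : open U ->
  measurable (U : set ('rV[R]_d * measurableTypeR R)).
Proof.
move=> Uo.
apply: (@open_measurable_balls _ ('rV[R]_d * measurableTypeR R)%type ('rV[rat]_d * rat)%type
  (fun q => (map_mx ratr q.1, ratr q.2)) (fun x e => ball x.1 e `*` ball x.2 e)).
- move=> x e e0; have [q1 ?] := rat_mx_dense x.1 e0.
  by have [q2 ?] := rat_dense x.2 e0; exists (q1, q2).
- by move=> *; apply: measurableX; [exact: measurable_mx_ball|exact: measurable_ball].
- by move=> x y e [? ?]; split; exact: ball_sym.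
- by move=> x y z e1 e2 [? ?] [? ?]; split; apply: ball_triangle; eauto.
- by move=> x e1 e2 y e12 [? ?]; split; apply: le_ball; eauto.
- exact: open_sub_ball.
Qed.

Lemma measurable_open_mxmx m n m' n' (U : set ('M[R]_(m, n) * 'M[R]_(m', n'))) :
  open U -> measurable U.
Proof.
move=> Uo.
apply: (@open_measurable_balls _ ('M[R]_(m, n) * 'M[R]_(m', n'))%type ('M[rat]_(m, n) * 'M[rat]_(m', n'))%type
  (fun q => (map_mx ratr q.1, map_mx ratr q.2)) (fun x e => ball x.1 e `*` ball x.2 e)).
- move=> x e e0; have [q1 ?] := rat_mx_dense x.1 e0.
  by have [q2 ?] := rat_mx_dense x.2 e0; exists (q1, q2).
- by move=> *; apply: measurableX; exact: measurable_mx_ball.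
- by move=> x y e [? ?]; split; exact: ball_sym.
- by move=> x y z e1 e2 [? ?] [? ?]; split; apply: ball_triangle; eauto.
- by move=> x e1 e2 y e12 [? ?]; split; apply: le_ball; eauto.
- exact: open_sub_ball.
Qed.

Lemma within_continuous_preimage (V : topologicalType) (D : set V) (g : V -> R)
    (O : set R) : {within D, continuous g} -> open O ->
  exists2 U, open U & D `&` g @^-1` O = D `&` U.
Proof.
move=> gc oO; have /continuousP/(_ O oO) := gc.
move=> /open_subspaceP[U oU UE]; exists U => //.
by rewrite ![D `&` _]setIC UE.
Qed.

Lemma measurable_fun_opens d (T : measurableType d) (D : set T) (f : T -> R) :
  (forall O, open O -> measurable (D `&` f @^-1` O)) -> measurable_fun D f.
Proof.
move=> H mD; apply: (measurability _ (RGenOpens.measurableE R)) => //.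
by move=> _ [_ [a [b ->] <-]]; apply: H; exact: interval_open.
Qed.

Lemma measurable_within_rV d (D : set 'rV[R]_d) (g : 'rV[R]_d -> R) :
  measurable D -> {within D, continuous g} -> measurable_fun D g.
Proof.
move=> mD gc; apply: measurable_fun_opens => O oO.
have [U oU ->] := within_continuous_preimage gc oO.
by apply: measurableI => //; exact: measurable_open_rV.
Qed.

Lemma measurable_within_rVR d (D : set ('rV[R]_d * R)) (g : 'rV[R]_d * R -> R) :
  measurable (D : set ('rV[R]_d * measurableTypeR R)) ->
  {within D, continuous g} ->
  measurable_fun (D : set ('rV[R]_d * measurableTypeR R)) g.
Proof.
move=> mD gc; apply: measurable_fun_opens => O oO.
have [U oU E] := within_continuous_preimage gc oO.
rewrite (_ : _ `&` _ = D `&` U)//.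
by apply: measurableI => //; exact: measurable_open_rVR.
Qed.

Lemma measurable_within_mxmx m n m' n' (D : set ('M[R]_(m, n) * 'M[R]_(m', n')))
  (g : 'M[R]_(m, n) * 'M[R]_(m', n') -> R) :
  measurable D -> {within D, continuous g} -> measurable_fun D g.
Proof.
move=> mD gc; apply: measurable_fun_opens => O oO.
have [U oU E] := within_continuous_preimage gc oO.
rewrite (_ : _ `&` _ = D `&` U)//.
by apply: measurableI => //; exact: measurable_open_mxmx.
Qed.

Lemma coord_le_norm m n (M : 'M[R]_(m, n)) i j : `|M i j| <= `|M|.
Proof.
rewrite [leRHS]/Num.Def.normr/= mx_normrE.
exact: (le_bigmax _ (fun ij : 'I_m * 'I_n => `|M ij.1 ij.2|) (i, j)).
Qed.

Lemma lebV_bounded_lty d (A : set 'rV[R]_d) : measurable A -> bounded_set A ->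
  (lebV A < +oo)%E.
Proof.
move=> mA [M [Mr AM]].
pose b := `|M| + 1.
have b0 : 0 <= b by rewrite addr_ge0.
pose Q := [set x : 'rV[R]_d | forall i, x 0 i \in `](- b - 1), b]].
have mQ : measurable Q.
  rewrite (_ : Q = \bigcap_(i in [set: 'I_d])
      ((fun x : 'rV[R]_d => x 0 i) @^-1` `](- b - 1), b])).
    apply: fin_bigcap_measurable => // i _; rewrite -[X in measurable X]setTI.
    exact: measurable_mx_entry.
  by apply/seteqP; split => x /= H i; [move=> _|]; exact: H.
apply: (@le_lt_trans _ _ (lebV Q)).
  apply: le_measure; rewrite ?inE// => x /AM xb i.
  have := xb b ltac:(rewrite /b; have := ler_norm M; lra).
  move=> /(le_trans (coord_le_norm x 0 i)); rewrite ler_norml in_itv/=.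
  lra.
by rewrite /lebV lebesgue_measure_rV_box ?ltry// => i; lra.
Qed.

End MeasurableOpen.

(** * Calculus of functions that are C^1 up to the boundary *)

Section C1Calculus.
Context {R : realType}.
Implicit Types V W : normedModType R.

Lemma differentiable_derive V (f : V -> R) (x e : V) :
  differentiable f x -> derivable f x e.
Proof. exact: diff_derivable. Qed.

Lemma derive_comp_diff V W (f : W -> R) (g : V -> W) x e :
  differentiable g x -> differentiable f (g x) ->
  'D_e (f \o g) x = 'D_('D_e g x) f (g x).
Proof.
move=> dg df; rewrite !deriveE//; last exact: differentiable_comp.
by rewrite diff_comp.
Qed.

Lemma derive_comp1 V (h : R -> R) (f : V -> R) x e :
  differentiable f x -> differentiable h (f x) ->
  'D_e (h \o f) x = derive1 h (f x) * 'D_e f x.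
Proof.
move=> df dh; rewrite derive_comp_diff// derive1E deriveE// [in RHS]deriveE//.
by rewrite -[X in 'd _ _ X = _]mulr1 -[_ * 1]/(_ *: 1) linearZ /= mulrC.
Qed.

Lemma within_continuousS V (A B : set V) (f : V -> R) :
  A `<=` B -> {within B, continuous f} -> {within A, continuous f}.
Proof. by move=> AB; apply: continuous_subspaceW. Qed.

Lemma within_continuousD V (A : set V) (f g : V -> R) :
  {within A, continuous f} -> {within A, continuous g} ->
  {within A, continuous (fun x => f x + g x)}.
Proof. by move=> cf cg x; apply: cvgD; [exact: cf|exact: cg]. Qed.

Lemma within_continuousM V (A : set V) (f g : V -> R) :
  {within A, continuous f} -> {within A, continuous g} ->
  {within A, continuous (fun x => f x * g x)}.
Proof. by move=> cf cg x; apply: cvgM; [exact: cf|exact: cg]. Qed.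

Lemma within_continuous_cst V (A : set V) (c : R) :
  {within A, continuous (fun _ => c)}.
Proof. by move=> x; exact: cvg_cst. Qed.

Lemma within_continuous_precomp V W (A : set V) (B : set W) (f : W -> R) (g : V -> W) :
  continuous g -> (forall x, A x -> B (g x)) -> {within B, continuous f} ->
  {within A, continuous (f \o g)}.
Proof.
move=> cg AB /subspace_continuousP cf; apply/subspace_continuousP => x Ax.
apply: cvg_comp (cf (g x) (AB _ Ax)) => P; rewrite /= => gP.
have := cg x _ gP; rewrite /nbhs /=; apply: filterS => y /= By Ay.
exact: By (AB _ Ay).
Qed.

Lemma within_continuous_comp1 V (A : set V) (h : R -> R) (f : V -> R) :
  {within A, continuous f} -> (forall x, A x -> {for f x, continuous h}) ->
  {within A, continuous (h \o f)}.
Proof.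
move=> /subspace_continuousP cf ch; apply/subspace_continuousP => x Ax.
by apply: cvg_comp; [exact: cf|exact: ch].
Qed.

Lemma C1_subset V (U E U' E' : set V) (f : V -> R) :
  U' `<=` U -> E' `<=` E -> C1 U E f -> C1 U' E' f.
Proof.
move=> UU EE [cf df gf]; split.
- exact: within_continuousS cf.
- by move=> x /UU; exact: df.
- move=> e; have [g cg gE] := gf e; exists g; first exact: within_continuousS cg.
  by move=> x /UU; exact: gE.
Qed.

Lemma C1_cst V (U E : set V) (c : R) : C1 U E (fun _ => c).
Proof.
split; [exact: within_continuous_cst | by move=> x _; exact: differentiable_cst|].
move=> e; exists (fun _ => 0); first exact: within_continuous_cst.
by move=> x _; exact: (derive_cst c x e).
Qed.

Lemma C1_add V (U E : set V) (f g : V -> R) :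
  C1 U E f -> C1 U E g -> C1 U E (fun x => f x + g x).
Proof.
move=> [cf df gf] [cg dg gg]; split.
- exact: within_continuousD.
- by move=> x Ux; apply: differentiableD; [exact: df|exact: dg].
- move=> e; have [f' cf' fE] := gf e; have [g' cg' gE] := gg e.
  exists (fun x => f' x + g' x); first exact: within_continuousD.
  move=> x Ux; rewrite -fE// -gE//; apply: deriveD; apply: diff_derivable;
  [exact: df|exact: dg].
Qed.

Lemma derive_mul V (f g : V -> R) (x e : V) :
  differentiable f x -> differentiable g x ->
  'D_e (fun y => f y * g y) x = f x * 'D_e g x + g x * 'D_e f x.
Proof. by move=> df dg; rewrite deriveM//; exact: diff_derivable. Qed.

Lemma C1_mul V (U E : set V) (f g : V -> R) : U `<=` E ->
  C1 U E f -> C1 U E g -> C1 U E (fun x => f x * g x).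
Proof.
move=> UE [cf df gf] [cg dg gg]; split.
- exact: within_continuousM.
- by move=> x Ux; apply: differentiableM; [exact: df|exact: dg].
- move=> e; have [f' cf' fE] := gf e; have [g' cg' gE] := gg e.
  exists (fun x => f x * g' x + g x * f' x).
    by apply: within_continuousD; apply: within_continuousM.
  by move=> x Ux; rewrite -fE// -gE// derive_mul//; [exact: df|exact: dg].
Qed.

Lemma C1_sum V (U E : set V) (I : Type) (s : seq I) (f : I -> V -> R) :
  (forall i, C1 U E (f i)) -> C1 U E (fun x => \sum_(i <- s) f i x).
Proof.
move=> Cf; elim: s => [|i s IH].
  by under eq_fun do rewrite big_nil; exact: C1_cst.
by under eq_fun do rewrite big_cons; exact: C1_add.
Qed.

Lemma C1_prod V (U E : set V) (I : Type) (s : seq I) (f : I -> V -> R) :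
  U `<=` E -> (forall i, C1 U E (f i)) -> C1 U E (fun x => \prod_(i <- s) f i x).
Proof.
move=> UE Cf; elim: s => [|i s IH].
  by under eq_fun do rewrite big_nil; exact: C1_cst.
by under eq_fun do rewrite big_cons; exact: C1_mul.
Qed.

(** The chain rule gives the differential inside U; continuity of the derivative
    of h on the values taken on E extends it to E. *)
Lemma C1_comp1 V (U E : set V) (h : R -> R) (f : V -> R) : U `<=` E ->
  (forall x, E x -> {for f x, continuous h}) ->
  (forall x, E x -> differentiable h (f x)) ->
  (forall x, E x -> {for f x, continuous (derive1 h)}) ->
  C1 U E f -> C1 U E (h \o f).
Proof.
move=> UE ch dh cdh [cf df gf]; split.
- exact: within_continuous_comp1.
- by move=> x Ux; apply: differentiable_comp; [exact: df|exact: dh (UE _ Ux)].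
- move=> e; have [f' cf' fE] := gf e.
  exists (fun x => derive1 h (f x) * f' x).
    by apply: within_continuousM => //; exact: within_continuous_comp1.
  by move=> x Ux; rewrite -fE// derive_comp1//; [exact: df|exact: dh (UE _ Ux)].
Qed.

(** Maps with constant differential: time slices, reflections, coordinates. *)
Lemma C1_precomp V W (U E : set V) (U' E' : set W) (A : W -> V) (L : W -> V)
    (f : V -> R) :
  (forall x, differentiable A x) -> (forall x e, 'D_e A x = L e) ->
  (forall x, U' x -> U (A x)) -> (forall x, E' x -> E (A x)) ->
  C1 U E f -> C1 U' E' (fun x => f (A x)).
Proof.
move=> dA AL UU EE [cf df gf].
have cA : continuous A by move=> x; exact: differentiable_continuous.
split.
- exact: (within_continuous_precomp cA EE cf).
- by move=> x Ux; apply: differentiable_comp => //; exact: df (UU _ Ux).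
- move=> e; have [f' cf' fE] := gf (L e).
  exists (f' \o A); first exact: (within_continuous_precomp cA EE cf').
  move=> x Ux; have := derive_comp_diff e (dA x) (df _ (UU _ Ux)).
  by rewrite AL fE//; exact: UU.
Qed.

Lemma C1_inv V (U E : set V) (f : V -> R) : U `<=` E ->
  (forall x, E x -> 0 < f x) -> C1 U E f -> C1 U E (fun x => (f x)^-1).
Proof.
move=> UE f0; apply: (C1_comp1 (h := fun r => r^-1)) => // x Ex.
- by apply: inv_continuous; rewrite gt_eqF ?f0.
- by apply: differentiable_Rinv; rewrite gt_eqF ?f0.
- have fx0 := f0 x Ex.
  have E1 : {near nbhs (f x), (fun r : R => - r^-2) =1 derive1 (fun r => r^-1)}.
    near=> r; have r0 : r != 0 by rewrite gt_eqF//; near: r; exact: lt_nbhsr.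
    rewrite derive1E deriveV// derive_id.
    by rewrite /GRing.scale/= mulr1.
  rewrite /prop_for /continuous_at -(nbhs_singleton E1).
  apply: cvg_trans.
    apply: near_eq_cvg; exact: E1.
  apply: cvgN; apply: cvgV; first by rewrite expf_eq0/= gt_eqF.
  exact: exprn_continuous.
Unshelve. all: by end_near. Qed.

Lemma C1_ln V (U E : set V) (f : V -> R) : U `<=` E ->
  (forall x, E x -> 0 < f x) -> C1 U E f -> C1 U E (fun x => ln (f x)).
Proof.
move=> UE f0; apply: (C1_comp1 (h := @ln R)) => // x Ex.
- by apply: continuous_ln; exact: f0.
- have /derivable1_diffP := @ex_derive _ _ _ _ _ _ _ (is_derive1_ln (f0 _ Ex)).
  by [].
- have fx0 := f0 x Ex.
  have E1 : {near nbhs (f x), (fun r : R => r^-1) =1 derive1 (@ln R)}.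
    near=> r; have r0 : 0 < r by near: r; exact: lt_nbhsr.
    by rewrite derive1E (@derive_val _ _ _ _ _ _ _ (is_derive1_ln r0)).
  rewrite /prop_for /continuous_at -(nbhs_singleton E1).
  apply: cvg_trans.
    apply: near_eq_cvg; exact: E1.
  by apply: inv_continuous; rewrite gt_eqF.
Unshelve. all: by end_near. Qed.

End C1Calculus.

(** * Iterated integrals *)

Section FubiniSections.
Context {R : realType} d1 d2 (T1 : measurableType d1) (T2 : measurableType d2).
Local Open Scope ereal_scope.

Lemma sections21 (m1 : {measure set T1 -> \bar R}) (m2 : {measure set T2 -> \bar R})
    (A : set T1) (B : set T2) (f : T1 * T2 -> \bar R) :
  \int[m2]_y \int[m1]_x (f \_ (A `*` B)) (x, y) =
  \int[m2]_(y in B) \int[m1]_(x in A) f (x, y).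
Proof.
rewrite [RHS]integral_mkcond; apply: eq_integral => y _.
rewrite patchE; case: ifPn => [|] yB.
  rewrite [RHS]integral_mkcond; apply: eq_integral => x _.
  by rewrite !patchE in_setX yB andbT.
by apply: integral0_eq => x _; rewrite patchE in_setX (negbTE yB) andbF.
Qed.

Lemma sections12 (m1 : {measure set T1 -> \bar R}) (m2 : {measure set T2 -> \bar R})
    (A : set T1) (B : set T2) (f : T1 * T2 -> \bar R) :
  \int[m1]_x \int[m2]_y (f \_ (A `*` B)) (x, y) =
  \int[m1]_(x in A) \int[m2]_(y in B) f (x, y).
Proof.
rewrite [RHS]integral_mkcond; apply: eq_integral => x _.
rewrite patchE; case: ifPn => [|] xA.
  rewrite [RHS]integral_mkcond; apply: eq_integral => y _.
  by rewrite !patchE in_setX xA.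
by apply: integral0_eq => y _; rewrite patchE in_setX (negbTE xA).
Qed.

Variables (m1 : {sigma_finite_measure set T1 -> \bar R}).
Variables (m2 : {sigma_finite_measure set T2 -> \bar R}).
Variables (A : set T1) (B : set T2) (mA : measurable A) (mB : measurable B).
Let mAB : measurable (A `*` B). Proof. exact: measurableX. Qed.

(** The order of integration chosen here, space inside and time outside, is the
    one of the definition of a measure-valued solution. *)
Lemma tonelli21 (f : T1 * T2 -> \bar R) : measurable_fun (A `*` B) f ->
  (forall z, (A `*` B) z -> 0 <= f z) ->
  \int[m2]_(y in B) \int[m1]_(x in A) f (x, y) =
  \int[(m1 \x m2)]_(z in A `*` B) f z.
Proof.
move=> mf f0; have mr : measurable_fun setT (f \_ (A `*` B)) by exact: (measurable_restrictT f mAB).1.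
have := @fubini_tonelli2 _ _ _ _ _ m1 m2 _ mr (erestrict_ge0 f0).
by rewrite -integral_mkcond => ->; rewrite -sections21.
Qed.

Lemma tonelli12 (f : T1 * T2 -> \bar R) : measurable_fun (A `*` B) f ->
  (forall z, (A `*` B) z -> 0 <= f z) ->
  \int[m1]_(x in A) \int[m2]_(y in B) f (x, y) =
  \int[(m1 \x m2)]_(z in A `*` B) f z.
Proof.
move=> mf f0; have mr : measurable_fun setT (f \_ (A `*` B)) by exact: (measurable_restrictT f mAB).1.
have := @fubini_tonelli1 _ _ _ _ _ m1 m2 _ mr (erestrict_ge0 f0).
by rewrite -integral_mkcond => ->; rewrite -sections12.
Qed.

Lemma measurable_tonelli21 (f : T1 * T2 -> \bar R) : measurable_fun (A `*` B) f ->
  (forall z, (A `*` B) z -> 0 <= f z) ->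
  measurable_fun B (fun y => \int[m1]_(x in A) f (x, y)).
Proof.
move=> mf f0.
have mG : measurable_fun setT (fubini_G m1 (f \_ (A `*` B))).
  apply: measurable_fun_fubini_tonelli_G; first exact: (measurable_restrictT f mAB).1.
  exact: erestrict_ge0.
apply: (eq_measurable_fun (fubini_G m1 (f \_ (A `*` B)))); last first.
  exact: measurable_funTS.
move=> y yB; rewrite /fubini_G [RHS]integral_mkcond; apply: eq_integral => x _.
by rewrite !patchE in_setX yB andbT.
Qed.

Lemma ae_integrable21 (f : T1 * T2 -> \bar R) :
  (m1 \x m2).-integrable (A `*` B) f ->
  {ae m2, forall y, B y -> m1.-integrable A (fun x => f (x, y))}.
Proof.
move=> fi; have := (integrable_mkcond f mAB).1 fi => /ae_integrable2.
apply: filterS => y iy By; apply/(integrable_mkcond _ mA).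
apply: eq_integrable iy => // x _.
by rewrite !patchE in_setX [y \in B]mem_set// andbT.
Qed.

Lemma ae_integrable12 (f : T1 * T2 -> \bar R) :
  (m1 \x m2).-integrable (A `*` B) f ->
  {ae m1, forall x, A x -> m2.-integrable B (fun y => f (x, y))}.
Proof.
move=> fi; have := (integrable_mkcond f mAB).1 fi => /ae_integrable1.
apply: filterS => x ix Ax; apply/(integrable_mkcond _ mB).
apply: eq_integrable ix => // y _.
by rewrite !patchE in_setX [x \in A]mem_set.
Qed.

Lemma integrable_fubini_G (f : T1 * T2 -> \bar R) :
  (m1 \x m2).-integrable setT f -> m2.-integrable setT (fubini_G m1 f).
Proof.
move=> fi; have mf := measurable_int _ fi.
have mG := measurable_fubini_G fi.
apply/integrableP; split => //.
apply: le_lt_trans ((integrable21ltyP m1 m2 mf).1 fi).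
apply: ge0_le_integral => //.
- exact: measurableT_comp.
- apply: (@measurable_fun_fubini_tonelli_G _ _ _ _ _ m1 (abse \o f)).
    exact: measurableT_comp.
  by move=> z /=; exact: abse_ge0.
- move=> y _; apply: le_abse_integral => //.
  exact: measurableT_comp.
Qed.

Lemma integrable_fubini21 (f : T1 * T2 -> R) :
  (m1 \x m2).-integrable (A `*` B) (EFin \o f) ->
  m2.-integrable B (EFin \o (fun y => (\int[m1]_(x in A) f (x, y))%R)) /\
  (\int[m2]_(y in B) \int[m1]_(x in A) f (x, y) =
   \int[(m1 \x m2)%E]_(z in A `*` B) f z)%R.
Proof.
move=> fi; have fi' := (integrable_mkcond _ mAB).1 fi.
have mf : measurable_fun (A `*` B) f.
  by apply/measurable_EFinP; exact: measurable_int fi.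
have iG : m2.-integrable B (fun y => \int[m1]_(x in A) (f (x, y))%:E).
  have := integrable_fubini_G fi' => /integrableS; move=> /(_ _ measurableT mB (@subsetT _ _)).
  apply: eq_integrable => // y yB.
  rewrite /fubini_G [RHS]integral_mkcond; apply: eq_integral => x _.
  by rewrite !patchE in_setX yB andbT.
have aeE : ae_eq m2 B (fun y => \int[m1]_(x in A) (f (x, y))%:E)
    (EFin \o (fun y => (\int[m1]_(x in A) f (x, y))%R)).
  have := ae_integrable21 fi; apply: filterS => y H By.
  by rewrite /= /Rintegral fineK//; apply: integrable_fin_num => //; exact: H.
have mG : measurable_fun B (EFin \o (fun y => (\int[m1]_(x in A) f (x, y))%R)).
  by apply/measurable_EFinP; apply: measurableT_comp => //; exact: measurable_int iG.
split.
  apply/integrableP; split => //.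
  have /integrableP[_] := iG; apply: le_lt_trans.
  rewrite le_eqVlt; apply/orP; left; apply/eqP; apply: ae_eq_integral => //.
  - by apply: measurableT_comp.
  - by apply: measurableT_comp => //; exact: measurable_int iG.
  - by apply: filterS aeE => y /[apply] ->.
rewrite {1 3}/Rintegral; congr fine.
transitivity (\int[m2]_(y in B) \int[m1]_(x in A) (f (x, y))%:E).
  apply: ae_eq_integral => //; first exact: measurable_int iG.
  by apply: filterS aeE => y /[apply] ->.
rewrite [RHS]integral_mkcond -[LHS](sections21 _ _ _ _ (EFin \o f)).
exact: (integral21_prod_meas1 fi').
Qed.

Lemma integrable_fubini12 (f : T1 * T2 -> R) :
  (m1 \x m2).-integrable (A `*` B) (EFin \o f) ->
  m1.-integrable A (EFin \o (fun x => (\int[m2]_(y in B) f (x, y))%R)) /\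
  (\int[m1]_(x in A) \int[m2]_(y in B) f (x, y) =
   \int[(m1 \x m2)%E]_(z in A `*` B) f z)%R.
Proof.
move=> fi; have fi' := (integrable_mkcond _ mAB).1 fi.
have mf : measurable_fun (A `*` B) f.
  by apply/measurable_EFinP; exact: measurable_int fi.
have iG : m1.-integrable A (fun x => \int[m2]_(y in B) (f (x, y))%:E).
  have := integrable_fubini_F fi' => /integrableS; move=> /(_ _ measurableT mA (@subsetT _ _)).
  apply: eq_integrable => // x xA.
  rewrite /fubini_F [RHS]integral_mkcond; apply: eq_integral => y _.
  by rewrite !patchE in_setX xA.
have aeE : ae_eq m1 A (fun x => \int[m2]_(y in B) (f (x, y))%:E)
    (EFin \o (fun x => (\int[m2]_(y in B) f (x, y))%R)).
  have := ae_integrable12 fi; apply: filterS => y H By.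
  by rewrite /= /Rintegral fineK//; apply: integrable_fin_num => //; exact: H.
have mG : measurable_fun A (EFin \o (fun x => (\int[m2]_(y in B) f (x, y))%R)).
  by apply/measurable_EFinP; apply: measurableT_comp => //; exact: measurable_int iG.
split.
  apply/integrableP; split => //.
  have /integrableP[_] := iG; apply: le_lt_trans.
  rewrite le_eqVlt; apply/orP; left; apply/eqP; apply: ae_eq_integral => //.
  - by apply: measurableT_comp.
  - by apply: measurableT_comp => //; exact: measurable_int iG.
  - by apply: filterS aeE => y /[apply] ->.
rewrite {1 3}/Rintegral; congr fine.
transitivity (\int[m1]_(x in A) \int[m2]_(y in B) (f (x, y))%:E).
  apply: ae_eq_integral => //; first exact: measurable_int iG.
  by apply: filterS aeE => y /[apply] ->.
rewrite [RHS]integral_mkcond -[LHS](sections12 _ _ _ _ (EFin \o f)).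
exact: (integral12_prod_meas1 fi').
Qed.

End FubiniSections.

Section IntegrableReal.
Context {R : realType} d (T : measurableType d) (m : {measure set T -> \bar R}).
Variables (D : set T) (mD : measurable D).

Lemma integrableMbdd (f h : T -> R) (M : R) :
  m.-integrable D (EFin \o f) -> measurable_fun D h ->
  (forall x, D x -> `|h x| <= M) -> m.-integrable D (EFin \o (fun x => h x * f x)).
Proof.
move=> fi mh hM.
have mf : measurable_fun D f by apply/measurable_EFinP; exact: measurable_int fi.
apply: (@le_integrable _ _ _ _ _ mD _ (fun x => M%:E * (EFin \o f) x)%E).
- by apply/measurable_EFinP; exact: measurable_funM.
- move=> x Dx /=; rewrite lee_fin !normrM ler_wpM2r//.
  by rewrite (le_trans (hM x Dx))// ler_norm.
- exact: integrableZl.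
Qed.

Lemma integrable_bdd (h : T -> R) (M : R) : (m D < +oo)%E ->
  measurable_fun D h -> (forall x, D x -> `|h x| <= M) ->
  m.-integrable D (EFin \o h).
Proof.
move=> Dfin mh hM; apply: measurable_bounded_integrable => //.
exists M; split; first exact: num_real.
by move=> x Mx y Dy; apply: (le_trans (hM y Dy)); exact: ltW.
Qed.

Lemma le_integrable_real (f g : T -> R) : measurable_fun D f ->
  (forall x, D x -> `|f x| <= g x) -> m.-integrable D (EFin \o g) ->
  m.-integrable D (EFin \o f).
Proof.
move=> mf fg gi; apply: (le_integrable mD _ _ gi); first exact/measurable_EFinP.
by move=> x Dx; rewrite /= lee_fin (le_trans (fg x Dx))// ler_norm.
Qed.

Lemma integrable_addR (f g : T -> R) :
  m.-integrable D (EFin \o f) -> m.-integrable D (EFin \o g) ->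
  m.-integrable D (EFin \o (fun x => f x + g x)).
Proof. by move=> fi gi; apply: eq_integrable (integrableD mD fi gi). Qed.

Lemma integrable_subR (f g : T -> R) :
  m.-integrable D (EFin \o f) -> m.-integrable D (EFin \o g) ->
  m.-integrable D (EFin \o (fun x => f x - g x)).
Proof. by move=> fi gi; apply: eq_integrable (integrableB mD fi gi). Qed.

Lemma integrable_scaleR (c : R) (f : T -> R) :
  m.-integrable D (EFin \o f) -> m.-integrable D (EFin \o (fun x => c * f x)).
Proof. by move=> fi; apply: eq_integrable (integrableZl mD c fi). Qed.

Lemma integrable_sumR (I : Type) (s : seq I) (f : I -> T -> R) :
  (forall i, m.-integrable D (EFin \o f i)) ->
  m.-integrable D (EFin \o (fun x => \sum_(i <- s) f i x)).
Proof.
move=> fi; elim: s => [|i s IH].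
  by under [X in _ \o X]eq_fun do rewrite big_nil; exact: integrable0.
by under [X in _ \o X]eq_fun do rewrite big_cons; exact: integrable_addR.
Qed.

Lemma Rintegral_sum (I : Type) (s : seq I) (f : I -> T -> R) :
  (forall i, m.-integrable D (EFin \o f i)) ->
  \int[m]_(x in D) (\sum_(i <- s) f i x) = \sum_(i <- s) \int[m]_(x in D) f i x.
Proof.
move=> fi; elim: s => [|i s IH].
  by under eq_Rintegral do rewrite big_nil; rewrite Rintegral_cst// mul0r big_nil.
under eq_Rintegral do rewrite big_cons.
by rewrite RintegralD ?IH ?big_cons//; exact: integrable_sumR.
Qed.

Lemma RintegralN (f : T -> R) : m.-integrable D (EFin \o f) ->
  \int[m]_(x in D) (- f x) = - \int[m]_(x in D) f x.
Proof.
move=> fi; under eq_Rintegral do rewrite -mulN1r.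
by rewrite RintegralZl// mulN1r.
Qed.

End IntegrableReal.

(** * Powers of the positive part *)

Section PosPow.
Context {R : realType}.

(** The powers of the positive part serve both as spatial bumps and as the
    time weight; from exponent 2 on they are C^1. *)
Definition pospow (k : nat) (r : R) : R := Num.max 0 r ^+ k.

Lemma pospow_ge0 k r : 0 <= pospow k r.
Proof. by rewrite exprn_ge0// le_max lexx. Qed.

Lemma pospow_continuous k : continuous (pospow k).
Proof.
move=> r; have c : {for r, continuous (cst 0 \max (@idfun R))}.
  by apply: continuous_max; [exact: cvg_cst|exact: cvg_id].
exact: (cvg_comp _ _ c (@exprn_continuous _ k _)).
Qed.

Lemma pospow_is_derive k (r : R) :
  is_derive r 1 (pospow k.+2) (k.+2%:R * pospow k.+1 r).
Proof.
have [r0|r0|->] := ltgtP r 0.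
- have E : {near r, (fun _ => 0) =1 pospow k.+2}.
    near=> s; rewrite /pospow max_l ?expr0n//.
    by apply: ltW; near: s; exact: lt_nbhsl.
  apply: (near_eq_is_derive E).
  rewrite /pospow max_l ?(ltW r0)// expr0n mulr0.
  exact: is_derive_cst.
- have E : {near r, (fun s => s ^+ k.+2) =1 pospow k.+2}.
    near=> s; rewrite /pospow max_r//.
    by apply: ltW; near: s; exact: lt_nbhsr.
  apply: (near_eq_is_derive E).
  rewrite /pospow max_r ?(ltW r0)//.
  split; first exact: exprn_derivable.
  by rewrite exp_derive /GRing.scale/= mulr1.
- rewrite /pospow maxxx expr0n mulr0.
  have H0 : (fun h : R => `|h| ^+ k.+1) @ 0^' --> (0 : R).
    apply: cvg_within_filter.
    have := cvg_comp _ _ (@norm_continuous _ R 0) (@exprn_continuous _ k.+1 _).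
    by rewrite normr0 expr0n.
  have H : (fun h : R => h^-1 *: (pospow k.+2 (h *: 1 + 0) - pospow k.+2 0)) @ 0^' --> (0 : R).
    apply: (@squeeze_cvgr _ _ _ _ (fun h => - (`|h| ^+ k.+1)) (fun h => `|h| ^+ k.+1)).
    + near=> h; rewrite addr0 /GRing.scale/= mulr1 /pospow maxxx expr0n subr0 -ler_norml.
      have h0 : h != 0 by near: h; exact: nbhs_dnbhs_neq.
      rewrite normrM normrX normfV mulrC ler_pdivrMr ?normr_gt0//.
      rewrite [leRHS]mulrC -exprS lerXn2r ?nnegrE//.
      by have [?|?] := leP 0 h; rewrite ?normr0.
    + by rewrite -[X in _ --> X]oppr0; exact: cvgN.
    + exact: H0.
  split; first by apply/cvg_ex; exists 0.
  exact: cvg_lim H.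
Unshelve. all: by end_near. Qed.

Lemma derive1_pospow k : derive1 (pospow k.+2) = (fun r => k.+2%:R * pospow k.+1 r).
Proof.
by apply/funext => r; rewrite derive1E (@derive_val _ _ _ _ _ _ _ (pospow_is_derive k r)).
Qed.

Lemma pospow_differentiable k r : differentiable (pospow k.+2) r.
Proof. by apply/derivable1_diffP; exact: (@ex_derive _ _ _ _ _ _ _ (pospow_is_derive k r)). Qed.

Lemma C1_pospow (V : normedModType R) (U E : set V) k (f : V -> R) : U `<=` E ->
  C1 U E f -> C1 U E (fun x => pospow k.+2 (f x)).
Proof.
move=> UE; apply: (C1_comp1 (h := pospow k.+2)) => // x Ex.
- exact: pospow_continuous.
- exact: pospow_differentiable.
- rewrite derive1_pospow; apply: continuousM; first exact: cvg_cst.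
  exact: pospow_continuous.
Qed.

End PosPow.

(** * Coordinates and compact boxes *)

Section Affine.
Context {R : realType}.

Lemma affine_diff (V W : normedModType R) (L : W -> V) (a : V) (x : W) :
  linear L -> continuous L ->
  differentiable (fun y => L y + a) x /\ forall e, 'D_e (fun y => L y + a) x = L e.
Proof.
move=> lL cL; pose f : {linear W -> V} := HB.pack L (GRing.isLinear.Build _ _ _ _ L lL).
have df : differentiable L x by exact: (@linear_differentiable _ _ _ f x (cL : continuous f)).
have dd : differentiable (fun y => L y + a) x.
  by apply: (@differentiableD _ _ _ L (cst a)) => //; exact: differentiable_cst.
split => // e; rewrite deriveE//.
rewrite (_ : (fun y => L y + a) = (L : W -> V) + cst a) // diffD//=.
rewrite diff_cst [_ + _]addr0.
by rewrite (@diff_lin _ _ _ f x (cL : continuous f)).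
Qed.

Lemma C1_linear (V : normedModType R) (U E : set V) (f : V -> R) (a : R) :
  linear f -> continuous f -> C1 U E (fun x => f x + a).
Proof.
move=> lf cf; split.
- move=> x; apply: continuous_subspaceT => y.
  by apply: cvgD; [exact: cf|exact: cvg_cst].
- by move=> x _; have [] := affine_diff a x lf cf.
- move=> e; exists (fun _ => f e); first exact: within_continuous_cst.
  by move=> x _; have [_ ->] := affine_diff a x lf cf.
Qed.

Lemma C1_coord d (U E : set 'rV[R]_d) (j : 'I_d) (a : R) :
  C1 U E (fun x => x 0 j + a).
Proof.
apply: (@C1_linear _ _ _ (fun x : 'rV[R]_d => x 0 j)); last exact: coord_continuous.
by move=> k x y; rewrite !mxE.
Qed.

Lemma C1_coord1 d (U E : set ('rV[R]_d * R)) (j : 'I_d) (a : R) :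
  C1 U E (fun z => z.1 0 j + a).
Proof.
apply: (@C1_linear _ _ _ (fun z : 'rV[R]_d * R => z.1 0 j)).
  by move=> k x y; rewrite !mxE.
move=> z; apply: (@continuous_comp _ _ _ (@fst 'rV[R]_d R) (fun x : 'rV[R]_d => x 0 j)).
  exact: cvg_fst.
exact: coord_continuous.
Qed.

Lemma C1_coord2 d (U E : set ('rV[R]_d * R)) (a : R) :
  C1 U E (fun z => z.2 + a).
Proof.
apply: (@C1_linear _ _ _ (fun z : 'rV[R]_d * R => z.2)) => // z.
exact: cvg_snd.
Qed.

Lemma C1T_continuous (V : normedModType R) (f : V -> R) : C1 setT setT f -> continuous f.
Proof. by move=> [_ df _] x; apply: differentiable_continuous; exact: df. Qed.

Lemma C1T_derive_continuous (V : normedModType R) (f : V -> R) e :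
  C1 setT setT f -> continuous ('D_e f).
Proof.
move=> [_ _ /(_ e)[g cg gE]]; have -> : 'D_e f = g by apply/funext => x; exact: gE.
exact/continuous_subspace_setT.
Qed.

Lemma compact_box d (M : R) : compact [set z : 'rV[R]_d * R | `|z| <= M].
Proof.
apply: (@subclosed_compact _ _ ([set x : 'rV[R]_d | forall i, x ord0 i \in `[(-M), M]] `*` `[(-M), M]%classic)).
- have -> : [set z : 'rV[R]_d * R | `|z| <= M] = Num.norm @^-1` [set x | x <= M] by [].
  apply: closed_comp; last exact: closed_le.
  by move=> z _; exact: norm_continuous.
- apply: compact_setX; last exact: segment_compact.
  by apply: (@rV_compact _ _ (fun=> `[(- M), M]%classic)) => _; exact: segment_compact.
- move=> z zM; split => /=; last first.
    rewrite in_itv/= -ler_norml (le_trans _ zM)//.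
    by rewrite [leRHS]/Num.Def.normr/= le_max lexx orbT.
  move=> i; rewrite in_itv/= -ler_norml (le_trans (coord_le_norm _ _ _))// (le_trans _ zM)//.
  by rewrite [leRHS]/Num.Def.normr/= le_max lexx.
Qed.

Lemma continuous_bounded_on (V : topologicalType) (E : set V) (f : V -> R) :
  compact E -> {within E, continuous f} -> exists C, forall x, E x -> `|f x| <= C.
Proof.
move=> cE cf; have := @continuous_compact _ _ f E cf cE.
move=> /compact_bounded[C [Cr HC]]; exists (`|C| + 1) => x Ex.
apply: (HC (`|C| + 1)); last by exists x.
by rewrite (le_lt_trans (ler_norm C))// ltrDl.
Qed.

End Affine.

(** * Smooth kernels on space-time *)

Section Kernel.
Context {R : realType} {d : nat}.
Local Notation V := ('rV[R]_d * R)%type.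
Local Notation VM := ('rV[R]_d * measurableTypeR R)%type.

Lemma sigma_finite_product d1 d2 (T1 : measurableType d1) (T2 : measurableType d2)
    (m1 : {sigma_finite_measure set T1 -> \bar R})
    (m2 : {sigma_finite_measure set T2 -> \bar R}) :
  sigma_finite setT (m1 \x m2)%E.
Proof.
have /sigma_finiteP[F [TF ndF Foo]] := sigma_finiteT m1.
have /sigma_finiteP[G [TG ndG Goo]] := sigma_finiteT m2.
exists (fun k => F k `*` G k) => [|k].
  apply/esym/seteqP; split => // -[x y] _.
  have [k1 _ Fx] : (\bigcup_k F k) x by rewrite -TF.
  have [k2 _ Gy] : (\bigcup_k G k) y by rewrite -TG.
  exists (maxn k1 k2) => //; split => /=.
    by move/subsetPset : (ndF _ _ (leq_maxl k1 k2)); exact.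
  by move/subsetPset : (ndG _ _ (leq_maxr k1 k2)); exact.
have [mF Flty] := Foo k; have [mG Glty] := Goo k.
split; first exact: measurableX.
by rewrite product_measure1E// lte_mul_pinfty// ge0_fin_numE.
Qed.

(** Packed by hand: inference on a product measure selects the structure of a
    product of probabilities. *)
Definition sf_product d1 d2 (T1 : measurableType d1) (T2 : measurableType d2)
    (m1 : {sigma_finite_measure set T1 -> \bar R})
    (m2 : {sigma_finite_measure set T2 -> \bar R}) :
    {sigma_finite_measure set (T1 * T2)%type -> \bar R} :=
  HB.pack_for {sigma_finite_measure set (T1 * T2)%type -> \bar R} (m1 \x m2)%E
    (Measure_isSigmaFinite.Build _ _ _ (m1 \x m2)%E (sigma_finite_product m1 m2)).

Definition lebVt : {sigma_finite_measure set VM -> \bar R} :=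
  sf_product (@lebV R d) (@lebesgue_measure R).

Lemma lebVtE (A : set 'rV[R]_d) (I : set (measurableTypeR R)) :
  measurable A -> measurable I ->
  lebVt (A `*` I) = (lebV A * lebesgue_measure I)%E.
Proof. by move=> mA mI; rewrite /lebVt /= product_measure1E. Qed.

Lemma C1_opp (W : normedModType R) (U E : set W) (f : W -> R) : U `<=` E ->
  C1 U E f -> C1 U E (fun x => - f x).
Proof.
move=> UE Cf; have -> : (fun x => - f x) = (fun x => (-1) * f x).
  by apply/funext => x; rewrite mulN1r.
by apply: C1_mul => //; exact: C1_cst.
Qed.

Lemma C1_bump (W : normedModType R) (U E : set W) (a : R) (f : W -> R) : U `<=` E ->
  C1 U E f -> C1 U E (fun x => pospow 2 (a - f x ^+ 2)).
Proof.
move=> UE Cf; apply: C1_pospow => //; apply: C1_add; first exact: C1_cst.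
by apply: C1_opp => //; exact: C1_mul.
Qed.

Lemma pospow_gt0 k (r : R) : pospow k.+1 r != 0 -> 0 < r.
Proof. by rewrite /pospow; case: leP => //; rewrite expr0n eqxx. Qed.

Lemma bump_supp (e r : R) : 0 < e -> pospow 2 (e ^+ 2 - r ^+ 2) != 0 -> `|r| < e.
Proof.
move=> e0 /pospow_gt0; rewrite subr_gt0 -[r ^+ 2]real_normK ?num_real// ltr_pXn2r// ?nnegrE// ltW//.
Qed.

(** A product over the coordinates, so that the C^1 calculus for products and
    powers of positive parts applies. *)
Definition box_bump (c : V) (e : R) (z : V) : R :=
  pospow 2 (e ^+ 2 - (z.2 - c.2) ^+ 2) *
  \prod_(j < d) pospow 2 (e ^+ 2 - (z.1 0 j - c.1 0 j) ^+ 2).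

Lemma box_bump_ge0 c e z : 0 <= box_bump c e z.
Proof. by rewrite mulr_ge0 ?pospow_ge0// prodr_ge0// => j _; exact: pospow_ge0. Qed.

Lemma box_bump_C1 c e : C1 setT setT (box_bump c e).
Proof.
apply: C1_mul => //; first by apply: C1_bump => //; exact: C1_coord2.
by apply: C1_prod => // j; apply: C1_bump => //; exact: C1_coord1.
Qed.

Lemma box_bump_supp c e z : 0 < e -> box_bump c e z != 0 -> ball c e z.
Proof.
move=> e0; rewrite mulf_eq0 negb_or prodf_seq_neq0 => /andP[H1 /allP H2].
split; last first.
  by rewrite /= /ball/= distrC; exact: bump_supp H1.
split => // i j; rewrite (ord1 i) /ball/= distrC.
by apply: bump_supp => //; exact: H2 (mem_index_enum j).
Qed.

Lemma box_bump_lb (c : V) (e : R) (z : V) : 0 < e ->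
  `|z.2 - c.2| <= e / 2 -> (forall j, `|z.1 0 j - c.1 0 j| <= e / 2) ->
  ((e / 2) ^+ 4) * (e / 2) ^+ (4 * d) <= box_bump c e z.
Proof.
move=> e0 H1 H2.
have H r : `|r| <= e / 2 -> (e / 2) ^+ 4 <= pospow 2 (e ^+ 2 - r ^+ 2).
  move=> re; have r2 : r ^+ 2 <= (e / 2) ^+ 2.
    by rewrite -[r ^+ 2]real_normK ?num_real// lerXn2r// nnegrE// ltW// divr_gt0.
  rewrite (exprM _ 2 2) /pospow lerXn2r ?nnegrE ?sqr_ge0 ?le_max ?lexx//.
  apply/orP; right; rewrite lerBrDr.
  have : 0 <= e ^+ 2 by rewrite sqr_ge0.
  by move: r2; rewrite !exprMn; lra.
have e2 : 0 <= e / 2 by rewrite divr_ge0// ltW.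
apply: ler_pM; [exact: exprn_ge0|exact: exprn_ge0|exact: H|].
rewrite exprM -[X in _ ^+ X]card_ord -prodr_const; apply: ler_prod => j _.
by rewrite exprn_ge0//= H.
Qed.

Lemma measurable_ball_VM (c : V) e : measurable (ball c e : set VM).
Proof. by apply: measurableX; [exact: measurable_mx_ball|exact: measurable_ball]. Qed.

Lemma lebVt_ball_lty (c : V) e : (lebVt (ball c e) < +oo)%E.
Proof.
have -> : lebVt (ball c e) = lebVt (ball c.1 e `*` ball c.2 e) by [].
rewrite lebVtE//; last 2 first.
- exact: measurable_mx_ball.
- exact: measurable_ball.
rewrite lte_mul_pinfty//.
- rewrite ge0_fin_numE//; apply: lebV_bounded_lty; first exact: measurable_mx_ball.
  exists (`|c.1| + e); split; first exact: num_real.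
  move=> M cM x xc; apply: le_trans (ltW cM).
  have := xc; rewrite -ball_normE /ball_/= distrC => xc'.
  by have := ler_normD (x - c.1) c.1; rewrite subrK; lra.
- have [e0|e0] := ltP 0 e; last by rewrite (ball0 _ _).2// measure0 ltry.
  by rewrite lebesgue_measure_ball ?ltW// ltry.
Qed.

Lemma continuousT_measurable_VM (f : V -> R) : continuous f -> measurable_fun setT (f : VM -> R).
Proof.
move=> cf; apply: (@measurable_within_rVR _ _ setT) => //.
exact: continuous_subspaceT.
Qed.

Lemma supp_bounded (f : V -> R) (M : R) : continuous f ->
  (forall z, M < `|z| -> f z = 0) -> exists C, forall z, `|f z| <= C.
Proof.
move=> cf f0.
have [C HC] := @continuous_bounded_on _ _ _ f (@compact_box _ d M) (continuous_subspaceT cf).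
exists (Num.max C 0) => z; have [zM|zM] := leP `|z| M.
  by rewrite (le_trans (HC z zM))// le_max lexx.
by rewrite f0// normr0 le_max lexx orbT.
Qed.

Record kernel_in (c : V) (e : R) (K : V -> R) : Prop := KernelIn {
  kernel_C1 : C1 setT setT K ;
  kernel_ge0 : forall z, 0 <= K z ;
  kernel_supp : forall z, K z != 0 -> ball c e z ;
  kernel_int1 : (\int[lebVt]_z (K z)%:E = 1)%E ;
  kernel_bdd : exists C, forall z, `|K z| <= C ;
  kernel_derive_bdd : forall w, exists C, forall z, `|'D_w K z| <= C }.

Lemma kernel_exists (c : V) (e : R) : 0 < e -> exists K, kernel_in c e K.
Proof.
move=> e0; pose K0 := box_bump c e; have CK0 := box_bump_C1 c e.
have cK0 := C1T_continuous CK0.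
have mK0 := continuousT_measurable_VM cK0.
have far z : `|c| + e < `|z| -> K0 z = 0.
  move=> zM; apply/eqP; apply/negP => /negP /(box_bump_supp e0).
  rewrite -ball_normE /ball_/= => cz.
  have := ler_normD (z - c) c; rewrite subrK distrC; lra.
have [C HC] := supp_bounded cK0 far.
have KN : (\int[lebVt]_z (K0 z)%:E < +oo)%E.
  rewrite (_ : (fun z => _) = ((fun z => (K0 z)%:E) \_ (ball c e : set VM))); last first.
    apply/funext => z; rewrite patchE; case: ifPn => // zc.
    congr EFin; apply/eqP; apply/negP => /negP /(box_bump_supp e0).
    by move/mem_set; rewrite (negbTE zc).
  rewrite -integral_mkcond.
  apply: (@le_lt_trans _ _ (\int[lebVt]_(z in ball c e) (C%:E))%E).
    apply: ge0_le_integral => //.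
    - exact: measurable_ball_VM.
    - by move=> z _; rewrite lee_fin box_bump_ge0.
    - by apply/measurable_EFinP; exact: measurable_funTS.
    - by move=> z _; rewrite lee_fin (le_trans _ (HC z))// ler_norm.
  rewrite integral_cst; last exact: measurable_ball_VM.
  rewrite lte_mul_pinfty ?lee_fin//; last exact: lebVt_ball_lty.
  by rewrite (le_trans _ (HC 0)).
have KP : (0 < \int[lebVt]_z (K0 z)%:E)%E.
  pose A := [set x : 'rV[R]_d | forall i, x 0 i \in `](c.1 0 i - e / 2), (c.1 0 i + e / 2)]].
  pose I := `](c.2 - e / 2), (c.2 + e / 2)]%classic.
  pose eta := ((e / 2) ^+ 4) * (e / 2) ^+ (4 * d).
  have eta0 : 0 < eta by rewrite mulr_gt0// exprn_gt0// divr_gt0.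
  have mA : measurable A.
    rewrite (_ : A = \bigcap_(i in [set: 'I_d])
        ((fun x : 'rV[R]_d => x 0 i) @^-1` `](c.1 0 i - e / 2), (c.1 0 i + e / 2)])).
      apply: fin_bigcap_measurable => // i _; rewrite -[X in measurable X]setTI.
      exact: measurable_mx_entry.
    by apply/seteqP; split => x /= H i; [move=> _|]; exact: H.
  have mAI : measurable (A `*` I : set VM) by apply: measurableX => //; exact: measurable_itv.
  apply: (@lt_le_trans _ _ (\int[lebVt]_(z in A `*` I) eta%:E)%E).
    rewrite integral_cst//; apply: mule_gt0; first by rewrite lte_fin.
    rewrite [X in (0 < X)%E](_ : _ = (lebV A * lebesgue_measure I)%E); last first.
      by apply: lebVtE => //; exact: measurable_itv.
    apply: mule_gt0.
      rewrite /lebV lebesgue_measure_rV_box => [|i]; last by lra.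
      by rewrite lte_fin prodr_gt0// => i _; lra.
    by rewrite lebesgue_measure_itv/= lte_fin ifT -?EFinB ?lte_fin; lra.
  apply: (@le_trans _ _ (\int[lebVt]_(z in A `*` I) (K0 z)%:E)%E).
    apply: ge0_le_integral => //.
    - by move=> z _; rewrite lee_fin ltW.
    - by apply/measurable_EFinP; exact: measurable_funTS.
    - move=> z [/= Az Iz]; rewrite lee_fin; apply: box_bump_lb => // [|j].
        by move: Iz; rewrite /I/= in_itv/= ler_norml; lra.
      by have := Az j; rewrite in_itv/= ler_norml; lra.
  apply: ge0_subset_integral => //; first by apply/measurable_EFinP.
  by move=> z _; rewrite lee_fin box_bump_ge0.
have [N N0 NE] : exists2 N, 0 < N & (\int[lebVt]_z (K0 z)%:E = N%:E)%E.
  move: KN KP; case: (\int[lebVt]_z _)%E => // r _; rewrite lte_fin => r0.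
  by exists r.
exists (fun z => N^-1 * K0 z).
have CK : C1 setT setT (fun z => N^-1 * K0 z) by apply: C1_mul => //; exact: C1_cst.
have far' z : `|c| + e < `|z| -> N^-1 * K0 z = 0 by move=> /far ->; rewrite mulr0.
split => //.
- by move=> z; apply: mulr_ge0; [rewrite invr_ge0 ltW|exact: box_bump_ge0].
- by move=> z; rewrite mulf_eq0 negb_or => /andP[_]; exact: box_bump_supp.
- under eq_integral do rewrite EFinM.
  rewrite ge0_integralZl_EFin//.
  + by rewrite NE -EFinM mulVf// gt_eqF.
  + by move=> z _; rewrite lee_fin; exact: box_bump_ge0.
  + exact/measurable_EFinP.
  + by rewrite invr_ge0 ltW.
- by apply: (@supp_bounded _ (`|c| + e)) => //; exact: C1T_continuous.
- move=> w; apply: (@supp_bounded _ (`|c| + e)); first exact: C1T_derive_continuous.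
  move=> z zM.
  have E : \forall y \near z, (fun _ => 0 : R) y = N^-1 * K0 y.
    have /= := @norm_continuous _ V z _ (lt_nbhsr zM).
    by rewrite nbhs_simpl /=; apply: filterS => y /far' ->.
  rewrite -(near_eq_derive _ E); exact: derive_cst.
Qed.

End Kernel.

(** * Approximate identities *)

Section Mollify.
Context {R : realType} {d : nat}.
Local Notation V := ('rV[R]_d * R)%type.
Local Notation VM := ('rV[R]_d * measurableTypeR R)%type.
Local Notation m := (@lebVt R d).

Lemma lebVt_shift (f : V -> \bar R) (a : V) :
  measurable_fun setT (f : VM -> \bar R) -> (forall z, 0 <= f z)%E ->
  (\int[m]_z f ((z : V) - a)%R = \int[m]_z f z)%E.
Proof.
move=> mf f0.
have := mpreserving_prod (mpreserving_rV_shift (- a.1)) (mpreserving_shift (- a.2)).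
by move=> /mpreserving_ge0_integral /(_ mf f0).
Qed.

Lemma continuous_comp_sub (f : V -> R) (a : V) : continuous f ->
  continuous (fun z : V => f (z - a)) /\ continuous (fun z : V => f (a - z)).
Proof.
move=> cf; split => z.
  apply: (@continuous_comp _ _ _ (fun z : V => z - a) f); last exact: cf.
  by apply: cvgB; [exact: cvg_id|exact: cvg_cst].
apply: (@continuous_comp _ _ _ (fun z : V => a - z) f); last exact: cf.
by apply: cvgB; [exact: cvg_cst|exact: cvg_id].
Qed.

Lemma kernel_continuous c e (K : V -> R) : kernel_in c e K -> continuous K.
Proof. by move=> hK; exact: C1T_continuous (kernel_C1 hK). Qed.

Lemma kernel_shift_integral c e (K : V -> R) a : kernel_in c e K ->
  m.-integrable setT (EFin \o (fun z : VM => K ((z : V) - a)%R)) /\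
  \int[m]_z K ((z : V) - a)%R = 1.
Proof.
move=> hK; have cK := kernel_continuous hK.
have mK := continuousT_measurable_VM cK.
have E : (\int[m]_z (K ((z : V) - a)%R)%:E = 1)%E.
  rewrite -(kernel_int1 hK); apply: (@lebVt_shift (fun z => (K z)%:E)).
    exact/measurable_EFinP.
  by move=> z; rewrite lee_fin (kernel_ge0 hK).
split; last by rewrite /Rintegral E.
apply/integrableP; split.
  by apply/measurable_EFinP; exact: continuousT_measurable_VM (continuous_comp_sub a cK).1.
under eq_integral do rewrite /= ger0_norm ?(kernel_ge0 hK)//.
by rewrite E ltry.
Qed.

Variables (D : set VM) (mD : measurable D).

Lemma mollify_integrable c e (K : V -> R) (A : V -> R) (M : R) a : 0 <= M ->
  kernel_in c e K -> measurable_fun D (A : VM -> R) ->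
  (forall z, D z -> `|A z| <= M) ->
  m.-integrable D (EFin \o (fun z : VM => A z * K ((z : V) - a)%R)) /\
  `|\int[m]_(z in D) (A z * K ((z : V) - a)%R)| <= M.
Proof.
move=> M0 hK mA AM; have [iK K1] := kernel_shift_integral a hK.
have iKD : m.-integrable D (EFin \o (fun z : VM => K ((z : V) - a)%R)).
  exact: integrableS iK.
have iAK : m.-integrable D (EFin \o (fun z : VM => A z * K ((z : V) - a)%R)).
  exact: (integrableMbdd mD iKD mA AM).
split => //; apply: le_trans (le_normr_Rintegral mD iAK) _.
have iMK := integrable_scaleR mD M iKD.
apply: (@le_trans _ _ (\int[m]_(z in D) (M * K ((z : V) - a)%R))).
  apply: le_Rintegral => //; first exact: (@integrable_norm _ _ _ _ _ (fun z : VM => A z * K ((z : V) - a)%R)).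
  move=> z Dz; rewrite normrM ler_pM// ?AM//.
  by rewrite ger0_norm// (kernel_ge0 hK).
rewrite RintegralZl// -[leRHS]mulr1 ler_wpM2l// -K1 /Rintegral.
apply: fine_le; [exact: integrable_fin_num| exact: integrable_fin_num|].
apply: ge0_subset_integral => //; first exact: measurable_int iK.
by move=> z _; rewrite lee_fin (kernel_ge0 hK).
Qed.

(** Kernels of mass one with shrinking supports form an approximate identity,
    even when the supports are off centre. *)
Lemma mollify_limit (c : nat -> V) (e r : nat -> R) (K : nat -> V -> R)
    (A : V -> R) (M : R) a : 0 <= M ->
  (forall k, kernel_in (c k) (e k) (K k)) ->
  (forall k z, K k z != 0 -> `|z| < r k) -> r @ \oo --> 0 ->
  measurable_fun D (A : VM -> R) -> (forall z, D z -> `|A z| <= M) ->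
  open (D : set V) -> D a -> {for a, continuous A} ->
  (fun k => \int[m]_(z in D) (A z * K k ((z : V) - a)%R)) @ \oo --> A a.
Proof.
move=> M0 hK rK r0 mA AM oD Da cA; apply/cvgrPdist_le => eps eps0.
have : \forall z \near a, D z /\ `|A a - A z| <= eps.
  apply: filterI; first exact: open_nbhs_nbhs.
  by move/cvgrPdist_le : cA; apply.
move=> /nbhs_ballP[eta /= eta0 Heta].
have : \forall k \near \oo, r k < eta.
  by move/cvgr_lt : r0; apply.
apply: filterS => k rk; have [iK K1] := kernel_shift_integral a (hK k).
have [iA _] := mollify_integrable a M0 (hK k) mA AM.
have near_a z : K k ((z : V) - a)%R != 0 -> D z /\ `|A a - A z| <= eps.
  move=> /rK zr; apply: Heta; rewrite -ball_normE /ball_/= distrC.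
  exact: lt_trans rk.
have EA : \int[m]_(z in D) (A z * K k ((z : V) - a)%R) = \int[m]_z ((A \_ D) z * K k ((z : V) - a)%R).
  rewrite Rintegral_mkcond; apply: eq_Rintegral => z _.
  by rewrite !patchE; case: ifPn => //; rewrite mul0r.
have iA' : m.-integrable setT (EFin \o (fun z : VM => (A \_ D) z * K k ((z : V) - a)%R)).
  have := (integrable_mkcond _ mD).1 iA; apply: eq_integrable => // z _ /=.
  by rewrite !patchE; case: ifPn => //; rewrite mul0r.
have iAa := integrable_scaleR measurableT (A a) iK.
rewrite EA -[X in X - _]mulr1 -K1 -RintegralZl// -RintegralB//.
have iB := integrable_subR measurableT iAa iA'.
apply: le_trans (le_normr_Rintegral measurableT iB) _.
rewrite -[leRHS]mulr1 -K1 -RintegralZl//.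
apply: le_Rintegral => //.
- exact: (@integrable_norm _ _ _ _ _ (fun z : VM => A a * K k ((z : V) - a)%R - (A \_ D) z * K k ((z : V) - a)%R)).
- exact: integrable_scaleR.
- move=> z _; have [->|Kz] := eqVneq (K k ((z : V) - a)%R) 0.
    by rewrite !mulr0 subrr normr0.
  have [Dz Aaz] := near_a z Kz.
  rewrite patchE mem_set// -mulrBl normrM [X in _ * X]ger0_norm ?(kernel_ge0 (hK k))//.
  by rewrite ler_wpM2r// (kernel_ge0 (hK k)).
Qed.

End Mollify.

(** * Continuous bounded functions on an open set *)

Section ContinuousBounded.
Context {R : realType}.

(** Interior continuity and a bound: enough for integrability on a set of finite
    measure, stable under products, and inherited by the derivatives of functions
    that are C^1 up to the boundary. *)
Definition cbd (V : topologicalType) (D : set V) (f : V -> R) : Prop :=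
  (forall z, D z -> {for z, continuous f}) /\
  exists M, forall z, D z -> `|f z| <= M.

Lemma cbd_cst (V : topologicalType) (D : set V) (a : R) : cbd D (fun _ => a).
Proof. by split => [z _|]; [exact: cvg_cst | exists `|a|]. Qed.

Lemma cbdD (V : topologicalType) (D : set V) (f g : V -> R) :
  cbd D f -> cbd D g -> cbd D (fun z => f z + g z).
Proof.
move=> [cf [M fM]] [cg [N gN]]; split=> [z Dz|].
  by apply: cvgD; [exact: cf|exact: cg].
exists (M + N) => z Dz; apply: le_trans (ler_normD _ _) _.
by apply: lerD; [exact: fM|exact: gN].
Qed.

Lemma cbdM (V : topologicalType) (D : set V) (f g : V -> R) :
  cbd D f -> cbd D g -> cbd D (fun z => f z * g z).
Proof.
move=> [cf [M fM]] [cg [N gN]]; split=> [z Dz|].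
  by apply: cvgM; [exact: cf|exact: cg].
exists (M * N) => z Dz; rewrite normrM.
by apply: ler_pM => //; [exact: fM|exact: gN].
Qed.

Lemma cbdN (V : topologicalType) (D : set V) (f : V -> R) :
  cbd D f -> cbd D (fun z => - f z).
Proof.
move=> [cf [M fM]]; split=> [z Dz|]; first by apply: cvgN; exact: cf.
by exists M => z Dz; rewrite normrN; exact: fM.
Qed.

Lemma cbd_sum (V : topologicalType) (D : set V) (I : Type) (s : seq I) (f : I -> V -> R) :
  (forall i, cbd D (f i)) -> cbd D (fun z => \sum_(i <- s) f i z).
Proof.
move=> cf; elim: s => [|i s IH].
  by under eq_fun do rewrite big_nil; exact: cbd_cst.
by under eq_fun do rewrite big_cons; exact: cbdD.
Qed.

Lemma within_open_continuous (V : topologicalType) (U : set V) (f : V -> R) :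
  open U -> {within U, continuous f} -> forall z, U z -> {for z, continuous f}.
Proof.
by move=> oU; rewrite continuous_open_subspace// => cf z Uz; apply: cf; rewrite inE.
Qed.

Lemma C1_cbd (V : normedModType R) (U E : set V) (f : V -> R) :
  open U -> U `<=` E -> compact E -> C1 U E f ->
  cbd U f /\ forall e, cbd U ('D_e f).
Proof.
move=> oU UE cE [cf df gf].
have [M fM] := continuous_bounded_on cE cf.
split.
  split; last by exists M => z Uz; exact: fM (UE _ Uz).
  exact: (within_open_continuous oU (within_continuousS UE cf)).
move=> e; have [g cg gE] := gf e; have [N gN] := continuous_bounded_on cE cg.
split=> [z Uz|]; last by exists N => z Uz; rewrite gE//; exact: gN (UE _ Uz).
have cgz := within_open_continuous oU (within_continuousS UE cg) Uz.
rewrite /prop_for /continuous_at gE//.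
apply: cvg_trans cgz; apply: near_eq_cvg.
near=> y; apply/esym; apply: gE; near: y; exact: open_nbhs_nbhs.
Unshelve. all: by end_near. Qed.

End ContinuousBounded.

Section Swap.
Context {R : realType} {d : nat}.
Local Notation V := ('rV[R]_d * R)%type.
Local Notation VM := ('rV[R]_d * measurableTypeR R)%type.
Local Notation m := (@lebVt R d).
Variables (D : set VM) (mD : measurable D) (Dlty : (m D < +oo)%E).

Lemma cbd_measurable (f : V -> R) : cbd (D : set V) f -> measurable_fun D (f : VM -> R).
Proof.
move=> [cf _]; apply: measurable_within_rVR => //.
by apply: continuous_in_subspaceT => z; rewrite inE; exact: cf.
Qed.

Lemma cbd_integrable (f : V -> R) : cbd (D : set V) f -> m.-integrable D (EFin \o (f : VM -> R)).
Proof.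
move=> cf; have [_ [M fM]] := cf.
exact: (integrable_bdd mD Dlty (cbd_measurable cf) fM).
Qed.

Lemma cbd_mul_integrable (f u : V -> R) : cbd (D : set V) f ->
  m.-integrable D (EFin \o (u : VM -> R)) ->
  m.-integrable D (EFin \o (fun z : VM => f z * u z)).
Proof.
move=> cf iu; have [_ [M fM]] := cf.
exact: (integrableMbdd mD iu (cbd_measurable cf) fM).
Qed.

Lemma integrable_fst (u : V -> R) : m.-integrable D (EFin \o (u : VM -> R)) ->
  (m \x m)%E.-integrable (D `*` D) (EFin \o (fun p : VM * VM => u p.1)).
Proof.
move=> iu; have mu : measurable_fun D (u : VM -> R) by apply/measurable_EFinP; exact: measurable_int iu.
have mu1 : measurable_fun (D `*` D) (fun p : VM * VM => u p.1).
  apply: (@measurable_comp _ _ _ _ _ _ D) => //; last exact: measurable_funTS.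
  by move=> _ [p [Dp _] <-].
apply/integrableP; split; first exact/measurable_EFinP.
rewrite -(tonelli12 m m mD mD (f := fun p : VM * VM => `|(u p.1)%:E|%E)) //; last first.
  by apply: measurableT_comp => //; exact/measurable_EFinP.
rewrite (eq_integral (fun x : VM => `|(u x)%:E| * m D)%E); last first.
  by move=> x _ /=; rewrite -(integral_cst m mD).
rewrite ge0_integralZr//; last first.
  by apply: measurableT_comp => //; exact/measurable_EFinP.
have /integrableP[_ iulty] := iu.
by rewrite lte_mul_pinfty ?integral_ge0// ge0_fin_numE ?integral_ge0.
Qed.

(** The adjoint of a convolution restricted to D is the convolution with the
    reflected kernel. *)
Lemma conv_swap (u A k : V -> R) (M C : R) :
  m.-integrable D (EFin \o (u : VM -> R)) ->
  measurable_fun D (A : VM -> R) -> (forall z, D z -> `|A z| <= M) ->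
  continuous k -> (forall z, `|k z| <= C) ->
  m.-integrable D (EFin \o (fun a : VM => u a * \int[m]_(z in D) (A z * k ((z : V) - (a : V))))) /\
  m.-integrable D (EFin \o (fun z : VM => A z * \int[m]_(a in D) (u a * k ((z : V) - (a : V))))) /\
  \int[m]_(a in D) (u a * \int[m]_(z in D) (A z * k ((z : V) - (a : V)))) =
  \int[m]_(z in D) (A z * \int[m]_(a in D) (u a * k ((z : V) - (a : V)))).
Proof.
move=> iu mA AM ck kC.
pose f (p : VM * VM) := (A p.2 * k ((p.2 : V) - (p.1 : V))) * u p.1.
have if_ : (m \x m)%E.-integrable (D `*` D) (EFin \o f).
  apply: (integrableMbdd (M := M * C) _ (integrable_fst iu)).
  - exact: measurableX.
  - apply: measurable_funM.
      apply: (@measurable_comp _ _ _ _ _ _ D) => //; last exact: measurable_funTS.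
      by move=> _ [p [_ Dp] <-].
    apply: measurableT_comp; first exact: continuousT_measurable_VM.
    apply: measurable_funTS; apply: measurable_fun_pair => /=.
      apply: measurable_fun_mx => i j; under eq_fun do rewrite !mxE.
      apply: measurable_funB.
        apply: (measurableT_comp (measurable_mx_entry (R := R) i j)).
        exact: measurableT_comp.
      apply: (measurableT_comp (measurable_mx_entry (R := R) i j)).
      exact: measurableT_comp.
    by apply: measurable_funB; exact: measurableT_comp.
  - by move=> p [_ Dp]; rewrite normrM ler_pM// AM.
have mAk a : m.-integrable D (EFin \o (fun z : VM => A z * k ((z : V) - a))).
  apply: (integrable_bdd (M := M * C) mD Dlty).
    apply: measurable_funM => //; apply: measurable_funTS.
    exact: continuousT_measurable_VM (continuous_comp_sub a ck).1.
  by move=> z Dz; rewrite normrM ler_pM// AM.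
have iuk z : m.-integrable D (EFin \o (fun a : VM => u a * k (z - (a : V)))).
  have H : m.-integrable D (EFin \o (fun a : VM => k (z - (a : V)) * u a)).
    apply: (integrableMbdd (M := C) mD iu) => //; apply: measurable_funTS.
    exact: continuousT_measurable_VM (continuous_comp_sub z ck).2.
  by apply: eq_integrable H => // a _; rewrite /= mulrC.
have [i1 e1] := integrable_fubini12 mD mD if_.
have [i2 e2] := integrable_fubini21 mD mD if_.
have E1 a : \int[m]_(z in D) f (a, z) = u a * \int[m]_(z in D) (A z * k ((z : V) - (a : V))).
  by rewrite -RintegralZl//; apply: eq_Rintegral => z _; rewrite /f/= mulrC.
have E2 z : \int[m]_(a in D) f (a, z) = A z * \int[m]_(a in D) (u a * k ((z : V) - (a : V))).
  by rewrite -RintegralZl//; apply: eq_Rintegral => a _; rewrite /f/=; ring.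
split; first by apply: eq_integrable i1 => // a _; rewrite /= E1.
split; first by apply: eq_integrable i2 => // a _; rewrite /= E2.
transitivity (\int[m]_(a in D) \int[m]_(z in D) f (a, z)).
  by apply: eq_Rintegral => a _; rewrite E1.
by rewrite e1 -e2; apply: eq_Rintegral => a _; rewrite E2.
Qed.

End Swap.

(** * The Green identity in a boundary chart *)

Lemma cvgn_sum {R : realType} (I : Type) (s : seq I) (f : I -> nat -> R) (l : I -> R) :
  (forall i, f i @ \oo --> l i) ->
  (fun k => \sum_(i <- s) f i k) @ \oo --> \sum_(i <- s) l i.
Proof.
move=> fl; elim: s => [|i s IH].
  by under eq_fun do rewrite big_nil; rewrite big_nil; exact: cvg_cst.
under eq_fun do rewrite big_cons; rewrite big_cons; exact: cvgD (fl i) IH.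
Qed.

Section Green.
Context {R : realType} {d n : nat}.
Local Notation V := ('rV[R]_d * R)%type.
Local Notation VM := ('rV[R]_d * measurableTypeR R)%type.
Local Notation m := (@lebVt R d).
Local Notation dx j := ((delta_mx 0 j : 'rV[R]_d), (0 : R)).

Variables (Omega : set 'rV[R]_d) (T : R).
Hypotheses (oOmega : open Omega) (bOmega : bounded_set Omega).
Let D : set VM := Omega `*` `]0, T[.

Lemma open_cylinder : open (D : set V).
Proof.
rewrite openE => -[x t] [/= Ox It]; exists (Omega, `]0, T[%classic) => //.
split; apply: open_nbhs_nbhs; split => //.
Qed.

Lemma measurable_cylinder : measurable D.
Proof. exact: measurable_open_rVR open_cylinder. Qed.

Lemma cylinder_lty : (m D < +oo)%E.
Proof.
have mO := measurable_open_rV oOmega.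
rewrite [X in (X < _)%E](_ : _ = (lebV Omega * lebesgue_measure `]0%R, T[)%E); last first.
  by apply: lebVtE => //; exact: measurable_itv.
rewrite lte_mul_pinfty//.
  by rewrite ge0_fin_numE//; exact: lebV_bounded_lty.
by rewrite lebesgue_measure_itv/=; case: ifP => _; rewrite ?ltry// -EFinB ltry.
Qed.

(** The test functions do not vanish on the boundary of Omega, which encodes a
    zero normal component of F. *)
Definition weak_div (g : V -> R) (F : 'I_d -> V -> R) : Prop :=
  forall t, 0 < t < T -> forall phi, C1 Omega (closure Omega) phi ->
    \int[@lebV R d]_(x in Omega) (g (x, t) * phi x) =
    - \int[@lebV R d]_(x in Omega) (\sum_j F j (x, t) * 'D_(delta_mx 0 j) phi x).

(** Stated on space-time, where the test functions for the measure-valued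
    solution live; only derivatives in space enter. *)
Definition weak_grad (w : V -> R) (Y : 'I_d -> V -> R) : Prop :=
  forall phi, C1c (D : set V) (D : set V) phi -> forall j,
    \int[m]_(z in D) (w z * 'D_(dx j) phi z) = - \int[m]_(z in D) (Y j z * phi z).

Lemma slice_linear : linear (fun e : 'rV[R]_d => (e, 0 : R)) /\
  continuous (fun e : 'rV[R]_d => (e, 0 : R)).
Proof.
split; first by move=> a y z; apply/pair_equal_spec; split => //=; rewrite scaler0 addr0.
move=> y; apply: (@cvg_pair _ _ _ (nbhs y) (nbhs y) (nbhs (0 : R)) _ _ _ id (fun _ => 0)).
  exact: cvg_id.
exact: cvg_cst.
Qed.

Lemma slice_diff (f : V -> R) x t j : differentiable f (x, t) ->
  'D_(delta_mx 0 j) (fun y => f (y, t)) x = 'D_(dx j) f (x, t).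
Proof.
move=> df.
have [lL cL] := slice_linear.
have [dA DA] := affine_diff ((0, t) : V) x lL cL.
have E : (fun y : 'rV[R]_d => (y, 0 : R) + (0, t)) = (fun y => (y, t)).
  by apply/funext => y; rewrite -[(y, 0) + _]/(y + 0, 0 + t) addr0 add0r.
rewrite E in dA DA.
by have := derive_comp_diff (delta_mx 0 j) dA df; rewrite DA.
Qed.

Lemma reflect_diff (f : V -> R) (a z e : V) : differentiable f (a - z) ->
  'D_e (fun y => f (a - y)) z = - 'D_e f (a - z).
Proof.
move=> df.
have lL : linear (fun e : V => - e).
  by move=> k y w; rewrite opprD scalerN.
have cL : continuous (fun e : V => - e) by move=> y; apply: cvgN; exact: cvg_id.
have [dA DA] := affine_diff a z lL cL.
have E : (fun y : V => - y + a) = (fun y => a - y).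
  by apply/funext => y; rewrite addrC.
rewrite E in dA DA.
have := derive_comp_diff e dA df; rewrite DA => ->.
rewrite !deriveE//; exact: linearN.
Qed.

Lemma shift_slice_C1 (K : V -> R) (U E : set 'rV[R]_d) t (a : V) : C1 setT setT K ->
  C1 U E (fun x => K ((x, t) - a)) /\
  forall x j, 'D_(delta_mx 0 j) (fun x => K ((x, t) - a)) x = 'D_(dx j) K ((x, t) - a).
Proof.
move=> CK.
have [lL cL] := slice_linear.
pose c : V := (0, t) - a.
have E0 : (fun y : 'rV[R]_d => (y, 0 : R) + c) = (fun y => (y, t) - a).
  apply/funext => y; rewrite /c addrA; congr (_ - a).
  by rewrite -[(y, 0) + _]/(y + 0, 0 + t) addr0 add0r.
have dA x : differentiable (fun y : 'rV[R]_d => (y, t) - a) x.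
  by rewrite -E0; have [] := affine_diff c x lL cL.
have DA x e : 'D_e (fun y : 'rV[R]_d => (y, t) - a) x = (e, 0).
  by rewrite -E0; have [_ ->] := affine_diff c x lL cL.
split; first exact: (C1_precomp dA DA (U := setT) (E := setT)).
move=> x j; have [_ dK _] := CK.
by have := derive_comp_diff (delta_mx 0 j) (dA x) (dK _ I); rewrite DA.
Qed.

Lemma reflect_C1 (K : V -> R) (U E : set V) (a : V) : C1 setT setT K ->
  C1 U E (fun z => K (a - z)).
Proof.
move=> CK.
have lL : linear (fun e : V => - e).
  by move=> k y w; rewrite opprD scalerN.
have cL : continuous (fun e : V => - e) by move=> y; apply: cvgN; exact: cvg_id.
have E0 : (fun y : V => - y + a) = (fun y => a - y).
  by apply/funext => y; rewrite addrC.
apply: (C1_precomp (L := fun e : V => - e) (U := setT) (E := setT)) => // x;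
  rewrite -E0; by have [] := affine_diff a x lL cL.
Qed.

(** Fubini in time turns the spatial identity at each instant into a space-time
    identity against a translated kernel. *)
Lemma weak_div_kernel (g : V -> R) (F : 'I_d -> V -> R) (K : V -> R) c e a :
  cbd (D : set V) g -> (forall j, cbd (D : set V) (F j)) -> weak_div g F ->
  kernel_in c e K ->
  \int[m]_(z in D) (g z * K ((z : V) - a)) =
  - \sum_j \int[m]_(z in D) (F j z * 'D_(dx j) K ((z : V) - a)).
Proof.
move=> cg cF gF hK; have CK := kernel_C1 hK.
have mD := measurable_cylinder; have Dlty := cylinder_lty.
have mO := measurable_open_rV oOmega.
have mI : measurable (`]0, T[%classic : set (measurableTypeR R)) by exact: measurable_itv.
have cbdK (k : V -> R) C : continuous k -> (forall z, `|k z| <= C) ->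
    cbd (D : set V) (fun z : V => k (z - a)).
  move=> ck kC; split; last by exists C.
  by move=> z _; exact: (continuous_comp_sub a ck).1.
have [C KC] := kernel_bdd hK.
have cK := cbdK _ _ (kernel_continuous hK) KC.
have cDK j : cbd (D : set V) (fun z : V => 'D_(dx j) K (z - a)).
  have [C' KC'] := kernel_derive_bdd hK (dx j).
  by apply: cbdK KC'; exact: C1T_derive_continuous.
have i1 := cbd_integrable mD Dlty (cbdM cg cK).
have i2 j := cbd_integrable mD Dlty (cbdM (cF j) (cDK j)).
have i3 := integrable_sumR mD (index_enum 'I_d) i2.
rewrite -Rintegral_sum//.
have [_ <-] := integrable_fubini21 mO mI i1.
have [i4 E4] := integrable_fubini21 mO mI i3; rewrite -E4 -RintegralN//.
apply: eq_Rintegral => t; rewrite inE/= in_itv/= => tT.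
have [Cphi Dphi] := shift_slice_C1 Omega (closure Omega) t a CK.
rewrite (gF t tT _ Cphi); apply: (congr1 -%R); apply: eq_Rintegral => x _.
by apply: eq_bigr => j _; rewrite Dphi.
Qed.

Section local.
Variables (g u : 'I_n -> V -> R) (F Y : 'I_n -> 'I_d -> V -> R) (Pi : 'M[R]_n).
Hypotheses (cg : forall i, cbd (D : set V) (g i))
  (cF : forall i j, cbd (D : set V) (F i j))
  (gF : forall i, weak_div (g i) (F i))
  (iu : forall i, m.-integrable D (EFin \o (u i : VM -> R)))
  (iY : forall i j, m.-integrable D (EFin \o (Y i j : VM -> R)))
  (uY : forall i, weak_grad (fun z => \sum_l Pi i l * u l z) (Y i))
  (FPi : forall z, D z -> forall j (w : 'I_n -> R),
     \sum_i F i j z * w i = \sum_i F i j z * \sum_l Pi i l * w l).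

(** For fixed a the kernel z |-> K (z - a) tests the divergence of F, and for
    fixed z its reflection a |-> K (z - a) tests the weak gradient of u. The two
    derivatives differ by a sign, and exchanging the integrals links the two tests. *)
Lemma green_kernel (K : V -> R) c e : kernel_in c e K ->
  (forall z i j, D z -> F i j z != 0 ->
     C1c (D : set V) (D : set V) (fun a => K (z - a))) ->
  \sum_i \int[m]_(a in D) (u i a * \int[m]_(z in D) (g i z * K ((z : V) - (a : V)))) =
  - \sum_i \sum_j \int[m]_(a in D) (Y i j a * \int[m]_(z in D) (F i j z * K ((z : V) - (a : V)))).
Proof.
move=> hK FK; have CK := kernel_C1 hK; have [_ dK _] := CK.
have mD := measurable_cylinder; have Dlty := cylinder_lty.
have [C KC] := kernel_bdd hK; have cK := kernel_continuous hK.
have cDK j : continuous ('D_(dx j) K) by exact: C1T_derive_continuous.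
pose A i j z := \int[m]_(a in D) (u i a * 'D_(dx j) K ((z : V) - (a : V))).
have S i j : exists M', (forall z, D z -> `|F i j z| <= M') by have [_] := cF i j.
have swapF i j :
    [/\ m.-integrable D (EFin \o (fun a : VM => u i a * \int[m]_(z in D) (F i j z * 'D_(dx j) K ((z : V) - (a : V))))),
     m.-integrable D (EFin \o (fun z : VM => F i j z * A i j z)) &
     \int[m]_(a in D) (u i a * \int[m]_(z in D) (F i j z * 'D_(dx j) K ((z : V) - (a : V)))) =
     \int[m]_(z in D) (F i j z * A i j z)].
  have [M' HM] := S i j; have [C' HC] := kernel_derive_bdd hK (dx j).
  have [h1 [h2 h3]] := conv_swap mD Dlty (iu i) (cbd_measurable mD (cF i j)) HM (cDK j) HC.
  exact: (And3 h1 h2 h3).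
have step1 i : \int[m]_(a in D) (u i a * \int[m]_(z in D) (g i z * K ((z : V) - (a : V)))) =
    - \sum_j \int[m]_(z in D) (F i j z * A i j z).
  transitivity (\int[m]_(a in D) (- \sum_j u i a * \int[m]_(z in D) (F i j z * 'D_(dx j) K ((z : V) - (a : V))))).
    apply: eq_Rintegral => a _; rewrite (weak_div_kernel a (cg i) (cF i) (gF i) hK).
    by rewrite mulrN mulr_sumr.
  have iS : m.-integrable D (EFin \o (fun a : VM => \sum_j u i a * \int[m]_(z in D) (F i j z * 'D_(dx j) K ((z : V) - (a : V))))).
    by apply: integrable_sumR => // j; have [h1 h2 h3] := swapF i j; exact: h1.
  rewrite (RintegralN mD iS); apply: (congr1 -%R).
  rewrite (Rintegral_sum mD); last by move=> j; have [h1 h2 h3] := swapF i j; exact: h1.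
  by apply: eq_bigr => j _; have [h1 h2 h3] := swapF i j; exact: h3.
pose B i j z := \int[m]_(a in D) (Y i j a * K ((z : V) - (a : V))).
have swapY i j :
    m.-integrable D (EFin \o (fun z : VM => F i j z * B i j z)) /\
     \int[m]_(a in D) (Y i j a * \int[m]_(z in D) (F i j z * K ((z : V) - (a : V)))) =
     \int[m]_(z in D) (F i j z * B i j z).
  have [M' HM] := S i j.
  have [_ [h2 h3]] := conv_swap mD Dlty (iY i j) (cbd_measurable mD (cF i j)) HM cK KC.
  exact: (conj h2 h3).
under eq_bigr do rewrite step1.
rewrite sumrN; apply: (congr1 -%R).
transitivity (\int[m]_(z in D) \sum_i \sum_j F i j z * A i j z).
  rewrite (Rintegral_sum mD); last first.
    by move=> i; apply: integrable_sumR => // j; have [h1 h2 h3] := swapF i j; exact: h2.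
  apply: eq_bigr => i _; rewrite (Rintegral_sum mD)//.
  by move=> j; have [h1 h2 h3] := swapF i j; exact: h2.
transitivity (\int[m]_(z in D) \sum_i \sum_j F i j z * B i j z); last first.
  rewrite (Rintegral_sum mD); last first.
    by move=> i; apply: integrable_sumR => // j; have [h2 h3] := swapY i j; exact: h2.
  apply: eq_bigr => i _; rewrite (Rintegral_sum mD); last by move=> j; have [h2 h3] := swapY i j; exact: h2.
  by apply: eq_bigr => j _; have [h2 h3] := swapY i j; exact: (esym h3).
apply: eq_Rintegral => z; rewrite inE => Dz.
rewrite exchange_big [RHS]exchange_big /=; apply: eq_bigr => j _.
rewrite (FPi Dz j (fun i => A i j z)); apply: eq_bigr => i _.
have [->|Fz] := eqVneq (F i j z) 0; first by rewrite !mul0r.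
congr (_ * _).
have iuDK l : m.-integrable D (EFin \o (fun a : VM => u l a * 'D_(dx j) K ((z : V) - (a : V)))).
  have [C' HC] := kernel_derive_bdd hK (dx j).
  have H : m.-integrable D (EFin \o (fun a : VM => 'D_(dx j) K ((z : V) - (a : V)) * u l a)).
    apply: (integrableMbdd (M := C') mD (iu l)) => //; apply: measurable_funTS.
    exact: continuousT_measurable_VM (continuous_comp_sub z (cDK j)).2.
  by apply: eq_integrable H => // a _; rewrite /= mulrC.
transitivity (\int[m]_(a in D) \sum_l Pi i l * (u l a * 'D_(dx j) K ((z : V) - (a : V)))).
  rewrite Rintegral_sum//; last by move=> l; exact: integrable_scaleR.
  by apply: eq_bigr => l _; rewrite RintegralZl.
apply: oppr_inj; rewrite -(uY i (FK z i j Dz Fz)) -RintegralN//; last first.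
  by apply: integrable_sumR => // l; exact: integrable_scaleR.
apply: eq_Rintegral => a _; rewrite reflect_diff//; last exact: dK.
rewrite mulrN mulr_suml; apply: (congr1 -%R); apply: eq_bigr => l _; rewrite mulrA //.
Qed.

(** Kernels shrinking along the inward cone of a boundary chart: the reflected
    translates stay compactly supported in the cylinder, so they are legitimate
    test functions for the weak gradient, and no extension of u across the
    boundary is needed. *)
Lemma green_chart (x0 e : 'rV[R]_d) (r delta tau0 t0 : R) :
  0 < delta < 1 -> 0 < tau0 -> t0 < T ->
  (forall x, Omega x -> ball x0 r x -> forall tau h, 0 < tau < tau0 ->
     `|h - e| <= delta -> Omega (x + tau *: h)) ->
  (forall z i j, D z -> F i j z != 0 -> ball x0 r z.1 /\ z.2 < t0) ->
  \sum_i \int[m]_(z in D) (g i z * u i z) =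
  - \sum_i \sum_j \int[m]_(z in D) (F i j z * Y i j z).
Proof.
move=> /andP[d0 d1] tau00 t0T chart suppF.
have mD := measurable_cylinder; have Dlty := cylinder_lty.
pose tm := Num.min tau0 ((T - t0) / 2).
have tm0 : 0 < tm by rewrite lt_min tau00 divr_gt0// subr_gt0.
pose tau k := tm / k.+2%:R.
have tau_gt0 k : 0 < tau k by rewrite divr_gt0.
have tau_lt k : tau k < tm.
  by rewrite ltr_pdivrMr// ltr_pMr// ltr1n.
have tau_cvg : tau @ \oo --> 0.
  rewrite -[X in _ --> X](mulr0 tm); apply: cvgM; first exact: cvg_cst.
  have := @cvg_harmonic R; rewrite -(cvg_shiftS (@harmonic R)); exact.
pose c k : V := (- (tau k *: e), - tau k).
have hker k := kernel_exists (c k) (mulr_gt0 (tau_gt0 k) d0).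
pose K k := projT1 (cid (hker k)).
have hK k : kernel_in (c k) (tau k * delta) (K k) by rewrite /K; case: cid.
pose rr k := tau k * (`|e| + 2).
have rr_cvg : rr @ \oo --> 0.
  rewrite -[X in _ --> X](mul0r (`|e| + 2)); apply: cvgM => //; exact: cvg_cst.
have K_supp k z : K k z != 0 -> ball (c k) (tau k * delta) z by exact: (kernel_supp (hK k)).
have K_small k z : K k z != 0 -> `|z| < rr k.
  move=> /K_supp; rewrite -ball_normE /ball_/= => zc.
  have := ler_normD (z - c k) (c k); rewrite subrK => H.
  have ck : `|c k| <= tau k * (`|e| + 1).
    rewrite [leLHS]/Num.Def.normr/= ge_max !normrN normrZ !gtr0_norm//.
    have := normr_ge0 e; have := tau_gt0 k; nra.
  rewrite /rr; rewrite distrC in zc; have := tau_gt0 k; nra.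
have K_inside k z a i j : D z -> F i j z != 0 ->
    `|z - a - c k| <= tau k * delta -> (D : set V) a.
  move=> Dz Fz za; have [z1 z2] := suppF z i j Dz Fz; have [/= Oz Iz] := Dz.
  have E1 : `|z.1 - a.1 + tau k *: e| <= tau k * delta.
    have -> : z.1 - a.1 + tau k *: e = (z - a - c k).1 by rewrite /= opprK.
    by apply: le_trans za; rewrite [leRHS]/Num.Def.normr/= le_max lexx.
  have E2 : `|z.2 - a.2 + tau k| <= tau k * delta.
    have -> : z.2 - a.2 + tau k = (z - a - c k).2 by rewrite /= opprK.
    by apply: le_trans za; rewrite [leRHS]/Num.Def.normr/= le_max lexx orbT.
  have tk := tau_gt0 k; have := tau_lt k; rewrite lt_min => /andP[tk1 tk2].
  split => /=; last first.
    move: Iz; rewrite /= !in_itv/= => /andP[s0 sT].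
    move: E2; rewrite ler_norml; nra.
  pose h := (tau k)^-1 *: (a.1 - z.1).
  have -> : a.1 = z.1 + tau k *: h.
    by rewrite scalerA divff ?gt_eqF// scale1r addrC subrK.
  apply: (chart _ Oz z1); first by rewrite tk tk1.
  have -> : h - e = - (tau k)^-1 *: (z.1 - a.1 + tau k *: e).
    rewrite scalerDr scalerA mulNr mulVf ?gt_eqF// scaleN1r; congr (_ - _).
    by rewrite /h scaleNr -scalerN opprB.
  rewrite normrZ normrN gtr0_norm ?invr_gt0// ler_pdivrMl//.
have FK k z i j : D z -> F i j z != 0 ->
    C1c (D : set V) (D : set V) (fun a => K k (z - a)).
  move=> Dz Fz; split; first by apply: reflect_C1; exact: kernel_C1 (hK k).
  exists [set a : V | `|z - a - c k| <= tau k * delta]; split.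
  - apply: (@subclosed_compact _ _ [set a : V | `|a| <= `|z| + `|c k| + tau k * delta]).
    + have -> : [set a : V | `|z - a - c k| <= tau k * delta] =
        (fun a : V => `|z - a - c k|) @^-1` [set x | x <= tau k * delta] by [].
      apply: closed_comp; last exact: closed_le.
      move=> a _; apply: cvg_norm; apply: cvgB; last exact: cvg_cst.
      by apply: cvgB; [exact: cvg_cst|exact: cvg_id].
    + exact: compact_box.
    + move=> a /= za.
      have aE : z - c k - (z - a - c k) = a.
        by rewrite opprB addrA subrK opprB addrC subrK.
      rewrite -{1}aE; apply: le_trans (ler_normB _ _) _; apply: lerD => //.
      exact: ler_normB.
  - by move=> a; exact: (K_inside k z a i j).
  - move=> a [Da /= Na]; apply/eqP; apply/negP => /negP /K_supp.
    rewrite -ball_normE /ball_/= distrC => /ltW; exact: Na.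
have E k := green_kernel (hK k) (FK k).
have lim (w G : V -> R) : cbd (D : set V) G -> m.-integrable D (EFin \o (w : VM -> R)) ->
    (fun k => \int[m]_(a in D) (w a * \int[m]_(z in D) (G z * K k ((z : V) - (a : V))))) @ \oo -->
    \int[m]_(a in D) (G a * w a).
  move=> cG iw; have [contG [M0 GM0]] := cG.
  pose M := Num.max M0 0.
  have M_ge0 : 0 <= M by rewrite le_max lexx orbT.
  have GM z : D z -> `|G z| <= M by move=> /GM0 h; rewrite le_max h.
  have mG := cbd_measurable mD cG.
  have mw : measurable_fun D (w : VM -> R) by apply/measurable_EFinP; exact: measurable_int iw.
  have ik k : m.-integrable D (EFin \o (fun a : VM => w a * \int[m]_(z in D) (G z * K k ((z : V) - (a : V))))).
    have [C KC] := kernel_bdd (hK k).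
    by have [] := conv_swap mD Dlty iw mG GM (kernel_continuous (hK k)) KC.
  have H1 : {ae m, forall a, D a -> (w a * \int[m]_(z in D) (G z * K k ((z : V) - (a : V))))%:E @[k --> \oo] --> (G a * w a)%:E}.
    apply: aeW => a Da; apply/cvg_EFin; first by near=> k.
    rewrite [G a * w a]mulrC; apply: cvgM; first exact: cvg_cst.
    exact: (mollify_limit mD M_ge0 hK K_small rr_cvg mG GM open_cylinder Da (contG a Da)).
  have H2 : m.-integrable D (fun a => (M * `|w a|)%:E).
    apply: (integrable_scaleR mD M (f := fun a : VM => `|w a|)).
    exact: (@integrable_norm _ _ _ _ _ (w : VM -> R)).
  have H3 : {ae m, forall a k, D a -> (`|(w a * \int[m]_(z in D) (G z * K k ((z : V) - (a : V))))%:E| <= (M * `|w a|)%:E)%E}.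
    apply: aeW => a k Da; rewrite lee_fin normrM mulrC ler_wpM2r//.
    by have [_] := mollify_integrable mD a M_ge0 (hK k) mG GM.
  have [_ _] := @dominated_convergence _ _ _ m D mD
    (fun k a => (w a * \int[m]_(z in D) (G z * K k ((z : V) - (a : V))))%:E)
    (fun a => (G a * w a)%:E) (fun a => (M * `|w a|)%:E)
    (fun k => measurable_int _ (ik k))
    (measurable_int _ (cbd_mul_integrable mD cG iw))
    H1 H2 H3.
  move=> H.
  have fG : (\int[m]_(a in D) (G a * w a)%:E)%E \is a fin_num.
    by apply: integrable_fin_num => //; exact: cbd_mul_integrable.
  by apply: fine_cvg; rewrite fineK.
have lim1 : (fun k => \sum_i \int[m]_(a in D) (u i a * \int[m]_(z in D) (g i z * K k ((z : V) - (a : V)))))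
    @ \oo --> \sum_i \int[m]_(z in D) (g i z * u i z).
  by apply: cvgn_sum => i; exact: lim.
have lim2 : (fun k => - \sum_i \sum_j \int[m]_(a in D) (Y i j a * \int[m]_(z in D) (F i j z * K k ((z : V) - (a : V)))))
    @ \oo --> - \sum_i \sum_j \int[m]_(z in D) (F i j z * Y i j z).
  by apply: cvgN; apply: cvgn_sum => i; apply: cvgn_sum => j; exact: lim.
have EK := funext E : (_ = _ :> (nat -> R)).
rewrite EK in lim1.
exact: (cvg_unique _ lim1 lim2).
Unshelve. all: by end_near. Qed.

End local.
End Green.

(** * Inward cones and partitions of unity of a Lipschitz domain *)

Section Chart.
Context {R : realType} {d : nat}.
Implicit Types x h e : 'rV[R]_d.

Lemma mulmx_norm_bound (O : 'M[R]_d) : exists2 C, 0 <= C &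
  forall x j, `|(x *m O) 0 j| <= C * `|x|.
Proof.
exists (\sum_i \sum_j `|O i j|); first by do 2![apply: sumr_ge0 => ? _].
move=> x j; rewrite mxE mulr_suml; apply: le_trans (ler_norm_sum _ _ _) _.
apply: ler_sum => i _; rewrite normrM mulrC; apply: ler_pM => //.
  by rewrite (bigD1 j)//= lerDl sumr_ge0.
exact: coord_le_norm.
Qed.

(** An inward cone of directions, uniform near the base point: at a boundary
    point it is the axis of the graph, and the Lipschitz constant fixes its
    opening. *)
Definition inward_cone (Omega : set 'rV[R]_d) (x0 e : 'rV[R]_d) (r delta tau0 : R) :=
  forall x, Omega x -> ball x0 r x -> forall tau h, 0 < tau < tau0 ->
     `|h - e| <= delta -> Omega (x + tau *: h).

(** At an interior point any direction works, at a boundary point the axis of the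
    graph, taken back through the rotation O: moving up by tau beats the change
    of the Lipschitz graph along a small transversal displacement. *)
Lemma inward_coneP (Omega : set 'rV[R]_d) : lipschitz_domain Omega ->
  forall x0, closure Omega x0 -> exists e r delta tau0,
    [/\ 0 < r, 0 < delta < 1, 0 < tau0 & inward_cone Omega x0 e r delta tau0].
Proof.
move=> [oO _ _ _ HO] x0 cx0.
have step rho e h x tau : 0 < rho -> `|h - e| <= 1 -> ball x0 (rho / 2) x ->
    0 < tau < rho / (2 * (`|e| + 1)) -> ball x0 rho (x + tau *: h).
  move=> rho0 he; rewrite -!ball_normE /ball_/= => xx0 /andP[tau0 taurho].
  have e1 : 0 < 2 * (`|e| + 1) by have := normr_ge0 e; lra.
  move: taurho; rewrite ltr_pdivlMr// => taurho.
  have h1 : `|h| <= `|e| + 1.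
    by have := ler_normD (h - e) e; rewrite subrK; lra.
  rewrite opprD addrA; apply: le_lt_trans (ler_normB _ _) _.
  rewrite normrZ gtr0_norm//.
  have : tau * `|h| <= tau * (`|e| + 1) by rewrite ler_pM2l.
  have := normr_ge0 e; lra.
have [Ox0|NOx0] := pselect (Omega x0).
  have [rho rho0 Hrho] := @open_sub_ball _ _ _ oO x0 Ox0.
  exists 0, (rho / 2), 2^-1, (rho / (2 * (`|0 : 'rV[R]_d| + 1))); split => //.
  - by rewrite divr_gt0.
  - by apply/andP; split; lra.
  - by rewrite normr0 add0r mulr1 divr_gt0.
  - move=> x _ xx0 tau h tau0 h0; apply: Hrho; apply: (step _ 0) => //.
    by apply: le_trans h0 _; lra.
case: (HO x0 (conj cx0 NOx0)) => O [j] [g] [OO glip].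
move=> /nbhs_ballP[rho /= rho0 Hrho].
have [L L0 gL] : exists2 L, 0 <= L & forall y z, `|g y - g z| <= L * `|y - z|.
  case: glip => L [_ HL]; exists (`|L| + 1); first by rewrite addr_ge0.
  move=> y z; apply: (HL (`|L| + 1) _ (y, z)) => //.
  by rewrite (le_lt_trans (ler_norm L))// ltrDl.
have [C C0 HC] := mulmx_norm_bound O.
pose e : 'rV[R]_d := delta_mx 0 j *m O^T.
have eO : e *m O = delta_mx 0 j.
  rewrite /e -mulmxA; have /mulmx1C -> := OO; exact: mulmx1.
pose delta := (2 * (C * (L + 1) + 1))^-1.
have CL0 : 0 <= C * (L + 1) by rewrite mulr_ge0// addr_ge0.
have delta0 : 0 < delta by rewrite invr_gt0; lra.
have deltaCL : C * delta * (L + 1) < 2^-1.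
  rewrite mulrAC /delta -lter_pdivlMr; last by rewrite invr_gt0; lra.
  by rewrite invrK; lra.
have delta1 : delta < 1 by rewrite invf_lt1; lra.
exists e, (rho / 2), delta, (rho / (2 * (`|e| + 1))); split => //.
- by rewrite divr_gt0.
- by rewrite delta0.
- by rewrite divr_gt0//; have := normr_ge0 e; lra.
move=> x Ox xx0 tau h tauB he.
have xh : ball x0 rho (x + tau *: h) by apply: (step _ e) => //; lra.
have xrho : ball x0 rho x by apply: le_ball xx0; lra.
apply/(Hrho _ xh); have /(Hrho _ xrho) gx := Ox.
have /andP[tau0 _] := tauB.
have hO i : `|(h *m O) 0 i - (delta_mx 0 j : 'rV[R]_d) 0 i| <= C * delta.
  have -> : (h *m O) 0 i - (delta_mx 0 j : 'rV[R]_d) 0 i = ((h - e) *m O) 0 i.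
    by rewrite mulmxBl eO !mxE.
  by apply: le_trans (HC _ _) _; rewrite ler_wpM2l.
have hj : 1 - C * delta <= (h *m O) 0 j.
  have dj : (delta_mx 0 j : 'rV[R]_d) 0 j = 1 by rewrite mxE !eqxx.
  by have := hO j; rewrite dj ler_norml; lra.
have colh : `|col' j ((x + tau *: h) *m O) - col' j (x *m O)| <= tau * (C * delta).
  rewrite mulmxDl -scalemxAl.
  have -> : col' j (x *m O + tau *: (h *m O)) - col' j (x *m O) = tau *: col' j (h *m O).
    by apply/matrixP => a b; rewrite !mxE addrC addKr.
  rewrite normrZ gtr0_norm// ler_pM2l//.
  rewrite [leLHS]/Num.Def.normr/= mx_normrE; apply/bigmax_leP; split.
    by rewrite mulr_ge0// ltW.
  move=> [a b] _ /=; rewrite !mxE (ord1 a).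
  have db : (delta_mx 0 j : 'rV[R]_d) 0 (lift j b) = 0.
    by rewrite mxE eqxx/= eq_sym (negbTE (neq_lift _ _)).
  by have := hO (lift j b); rewrite db subr0 mxE.
have := gL (col' j ((x + tau *: h) *m O)) (col' j (x *m O)).
have : L * `|col' j ((x + tau *: h) *m O) - col' j (x *m O)| <= L * (tau * (C * delta)).
  by rewrite ler_wpM2l.
have -> : ((x + tau *: h) *m O) 0 j = (x *m O) 0 j + tau * (h *m O) 0 j.
  by rewrite mulmxDl -scalemxAl !mxE.
move: (g _) (g _) (`| _ - _|) gx => g1 g2 N gx HN.
have : tau * (1 - C * delta) <= tau * (h *m O) 0 j by rewrite ler_pM2l.
have : 0 < tau * (1 - C * delta * (L + 1)) by rewrite mulr_gt0//; lra.
rewrite ler_norml; lra.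
Qed.

(** Normalised bumps on a finite cover of the compact closure. *)
Lemma partition_of_unity (Omega : set 'rV[R]_d) (r : 'rV[R]_d -> R) :
  bounded_set Omega -> (forall x, closure Omega x -> 0 < r x) ->
  exists (s : seq 'rV[R]_d) (zeta : 'rV[R]_d -> 'rV[R]_d -> R),
    [/\ forall p, p \in s -> closure Omega p,
        forall p, C1 Omega (closure Omega) (zeta p),
        forall p x, p \in s -> Omega x -> zeta p x != 0 -> ball p (r p) x &
        forall x, closure Omega x -> \sum_(p <- s) zeta p x = 1].
Proof.
move=> bO r0.
have bcO : bounded_set (closure Omega).
  have [M [Mr OM]] := bO; exists (`|M| + 1); split; first exact: num_real.
  move=> N MN x cx.
  have : closed [set y : 'rV[R]_d | `|y| <= `|M| + 1].
    have -> : [set y : 'rV[R]_d | `|y| <= `|M| + 1] = Num.norm @^-1` [set a | a <= `|M| + 1] by [].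
    by apply: closed_comp; [move=> y _; exact: norm_continuous|exact: closed_le].
  move=> /closure_id E.
  apply: le_trans (ltW MN).
  suff : closure [set y : 'rV[R]_d | `|y| <= `|M| + 1] x by rewrite -E.
  apply: closure_subset cx => y Oy; apply: (OM (`|M| + 1)) => //.
  by rewrite (le_lt_trans (ler_norm M))// ltrDl.
have cO : compact (closure Omega).
  by apply: bounded_closed_compact => //; exact: closed_closure.
move: (cO); rewrite compact_cover => /(_ _ (closure Omega) (fun x => ball x (r x))).
case=> [x cx|x cx|s0 sO0 cov0].
- exact: ball_open.
- by exists x => //; exact: ballxx (r0 x cx).
pose s : seq 'rV[R]_d := finmap.enum_fset s0.
have sO p : p \in s -> closure Omega p by move=> /sO0; rewrite inE.
have cov x : closure Omega x -> exists2 p, p \in s & ball p (r p) x.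
  by move=> /cov0[p /= ps px]; exists p.
pose beta p x := \prod_(j < d) pospow 2 (r p ^+ 2 - (x 0 j - p 0 j) ^+ 2).
have beta_ge0 p x : 0 <= beta p x by apply: prodr_ge0 => j _; exact: pospow_ge0.
have Cbeta p (U E : set 'rV[R]_d) : U `<=` E -> C1 U E (beta p).
  by move=> UE; apply: C1_prod => // j; apply: C1_bump => //; exact: C1_coord.
have OcO : Omega `<=` closure Omega by exact: subset_closure.
pose sigma x := \sum_(p <- s) beta p x.
have sigma0 x : closure Omega x -> 0 < sigma x.
  move=> /cov[p ps [_ px]]; rewrite /sigma (big_rem p)//=.
  apply: ltr_pwDl; last by apply: sumr_ge0.
  apply: prodr_gt0 => j _; rewrite /pospow exprn_gt0// lt_max subr_gt0.
  apply/orP; right; have := px 0 j; rewrite /ball/= distrC => xj.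
  rewrite -[ltLHS]real_normK ?num_real// ltr_pXn2r// nnegrE//.
  by rewrite ltW// (le_lt_trans _ xj).
exists s, (fun p x => beta p x * (sigma x)^-1); split.
- exact: sO.
- move=> p; apply: C1_mul => //; first exact: Cbeta.
  by apply: C1_inv => //; apply: C1_sum => q; exact: Cbeta.
- move=> p x ps Ox; rewrite mulf_eq0 negb_or => /andP[+ _].
  rewrite prodf_seq_neq0 => /allP H.
  have rp : 0 < r p by apply: r0; exact: sO.
  split => // i j; rewrite (ord1 i) /ball/= distrC.
  by apply: bump_supp => //; exact: H (mem_index_enum j).
- by move=> x cx; rewrite -mulr_suml divff// gt_eqF// sigma0.
Qed.

End Chart.

(** * The Green identity on the whole domain *)

Lemma derive_sum_seq {R : realType} (V : normedModType R) (I : Type) (s : seq I)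
    (f : I -> V -> R) x e : (forall i, differentiable (f i) x) ->
  differentiable (fun y => \sum_(i <- s) f i y) x /\
  'D_e (fun y => \sum_(i <- s) f i y) x = \sum_(i <- s) 'D_e (f i) x.
Proof.
move=> df; elim: s => [|i s [IH1 IH2]].
  under eq_fun do rewrite big_nil; rewrite big_nil.
  by split; [exact: differentiable_cst|exact: derive_cst].
under eq_fun do rewrite big_cons; rewrite big_cons.
split; first exact: (differentiableD (df i) IH1).
rewrite -IH2; apply: deriveD; exact: diff_derivable.
Qed.

Section GreenGlobal.
Context {R : realType} {d n : nat}.
Local Notation V := ('rV[R]_d * R)%type.
Local Notation VM := ('rV[R]_d * measurableTypeR R)%type.
Local Notation m := (@lebVt R d).
Variables (Omega : set 'rV[R]_d) (T : R).
Hypotheses (lOmega : lipschitz_domain Omega).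
Let D : set VM := Omega `*` `]0, T[.

Let oOmega : open Omega. Proof. by case: lOmega. Qed.
Let bOmega : bounded_set Omega. Proof. by case: lOmega. Qed.

Lemma cbd_fst (f : 'rV[R]_d -> R) : cbd Omega f -> cbd (D : set V) (fun z => f z.1).
Proof.
move=> [cf [M fM]]; split; last by exists M => z [Oz _]; exact: fM.
move=> z [Oz _]; apply: (@continuous_comp _ _ _ (@fst 'rV[R]_d R) f).
  exact: cvg_fst.
exact: cf.
Qed.

Lemma cbd_slice (f : V -> R) t : 0 < t < T -> cbd (D : set V) f ->
  cbd Omega (fun x => f (x, t)).
Proof.
move=> tT [cf [M fM]]; split; last first.
  by exists M => x Ox; apply: fM; split => //=; rewrite in_itv.
move=> x Ox; apply: (@continuous_comp _ _ _ (fun x => (x, t)) f).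
  apply: (@cvg_pair _ _ _ (nbhs x) (nbhs x) (nbhs t) _ _ _ id (fun _ => t)).
    exact: cvg_id.
  exact: cvg_cst.
by apply: cf; split => //=; rewrite in_itv.
Qed.

Lemma cbd_integrable_slice (f : 'rV[R]_d -> R) : cbd Omega f ->
  (@lebV R d).-integrable Omega (EFin \o f).
Proof.
move=> [cf [M fM]]; have mO := measurable_open_rV oOmega.
apply: (@integrable_bdd _ _ _ _ _ mO _ M _ _ fM); first exact: lebV_bounded_lty.
apply: measurable_within_rV => //.
by apply: continuous_in_subspaceT => z; rewrite inE; exact: cf.
Qed.

Lemma closure_bounded (A : set 'rV[R]_d) : bounded_set A -> compact (closure A).
Proof.
move=> bO; apply: bounded_closed_compact; last exact: closed_closure.
have [M [Mr OM]] := bO; exists (`|M| + 1); split; first exact: num_real.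
move=> N MN x cx.
have : closed [set y : 'rV[R]_d | `|y| <= `|M| + 1].
  have -> : [set y : 'rV[R]_d | `|y| <= `|M| + 1] = Num.norm @^-1` [set a | a <= `|M| + 1] by [].
  by apply: closed_comp; [move=> y _; exact: norm_continuous|exact: closed_le].
move=> /closure_id E.
apply: le_trans (ltW MN).
suff : closure [set y : 'rV[R]_d | `|y| <= `|M| + 1] x by rewrite -E.
apply: closure_subset cx => y Oy; apply: (OM (`|M| + 1)) => //.
by rewrite (le_lt_trans (ler_norm M))// ltrDl.
Qed.

Lemma C1_cbd_Omega (f : 'rV[R]_d -> R) : C1 Omega (closure Omega) f ->
  cbd Omega f /\ forall e, cbd Omega ('D_e f).
Proof.
apply: C1_cbd => //; first exact: subset_closure.
exact: closure_bounded.
Qed.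

(** A cut-off zeta multiplies the flux and adds grad zeta . F to the source. *)
Lemma weak_div_localize (g : V -> R) (F : 'I_d -> V -> R) (zeta : 'rV[R]_d -> R) :
  cbd (D : set V) g -> (forall j, cbd (D : set V) (F j)) ->
  C1 Omega (closure Omega) zeta -> weak_div Omega T g F ->
  weak_div Omega T
    (fun z => zeta z.1 * g z + \sum_j 'D_(delta_mx 0 j) zeta z.1 * F j z)
    (fun j z => zeta z.1 * F j z).
Proof.
move=> cg cF Cz gF t tT phi Cphi.
have mO := measurable_open_rV oOmega.
have [cz cdz] := C1_cbd_Omega Cz; have [cp cdp] := C1_cbd_Omega Cphi.
have cgt := cbd_slice tT cg; have cFt j := cbd_slice tT (cF j).
have Czp : C1 Omega (closure Omega) (fun x => zeta x * phi x).
  by apply: C1_mul => //; exact: subset_closure.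
have := gF t tT _ Czp => E.
have i1 : (@lebV R d).-integrable Omega (EFin \o (fun x => g (x, t) * (zeta x * phi x))).
  by apply: cbd_integrable_slice; apply: cbdM => //; exact: cbdM.
have i2 : (@lebV R d).-integrable Omega (EFin \o (fun x => \sum_j 'D_(delta_mx 0 j) zeta x * F j (x, t) * phi x)).
  apply: cbd_integrable_slice; apply: cbd_sum => j; apply: cbdM => //.
  by apply: cbdM => //; exact: cdz.
have i3 : (@lebV R d).-integrable Omega (EFin \o (fun x => \sum_j F j (x, t) * 'D_(delta_mx 0 j) (fun x => zeta x * phi x) x)).
  apply: cbd_integrable_slice; apply: cbd_sum => j; apply: cbdM => //.
  by have [_] := C1_cbd_Omega Czp; exact.
transitivity (\int[@lebV R d]_(x in Omega) (g (x, t) * (zeta x * phi x) +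
    \sum_j 'D_(delta_mx 0 j) zeta x * F j (x, t) * phi x)).
  by apply: eq_Rintegral => x _ /=; rewrite mulrDl mulr_suml; congr (_ + _); ring.
have i4 : (@lebV R d).-integrable Omega (EFin \o (fun x => \sum_j zeta x * F j (x, t) * 'D_(delta_mx 0 j) phi x)).
  apply: cbd_integrable_slice; apply: cbd_sum => j; apply: cbdM; last exact: cdp.
  by apply: cbdM => //; exact: cFt.
have [_ dz _] := Cz; have [_ dp _] := Cphi.
have E3 : \int[@lebV R d]_(x in Omega) (\sum_j F j (x, t) * 'D_(delta_mx 0 j) (fun x => zeta x * phi x) x) =
    \int[@lebV R d]_(x in Omega) (\sum_j 'D_(delta_mx 0 j) zeta x * F j (x, t) * phi x) +
    \int[@lebV R d]_(x in Omega) (\sum_j zeta x * F j (x, t) * 'D_(delta_mx 0 j) phi x).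
  apply: etrans (RintegralD mO i2 i4).
  apply: eq_Rintegral => x; rewrite inE => Ox.
  rewrite -big_split; apply: eq_bigr => j _ /=.
  by rewrite derive_mul; [ring|exact: dz|exact: dp].
apply: (etrans (RintegralD mO i1 i2)).
apply: (etrans (congr1 (fun r => r + _) E)).
apply: (etrans (congr1 (fun r => - r + _) E3)).
have arith (a b : R) : - (a + b) + a = - b by ring.
exact: arith.
Qed.

(** The chart identities are summed over a partition of unity; the additional
    sources cancel because the gradients of the partition add up to zero. The
    field F takes values in the range of the projection Pi, so that only the weak
    gradient of Pi u is required. *)
Theorem green (g u : 'I_n -> V -> R) (F Y : 'I_n -> 'I_d -> V -> R)
    (Pi : 'M[R]_n) (t0 : R) : t0 < T ->
  (forall i, cbd (D : set V) (g i)) -> (forall i j, cbd (D : set V) (F i j)) ->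
  (forall i, weak_div Omega T (g i) (F i)) ->
  (forall i, m.-integrable D (EFin \o (u i : VM -> R))) ->
  (forall i j, m.-integrable D (EFin \o (Y i j : VM -> R))) ->
  (forall i, weak_grad Omega T (fun z => \sum_l Pi i l * u l z) (Y i)) ->
  (forall z, D z -> forall j (w : 'I_n -> R),
     \sum_i F i j z * w i = \sum_i F i j z * \sum_l Pi i l * w l) ->
  (forall z i j, D z -> F i j z != 0 -> z.2 < t0) ->
  \sum_i \int[m]_(z in D) (g i z * u i z) =
  - \sum_i \sum_j \int[m]_(z in D) (F i j z * Y i j z).
Proof.
move=> t0T cg cF gF iu iY uY FPi Ft0.
have mD : measurable D by exact: (measurable_cylinder T oOmega).
have Dlty : (m D < +oo)%E by exact: (cylinder_lty T oOmega bOmega).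
have : forall x, exists q : 'rV[R]_d * R * R * R, closure Omega x ->
    [/\ 0 < q.1.1.2, 0 < q.1.2 < 1, 0 < q.2 &
        inward_cone Omega x q.1.1.1 q.1.1.2 q.1.2 q.2].
  move=> x; have [cx|ncx] := pselect (closure Omega x); last by exists (0, 0, 0, 0).
  have [e [r [delta [tau0 H]]]] := inward_coneP lOmega cx.
  by exists (e, r, delta, tau0).
move=> /choice[q Hq].
have r_gt0 x : closure Omega x -> 0 < (q x).1.1.2 by case/Hq.
have [s [zeta [sO Czeta zsupp zsum]]] := partition_of_unity bOmega r_gt0.
have cz p : cbd (D : set V) (fun z => zeta p z.1).
  by apply: cbd_fst; have [] := C1_cbd_Omega (Czeta p).
have cdz p j : cbd (D : set V) (fun z => 'D_(delta_mx 0 j) (zeta p) z.1).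
  by apply: (@cbd_fst ('D_(delta_mx 0 j) (zeta p))); have [_] := C1_cbd_Omega (Czeta p); exact.
pose gp p i z := zeta p z.1 * g i z + \sum_j 'D_(delta_mx 0 j) (zeta p) z.1 * F i j z.
pose Fp p i j z := zeta p z.1 * F i j z.
have cgp p i : cbd (D : set V) (gp p i).
  apply: cbdD; first by apply: cbdM; [exact: cz|exact: cg].
  by apply: cbd_sum => j; apply: cbdM; [exact: cdz|exact: cF].
have cFp p i j : cbd (D : set V) (Fp p i j).
  by apply: cbdM; [exact: cz|exact: cF].
have local p : p \in s -> \sum_i \int[m]_(z in D) (gp p i z * u i z) =
    - \sum_i \sum_j \int[m]_(z in D) (Fp p i j z * Y i j z).
  move=> ps; have [r0 d01 tau0 cone] := Hq p (sO p ps).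
  apply: (green_chart oOmega bOmega (cgp p) (cFp p) _ iu iY uY _ d01 tau0 t0T cone).
  - by move=> i; apply: weak_div_localize.
  - move=> z Dz j w; rewrite /Fp.
    under eq_bigr do rewrite -mulrA; rewrite -mulr_sumr (FPi z Dz) mulr_sumr.
    by apply: eq_bigr => i _; rewrite mulrA.
  - move=> z i j Dz; rewrite mulf_eq0 negb_or => /andP[zp Fz].
    split; last exact: Ft0 Fz.
    by apply: zsupp => //; have [] := Dz.
have dsum x j : Omega x -> \sum_(p <- s) 'D_(delta_mx 0 j) (zeta p) x = 0.
  move=> Ox.
  have dzx p : differentiable (zeta p) x by have [_ dz _] := Czeta p; exact: dz.
  have [_ <-] := derive_sum_seq s (delta_mx 0 j) dzx.
  have E : \forall y \near x, (fun _ => 1 : R) y = \sum_(p <- s) zeta p y.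
    have : \forall y \near x, Omega y by exact: open_nbhs_nbhs.
    by apply: filterS => y Oy; rewrite zsum//; exact: subset_closure.
  rewrite -(near_eq_derive _ E); exact: derive_cst.
have gsum i z : D z -> \sum_(p <- s) gp p i z = g i z.
  move=> [/= Oz _]; rewrite big_split /= -mulr_suml zsum; last exact: subset_closure.
  rewrite mul1r exchange_big big1 ?addr0// => j _.
  by rewrite -mulr_suml dsum// mul0r.
have Fsum i j z : D z -> \sum_(p <- s) Fp p i j z = F i j z.
  move=> [/= Oz _]; rewrite -mulr_suml zsum ?mul1r//; exact: subset_closure.
transitivity (\sum_(p <- s) \sum_i \int[m]_(z in D) (gp p i z * u i z)).
  rewrite exchange_big /=; apply: eq_bigr => i _.
  rewrite -(Rintegral_sum mD); last by move=> p; exact: cbd_mul_integrable.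
  by apply: eq_Rintegral => z; rewrite inE => Dz; rewrite -mulr_suml gsum.
rewrite big_seq_cond; under eq_bigr => p /andP[ps _] do rewrite (local p ps).
rewrite -big_seq_cond sumrN; apply: (congr1 -%R).
rewrite exchange_big /=; apply: eq_bigr => i _.
rewrite exchange_big /=; apply: eq_bigr => j _.
rewrite -(Rintegral_sum mD); last by move=> p; exact: cbd_mul_integrable.
by apply: eq_Rintegral => z; rewrite inE => Dz; rewrite -mulr_suml Fsum.
Qed.

End GreenGlobal.

(** * Relative entropy and the remainder *)

Section RelativeEntropy.
Context {R : realType}.

Definition relent (s v : R) : R := (s * (ln s - 1) + 1) - s * ln v + (v - 1).

Lemma ln_ge1V (x : R) : 0 < x -> 1 - x^-1 <= ln x.
Proof.
move=> x0; have := @le_ln1Dx R (x^-1 - 1).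
have -> : 1 + (x^-1 - 1) = x^-1 by ring.
have xV : 0 < x^-1 by rewrite invr_gt0.
move=> /(_ ltac:(lra)); rewrite lnV ?posrE//; lra.
Qed.

(** The relative entropy dominates the squared Hellinger distance, uniformly
    in s: bounded and large densities are treated at once, where a quadratic
    lower bound would only serve the bounded ones. *)
Lemma relent_sqrt (s v : R) : 0 <= s -> 0 < v ->
  (Num.sqrt s - Num.sqrt v) ^+ 2 <= relent s v.
Proof.
rewrite le_eqVlt => /predU1P[<-|s0] v0; rewrite /relent.
  rewrite sqrtr0 !mul0r sub0r sqrrN sqr_sqrtr; [lra|exact: ltW].
have sr0 : 0 < Num.sqrt s by rewrite sqrtr_gt0.
have vr0 : 0 < Num.sqrt v by rewrite sqrtr_gt0.
have sE : s = Num.sqrt s ^+ 2 by rewrite sqr_sqrtr ?ltW.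
have vE : v = Num.sqrt v ^+ 2 by rewrite sqr_sqrtr ?ltW.
rewrite [in X in _ <= X]sE [in X in _ <= X]vE.
move: (Num.sqrt s) (Num.sqrt v) sr0 vr0 => a b a0 b0.
rewrite !lnXn//.
have := @ln_ge1V (a / b) (divr_gt0 a0 b0); rewrite invf_div ln_div ?posrE// => H.
have : a ^+ 2 * (1 - b / a) <= a ^+ 2 * (ln a - ln b).
  by rewrite ler_wpM2l// sqr_ge0.
have -> : a ^+ 2 * (1 - b / a) = a ^+ 2 - a * b by field; rewrite gt_eqF.
move=> H2; rewrite !mulr2n sqrrB; lra.
Qed.

Lemma relent_ge0 (s v : R) : 0 <= s -> 0 < v -> 0 <= relent s v.
Proof. by move=> s0 v0; apply: le_trans (relent_sqrt s0 v0); exact: sqr_ge0. Qed.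

Lemma relent_eq0 (s v : R) : 0 <= s -> 0 < v -> relent s v <= 0 -> s = v.
Proof.
move=> s0 v0 r0; have := le_trans (relent_sqrt s0 v0) r0.
rewrite le_eqVlt ltNge sqr_ge0 orbF sqrf_eq0 subr_eq0 => /eqP E.
by rewrite -[s]sqr_sqrtr// E sqr_sqrtr ?ltW.
Qed.

(** With s - v = (a - b) a + (a - b) b, where a and b are the square roots of s
    and v, the part containing a is absorbed by s x^2 and the part containing b by
    eps x^2; both leave a multiple of (a - b)^2. *)
Lemma cross_term_bound (s v x l M N eps : R) : 0 <= s -> 0 < v -> v <= M ->
  `|l| <= N -> 0 < eps ->
  (s - v) * x * l - s * x ^+ 2 <=
  eps * x ^+ 2 + (N ^+ 2 / 4 + N ^+ 2 * M / (4 * eps)) * relent s v.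
Proof.
move=> s0 v0 vM lN eps0.
have N0 : 0 <= N by apply: le_trans lN.
have := relent_sqrt s0 v0; set h := relent s v => hh.
have sE : s = Num.sqrt s ^+ 2 by rewrite sqr_sqrtr.
have vE : v = Num.sqrt v ^+ 2 by rewrite sqr_sqrtr ?ltW.
have a0 := sqrtr_ge0 s; have b0 := sqrtr_ge0 v.
have l2 : l ^+ 2 <= N ^+ 2.
  by rewrite -[l ^+ 2]real_normK ?num_real// lerXn2r// nnegrE.
have bM : Num.sqrt v ^+ 2 <= M by rewrite -vE.
move: hh; rewrite sE [in X in X -> _]vE [in X in X * x]vE.
rewrite !sqrtr_sqr !ger0_norm//.
move: (Num.sqrt s) (Num.sqrt v) a0 b0 bM => a b a0 b0 bM hh.
have Y1 : (a - b) * a * x * l <= a ^+ 2 * x ^+ 2 + (a - b) ^+ 2 * l ^+ 2 / 4.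
  have := sqr_ge0 (a * x - (a - b) * l / 2); nra.
have Y2 : (a - b) * b * x * l <= eps * x ^+ 2 + (a - b) ^+ 2 * l ^+ 2 * b ^+ 2 / (4 * eps).
  have : 0 <= (2 * eps * x - (a - b) * b * l) ^+ 2 / (4 * eps).
    by rewrite divr_ge0 ?sqr_ge0// mulr_ge0// ltW.
  have -> : (2 * eps * x - (a - b) * b * l) ^+ 2 / (4 * eps) =
    eps * x ^+ 2 - (a - b) * b * x * l + (a - b) ^+ 2 * l ^+ 2 * b ^+ 2 / (4 * eps).
    by field; rewrite gt_eqF.
  lra.
have h0 : 0 <= h by apply: le_trans hh; exact: sqr_ge0.
have Z1 : (a - b) ^+ 2 * l ^+ 2 <= h * N ^+ 2.
  by apply: ler_pM => //; exact: sqr_ge0.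
have Z2 : (a - b) ^+ 2 * l ^+ 2 * b ^+ 2 / (4 * eps) <= h * N ^+ 2 * M / (4 * eps).
  rewrite ler_pM2r ?invr_gt0 ?mulr_gt0//.
  apply: ler_pM => //; [by apply: mulr_ge0; exact: sqr_ge0|exact: sqr_ge0].
have -> : (a ^+ 2 - b ^+ 2) * x * l = (a - b) * a * x * l + (a - b) * b * x * l by ring.
have -> : (N ^+ 2 / 4 + N ^+ 2 * M / (4 * eps)) * h =
   h * N ^+ 2 / 4 + h * N ^+ 2 * M / (4 * eps) by ring.
lra.
Qed.

End RelativeEntropy.

Section Dissipation.
Context {R : realType} {d n : nat}.
Variable B : 'M[R]_n.
Hypothesis Bpsd : psd B.

(** The integrand left over after all evolution identities have been added. *)
Definition remainder (v : 'cV[R]_n) (Vx lx : 'M[R]_(n, d)) (s : 'cV[R]_n)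
    (p : 'M[R]_(n, d)) : R :=
  let q := B *m p in let Q := B *m Vx in
  let M := \matrix_(i, j) (Vx i j + v i 0 * Q i j) in
  - mxdot p q - (\sum_i s i 0 * mxdot (row i q) (row i q))
  + (\sum_i \sum_j (s i 0 * q i j) * (lx i j + Q i j))
  + (\sum_i \sum_j (B *m M) i j * (p i j - Vx i j))
  - (\sum_i (s i 0 - v i 0) * \sum_j Q i j * lx i j).

(** Completing the square in p: since B P = B, the projected gradient of v can
    replace the gradient of v in every term. *)
Lemma remainderE (v : 'cV[R]_n) (Vx lx : 'M[R]_(n, d)) (s : 'cV[R]_n) (p : 'M[R]_(n, d)) : (forall i j, v i 0 * lx i j = Vx i j) ->
  let q := B *m p in let Q := B *m Vx in let X := p - projLperp B *m Vx in
  remainder v Vx lx s p = - mxdot X (B *m X) +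
    \sum_i \sum_j ((s i 0 - v i 0) * (q i j - Q i j) * (lx i j - Q i j) -
       s i 0 * (q i j - Q i j) ^+ 2).
Proof.
move=> Vl q Q X; have [Bsym _] := Bpsd.
have BP : B *m (projLperp B *m Vx) = Q by rewrite mulmxA mul_projLperp.
have PB Z : mxdot (projLperp B *m Vx) (B *m Z) = mxdot Vx (B *m Z).
  by rewrite mxdot_mull mulmxA -{2}Bsym -trmx_mul mul_projLperp Bsym.
have XE : mxdot X (B *m X) = mxdot p q - 2 * mxdot Vx q + mxdot Vx Q.
  rewrite /X mulmxBr BP mxdotDl mxdotNl !mxdotDr !mxdotNr -/q.
  have -> : mxdot p Q = mxdot Vx q.
    by rewrite mxdotC mxdot_mull Bsym.
  rewrite PB -{2}BP mulmxA mul_projLperp PB; lra.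
rewrite XE /remainder -/q -/Q.
set M := \matrix_(i, j) _.
have ME i j : M i j = Vx i j + v i 0 * Q i j by rewrite mxE.
have -> : \sum_i \sum_j (B *m M) i j * (p i j - Vx i j) = mxdot M (q - Q).
  transitivity (mxdot (B *m M) (p - Vx)).
    by apply: eq_bigr => i _; apply: eq_bigr => j _; rewrite !mxE.
  by rewrite mxdot_mull Bsym mulmxBr.
have -> : \sum_i s i 0 * mxdot (row i q) (row i q) = \sum_i \sum_j s i 0 * q i j ^+ 2.
  apply: eq_bigr => i _; rewrite /mxdot big_ord1 mulr_sumr.
  by apply: eq_bigr => j _; rewrite !mxE expr2.
have -> : \sum_i (s i 0 - v i 0) * (\sum_j Q i j * lx i j) =
    \sum_i \sum_j (s i 0 - v i 0) * (Q i j * lx i j).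
  by apply: eq_bigr => i _; rewrite mulr_sumr.
have E : \sum_i \sum_j ((s i 0 - v i 0) * (q i j - Q i j) * (lx i j - Q i j) -
       s i 0 * (q i j - Q i j) ^+ 2) =
   - 2 * mxdot Vx q + mxdot Vx Q - \sum_i \sum_j s i 0 * q i j ^+ 2
   + \sum_i \sum_j s i 0 * q i j * (lx i j + Q i j) + mxdot M (q - Q)
   - \sum_i \sum_j (s i 0 - v i 0) * (Q i j * lx i j).
  rewrite /mxdot [- 2 * _]mulr_sumr -big_split -sumrB -big_split -big_split -sumrB /=.
  apply: eq_bigr => i _.
  rewrite [- 2 * _]mulr_sumr -big_split -sumrB -big_split -big_split -sumrB /=.
  apply: eq_bigr => j _.
  have -> : (q - Q) i j = q i j - Q i j by rewrite mxE [(- Q) i j]mxE.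
  by rewrite ME -Vl; ring.
rewrite E; lra.
Qed.

(** The drift log v - B v has bounded gradient; the cross terms are absorbed by
    the dissipation of B, each row of B X being controlled by the form of X. *)
Lemma remainder_bound (M N : R) : 0 <= M -> 0 <= N ->
  exists2 C, 0 <= C & forall (v : 'cV[R]_n) (Vx lx : 'M[R]_(n, d)) (s : 'cV[R]_n) (p : 'M[R]_(n, d)),
    (forall i j, v i 0 * lx i j = Vx i j) ->
    (forall i, 0 < v i 0 <= M) ->
    (forall i j, `|lx i j - (B *m Vx) i j| <= N) ->
    (forall i, 0 <= s i 0) ->
    let X := p - projLperp B *m Vx in
    remainder v Vx lx s p <=
      C * (\sum_i relent (s i 0) (v i 0)) - 2^-1 * mxdot X (B *m X).
Proof.
move=> M0 N0.
have Bii i : 0 <= B i i.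
  have [_ /(_ (delta_mx i 0))] := Bpsd.
  by rewrite trmx_delta -rowE -colE !mxE.
pose b := \sum_i \sum_(j < d) B i i.
have b0 : 0 <= b by do 2![apply: sumr_ge0 => ? _].
(* Half of the form of X has to survive the sum over all entries. *)
pose eps := (2 * (b + 1))^-1.
have eps0 : 0 < eps by rewrite invr_gt0; lra.
have epsb : eps * b <= 2^-1.
  rewrite /eps mulrC ler_pdivrMr; last by lra.
  by rewrite mulrA mulVf// mul1r; lra.
pose c := N ^+ 2 / 4 + N ^+ 2 * M / (4 * eps).
have c0 : 0 <= c.
  have N2 := sqr_ge0 N; apply: addr_ge0; first by apply: divr_ge0.
  by apply: divr_ge0; [exact: mulr_ge0|rewrite mulr_ge0// ltW].
exists (c *+ d); [exact: mulrn_wge0|].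
move=> v Vx lx s p Vl vM lN s0 /=; rewrite (remainderE s p Vl).
set X := p - _.
have BX : B *m p - B *m Vx = B *m X.
  by rewrite /X mulmxBr mulmxA mul_projLperp.
have H i j : (s i 0 - v i 0) * ((B *m p) i j - (B *m Vx) i j) * (lx i j - (B *m Vx) i j) -
       s i 0 * ((B *m p) i j - (B *m Vx) i j) ^+ 2 <=
   eps * B i i * mxdot X (B *m X) + c * relent (s i 0) (v i 0).
  have /andP[vi0 viM] := vM i.
  apply: le_trans (cross_term_bound _ (s0 i) vi0 viM (lN i j) eps0) _.
  rewrite lerD2r -mulrA ler_pM2l//.
  apply: le_trans (psd_row_bound X i Bpsd).
  rewrite -BX /mxdot big_ord1 (bigD1 j)//= !mxE expr2 lerDl.
  by apply: sumr_ge0 => k _; rewrite -expr2 sqr_ge0.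
have X0 := psd_mxdot_ge0 X Bpsd.
apply: le_trans (_ : - mxdot X (B *m X) + \sum_i \sum_(j < d)
   (eps * B i i * mxdot X (B *m X) + c * relent (s i 0) (v i 0)) <= _).
  by rewrite lerD2l; do 2![apply: ler_sum => ? _]; exact: H.
have -> : \sum_i \sum_(j < d) (eps * B i i * mxdot X (B *m X) + c * relent (s i 0) (v i 0)) =
   eps * b * mxdot X (B *m X) + c *+ d * \sum_i relent (s i 0) (v i 0).
  transitivity (\sum_i (eps * (B i i *+ d) * mxdot X (B *m X) + c *+ d * relent (s i 0) (v i 0))).
    apply: eq_bigr => i _; rewrite big_split /= !sumr_const !card_ord.
    by rewrite mulrnAr !mulrnAl.
  rewrite big_split /= -mulr_suml -!mulr_sumr; congr (_ * _ * _ + _).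
  by apply: eq_bigr => i _; rewrite sumr_const card_ord.
have : eps * b * mxdot X (B *m X) <= 2^-1 * mxdot X (B *m X) by rewrite ler_wpM2r.
lra.
Qed.

(** B is injective on the orthogonal complement of its kernel, so a matrix A
    inverts it there; this bounds p by B p on the state space. *)
Lemma Lperp_recover : exists A : 'M[R]_n, forall k (X : 'M[R]_(n, k)),
  (X^T <= Lperp B)%MS -> X = A *m (B *m X).
Proof.
pose U := row_base (Lperp B).
have UBfree : row_free (U *m B^T).
  apply: inj_row_free => x; rewrite mulmxA => /sub_kermxP xU.
  have xL : (x *m U <= Lperp B)%MS.
    by rewrite (submx_trans (submxMl _ _))// eq_row_base.
  have : (x *m U <= (0 : 'M[R]_n))%MS by rewrite -(kerL_Lperp0 B) sub_capmx xU xL.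
  rewrite submx0 => /eqP xU0; apply: (row_free_inj (row_base_free (Lperp B))).
  by rewrite mul0mx.
exists (pinvmx (U *m B^T) *m U)^T => k X XL.
have : (X^T <= U)%MS by rewrite eq_row_base.
move=> /submxP[c cE]; apply: trmx_inj.
rewrite trmx_mul trmx_mul trmxK cE.
have -> : c *m U *m B^T *m (pinvmx (U *m B^T) *m U) =
    c *m ((U *m B^T) *m pinvmx (U *m B^T)) *m U by rewrite !mulmxA.
by rewrite mulmxVp// mulmx1.
Qed.

End Dissipation.

(** * Measurability of the moments of a Young measure *)

Section MatrixCompact.
Context {R : realType}.

Lemma continuous_vec_mx m n : continuous (@vec_mx R m n).
Proof.
move=> x A /nbhs_ballP[e /= e0 HA]; apply/nbhs_ballP; exists e => //= y [_ xy].
by apply: HA; split => // i j; rewrite !mxE; exact: xy.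
Qed.

Lemma compact_mx_le m n (c : R) : compact [set M : 'M[R]_(m, n) | `|M| <= c].
Proof.
pose Q := [set x : 'rV[R]_(m * n) | forall i, x ord0 i \in `[(-c), c]].
have cQ : compact Q.
  by apply: (@rV_compact _ _ (fun=> `[(- c), c]%classic)) => _; exact: segment_compact.
have cvQ : compact (vec_mx @` Q : set 'M[R]_(m, n)).
  by apply: continuous_compact => //; apply: continuous_subspaceT; exact: continuous_vec_mx.
apply: subclosed_compact cvQ _.
  have -> : [set M : 'M[R]_(m, n) | `|M| <= c] = Num.norm @^-1` [set a | a <= c] by [].
  by apply: closed_comp; [move=> y _; exact: norm_continuous|exact: closed_le].
move=> M /= Mc; exists (mxvec M); last exact: mxvecK.
move=> i; rewrite in_itv/= -ler_norml; case/mxvec_indexP: i => i j.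
by rewrite mxvecE (le_trans (coord_le_norm _ _ _)).
Qed.

Lemma compact_pair_le m n m' n' (c : R) :
  compact [set w : 'M[R]_(m, n) * 'M[R]_(m', n') | `|w| <= c].
Proof.
apply: (@subclosed_compact _ _ ([set M | `|M| <= c] `*` [set M | `|M| <= c])).
- have -> : [set w : 'M[R]_(m, n) * 'M[R]_(m', n') | `|w| <= c] = Num.norm @^-1` [set x | x <= c] by [].
  by apply: closed_comp; [move=> z _; exact: norm_continuous|exact: closed_le].
- by apply: compact_setX; exact: compact_mx_le.
- by move=> z zM; split; apply: le_trans zM; rewrite [leRHS]/Num.Def.normr/= le_max lexx ?orbT.
Qed.

End MatrixCompact.

Section Young.
Context {R : realType} {d n : nat}.
Local Notation V := ('rV[R]_d * R)%type.
Local Notation VM := ('rV[R]_d * measurableTypeR R)%type.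
Local Notation W := ('cV[R]_n * 'M[R]_(n, d))%type.
Variables (Omega : set 'rV[R]_d) (B : 'M[R]_n) (mu : V -> probability W R).
Let Sp : set W := state_space B.

Lemma continuous_coord1 i : continuous (fun w : W => w.1 i 0).
Proof.
move=> w; apply: (@continuous_comp _ _ _ (@fst 'cV[R]_n 'M[R]_(n, d)) (fun s : 'cV[R]_n => s i 0)).
  exact: cvg_fst.
exact: coord_continuous.
Qed.

Lemma continuous_coord2 i j : continuous (fun w : W => w.2 i j).
Proof.
move=> w; apply: (@continuous_comp _ _ _ (@snd 'cV[R]_n 'M[R]_(n, d)) (fun s : 'M[R]_(n, d) => s i j)).
  exact: cvg_snd.
exact: coord_continuous.
Qed.

Lemma continuous_sumR (U : topologicalType) (I : Type) (s : seq I) (f : I -> U -> R) :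
  (forall i, continuous (f i)) -> continuous (fun w => \sum_(i <- s) f i w).
Proof.
move=> cf; elim: s => [|i s IH] w.
  by under eq_fun do rewrite big_nil; exact: cvg_cst.
by under eq_fun do rewrite big_cons; apply: cvgD; [exact: cf|exact: IH].
Qed.

Lemma closed_state_space : closed Sp.
Proof.
have -> : Sp = (\bigcap_i [set w : W | 0 <= w.1 i 0]) `&`
    \bigcap_ij [set w : W | \sum_k w.2 k ij.1 * cokermx (Lperp B) k ij.2 = 0].
  apply/seteqP; split => [w [w1 w2]|w [w1 w2]].
    split; first by move=> i _; exact: w1.
    move=> [i j] _ /=; move: w2; rewrite submxE => /eqP/matrixP/(_ i j).
    rewrite mxE [X in _ = X]mxE; apply: etrans.
    by apply: eq_bigr => k _; rewrite [X in _ = X * _]mxE.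
  split; first by move=> i; exact: (w1 i I).
  rewrite submxE; apply/eqP/matrixP => i j; rewrite [RHS]mxE -[RHS](w2 (i, j) I) mxE.
  by apply: eq_bigr => k _; rewrite [X in X * _ = _]mxE.
apply: closedI; apply: closed_bigI => i _.
  have -> : [set w : W | 0 <= w.1 i 0] = (fun w : W => w.1 i 0) @^-1` [set r | 0 <= r] by [].
  by apply: closed_comp; [move=> w _; exact: continuous_coord1|exact: closed_ge].
have -> : [set w : W | \sum_k w.2 k i.1 * cokermx (Lperp B) k i.2 = 0] =
   (fun w : W => \sum_k w.2 k i.1 * cokermx (Lperp B) k i.2) @^-1` [set 0] by [].
apply: closed_comp; last exact: closed_eq.
move=> w _; apply: continuous_sumR => k w'; apply: cvgM; last exact: cvg_cst.
exact: continuous_coord2.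
Qed.

Lemma measurable_state_space : measurable Sp.
Proof.
rewrite -[Sp]setCK; apply: measurableC; apply: measurable_open_mxmx.
by apply: closed_openC; exact: closed_state_space.
Qed.

Lemma continuousT_measurable_W (f : W -> R) : continuous f -> measurable_fun setT f.
Proof.
by move=> cf; apply: measurable_within_mxmx => //; exact: continuous_subspaceT.
Qed.

Hypothesis young : young_measure Omega B mu.

(** Equal to 1 on the ball of radius k and supported in the ball of radius k + 1;
    increasing in k, as monotone convergence requires. *)
Definition cutoff (k : nat) (w : W) : R := Num.max 0 (Num.min 1 (k.+1%:R - `|w|)).

Lemma cutoff_continuous k : continuous (cutoff k).
Proof.
move=> w.
have c : {for w, continuous (cst 1 \min (fun w : W => k.+1%:R - `|w|))}.
  apply: continuous_min; first exact: cvg_cst.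
  by apply: cvgB; [exact: cvg_cst|exact: norm_continuous].
have c0 : {for w, continuous (cst (0 : R) : W -> R)} by exact: cvg_cst.
exact: (continuous_max c0 c).
Qed.

Lemma cutoff_ge0 k w : 0 <= cutoff k w.
Proof. by rewrite le_max lexx. Qed.

Lemma cutoff_far k w : k.+1%:R < `|w| -> cutoff k w = 0.
Proof.
move=> kw; rewrite /cutoff max_l// ge_min; apply/orP; right; lra.
Qed.

Lemma cutoff_near k w : `|w| <= k%:R -> cutoff k w = 1.
Proof.
move=> kw; rewrite /cutoff min_l ?max_r// -natr1; lra.
Qed.

Lemma cutoff_le k k' w : (k <= k')%N -> cutoff k w <= cutoff k' w.
Proof.
move=> kk'; have : k.+1%:R <= k'.+1%:R :> R by rewrite ler_nat.
rewrite /cutoff => H.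
rewrite ge_max le_max lexx/= le_max; apply/orP; right.
rewrite le_min !ge_min lexx /=; apply/orP; right; lra.
Qed.

(** Only test functions vanishing at infinity are controlled by the Young
    measure; truncation and monotone convergence reach all nonnegative
    continuous ones. *)
Lemma young_measurable (f : W -> R) : continuous f -> (forall w, Sp w -> 0 <= f w) ->
  measurable_fun (Omega `*` `[0, +oo[ : set VM)
    (fun z => \int[mu z]_(w in Sp) (f w)%:E)%E.
Proof.
move=> cf f0; have [mu1 muC0] := young.
have mS := measurable_state_space.
pose fk k w := f w * cutoff k w.
have cfk k : continuous (fk k).
  by move=> w; apply: cvgM; [exact: cf|exact: cutoff_continuous].
have mfk k : measurable_fun Sp (EFin \o fk k).
  apply/measurable_EFinP; apply: measurable_funTS.
  exact: continuousT_measurable_W.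
have fk_bdd k : exists C, forall w, `|fk k w| <= C.
  have [C HC] := continuous_bounded_on (@compact_pair_le _ n 1 n d k.+1%:R)
    (continuous_subspaceT (cfk k)).
  exists (Num.max C 0) => w; have [wk|wk] := leP `|w| k.+1%:R.
    by rewrite (le_trans (HC w wk))// le_max lexx.
  by rewrite /fk cutoff_far// mulr0 normr0 le_max lexx orbT.
have fkC0 k : C0 Sp (fk k).
  split; first by apply: continuous_subspaceT.
  move=> e e0; exists (Sp `&` [set w | `|w| <= k.+1%:R]); split.
  - rewrite setIC; apply: compact_closedI; first exact: compact_pair_le.
    exact: closed_state_space.
  - by move=> w [].
  - move=> w [Sw Nw]; rewrite /fk cutoff_far ?mulr0 ?normr0//.
    by rewrite ltNge; apply/negP => wk; apply: Nw.
have mI k : measurable_fun (Omega `*` `[0, +oo[ : set VM)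
    (fun z => \int[mu z]_(w in Sp) (fk k w)%:E)%E.
  have := muC0 _ (fkC0 k) => H.
  apply: (eq_measurable_fun (EFin \o (fun z => \int[mu z]_(w in Sp) fk k w))); last first.
    exact/measurable_EFinP.
  move=> z _; rewrite /= /Rintegral fineK//.
  apply: integrable_fin_num => //; have [C HC] := fk_bdd k.
  apply: (integrable_bdd (M := C) mS) => //.
  - by rewrite (le_lt_trans (probability_le1 _ _))// ltry.
  - exact/measurable_EFinP.
apply: (emeasurable_fun_cvg (fun k z => \int[mu z]_(w in Sp) (fk k w)%:E)%E _ mI) => z _.
have ndk w : Sp w -> nondecreasing_seq (fun k => (fk k w)%:E).
  move=> Sw k k' kk'; rewrite lee_fin ler_wpM2l//; first exact: f0.
  exact: cutoff_le.
have ge0k k w : Sp w -> (0 <= (fk k w)%:E)%E.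
  by move=> Sw; rewrite lee_fin mulr_ge0 ?cutoff_ge0// f0.
have := @cvg_monotone_convergence _ _ _ (mu z) Sp mS (fun k w => (fk k w)%:E) mfk ge0k ndk.
rewrite (_ : (\int[mu z]_(w in Sp) limn _ = \int[mu z]_(w in Sp) (f w)%:E)%E)//.
apply: eq_integral => w _; apply: lim_near_cst => //.
exists (Num.truncn `|w|).+1 => // k /= kw.
by rewrite /fk cutoff_near ?mulr1// (le_trans (ltW (truncnS_gt _)))// ler_nat.
Qed.

Lemma young_measurable_signed (f : W -> R) : continuous f ->
  measurable_fun (Omega `*` `[0, +oo[ : set VM)
    (fun z => \int[mu z]_(w in Sp) (f w)%:E)%E.
Proof.
move=> cf.
have cp : continuous (fun w => Num.max (f w) 0).
  move=> w; have c0 : {for w, continuous (cst (0 : R) : W -> R)} by exact: cvg_cst.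
  exact: (continuous_max (cf w) c0).
have cm : continuous (fun w => Num.max (- f w) 0).
  move=> w; have c0 : {for w, continuous (cst (0 : R) : W -> R)} by exact: cvg_cst.
  have cN : {for w, continuous (fun w => - f w)} by apply: cvgN; exact: cf.
  exact: (continuous_max cN c0).
apply: (eq_measurable_fun (fun z => (\int[mu z]_(w in Sp) (Num.max (f w) 0)%:E -
    \int[mu z]_(w in Sp) (Num.max (- f w) 0)%:E)%E)).
  move=> z _; rewrite [RHS]integralE; congr (_ - _)%E.
    by apply: eq_integral => w _; rewrite funeposE EFin_max.
  by apply: eq_integral => w _; rewrite funenegE EFin_max.
by apply: emeasurable_funB; apply: young_measurable => // w _; rewrite le_max lexx orbT.
Qed.

End Young.

(** * The time weight *)

Section TimeWeight.
Context {R : realType}.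
Local Notation mu := (@lebesgue_measure R).
Variables (k : nat) (t0 T : R).

(** Integrating the entropy inequalities against this weight uses them at almost
    every time at once, instead of at a chosen final time. *)
Definition psi (t : R) : R := pospow k.+2 (t0 - t).
Definition dpsi (t : R) : R := - (k.+2%:R * pospow k.+1 (t0 - t)).

Lemma psi_is_derive (t : R) : is_derive t (1 : R) psi (dpsi t).
Proof.
have d1 : is_derive t (1 : R) (fun t : R => t0 - t) (-1).
  by rewrite -[-1]add0r; apply: is_deriveB.
have [dh hE] := pospow_is_derive k (t0 - t).
have [dg gE] := d1.
have dh' : differentiable (pospow k.+2) (t0 - t) by exact: pospow_differentiable.
have dg' : differentiable (fun t : R => t0 - t) t by exact/derivable1_diffP.
split; first by apply: diff_derivable; exact: (differentiable_comp dg' dh').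
have := derive_comp1 (1 : R) dg' dh'; rewrite gE derive1_pospow.
by rewrite mulrN1.
Qed.

Lemma dpsi_le0 t : dpsi t <= 0.
Proof. by rewrite oppr_le0 mulr_ge0// pospow_ge0. Qed.

Lemma psi_ge0 t : 0 <= psi t. Proof. exact: pospow_ge0. Qed.

Lemma continuous_pospow_sub j : continuous (fun t => pospow j (t0 - t)).
Proof.
move=> t; apply: (@continuous_comp _ _ _ (fun t : R => t0 - t) (pospow j)).
  by apply: cvgB; [exact: cvg_cst|exact: cvg_id].
exact: pospow_continuous.
Qed.

Lemma continuous_dpsi : continuous dpsi.
Proof.
move=> t; apply: cvgN; apply: cvgM; first exact: cvg_cst.
exact: continuous_pospow_sub.
Qed.

Lemma psi_late t : t0 <= t -> psi t = 0.
Proof. by move=> t0t; rewrite /psi /pospow max_l ?expr0n// subr_le0. Qed.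

Lemma psi_early t : t < t0 -> 0 < psi t.
Proof. by move=> tt0; rewrite exprn_gt0// lt_max subr_gt0 tt0 orbT. Qed.

(** The weight beats any linear growth rate once its exponent is large: this
    replaces the Gronwall argument. *)
Lemma dpsi_beats (C t : R) : 0 < t -> t < t0 -> 0 <= C -> C * t0 < k.+2%:R ->
  C * psi t < - dpsi t.
Proof.
move=> t_gt0 tt0 C0 Ck; rewrite /psi /dpsi opprK /pospow max_r; last by rewrite subr_ge0 ltW.
rewrite exprS mulrA ltr_pM2r ?exprn_gt0 ?subr_gt0//.
apply: le_lt_trans Ck; rewrite ler_wpM2l//; lra.
Qed.

Hypothesis t0T : t0 < T.

Lemma integral_dpsi (tau : R) : tau < T ->
  (\int[mu]_(t in `]tau, T[) (- dpsi t)%:E = (psi tau)%:E)%E.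
Proof.
move=> tauT.
have cw : continuous (fun t => - dpsi t) by move=> t; apply: cvgN; exact: continuous_dpsi.
rewrite -(@integral_itv_bndoo _ _ _ _ true false); last first.
  apply/measurable_EFinP; apply: measurable_funTS; exact: continuous_measurable_fun.
apply: (etrans (@continuous_FTC2 R (fun t => - dpsi t) (fun t => - psi t) tau T tauT _ _ _)); last first.
- by rewrite (psi_late (ltW t0T)) oppr0 add0e -EFinN opprK.
- move=> t _; rewrite derive1E deriveN.
    by rewrite (@derive_val _ _ _ _ _ _ _ (psi_is_derive t)).
  exact: (@ex_derive _ _ _ _ _ _ _ (psi_is_derive t)).
- have cps : continuous (fun t => - psi t).
    by move=> t; apply: cvgN; exact: continuous_pospow_sub.
  split => [t _||].
  + by apply: derivableN; exact: (@ex_derive _ _ _ _ _ _ _ (psi_is_derive t)).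
  + by apply: cvg_at_right_filter; exact: cps.
  + by apply: cvg_at_left_filter; exact: cps.
- exact: continuous_subspaceT.
Qed.

(** Exchanging the integrals leaves the integral of - psi' over (tau, T), which is
    psi tau. *)
Lemma tonelli_time (dd : R -> \bar R) :
  measurable_fun (`]0, T[ : set (measurableTypeR R)) dd ->
  (forall t, (0 < t < T)%R -> (0 <= dd t)%E) ->
  measurable_fun (`]0, T[ : set (measurableTypeR R))
    (fun t => (- dpsi t)%:E * \int[mu]_(tau in `]0%R, t[) dd tau)%E /\
  (\int[mu]_(t in `]0%R, T[) ((- dpsi t)%:E * \int[mu]_(tau in `]0%R, t[) dd tau) =
   \int[mu]_(tau in `]0%R, T[) ((psi tau)%:E * dd tau))%E.
Proof.
move=> mdd dd0.
pose I : set (measurableTypeR R) := `]0, T[%classic.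
have mI : measurable I by exact: measurable_itv.
have cw : continuous (fun t => - dpsi t) by move=> t; apply: cvgN; exact: continuous_dpsi.
have mw : measurable_fun setT (fun t : measurableTypeR R => - dpsi t) by exact: continuous_measurable_fun.
have w0 t : 0 <= - dpsi t by rewrite oppr_ge0 dpsi_le0.
pose f (p : measurableTypeR R * measurableTypeR R) :=
  ((- dpsi p.2 * (p.1 < p.2)%R%:R)%:E * dd p.1)%E.
have mf : measurable_fun (I `*` I) f.
  apply: emeasurable_funM.
    apply/measurable_EFinP; apply: measurable_funTS; apply: measurable_funM.
      exact: (measurableT_comp mw (@measurable_snd _ _ _ _)).
    have -> : (fun p : measurableTypeR R * measurableTypeR R => (p.1 < p.2)%R%:R : R) =
       \1_[set p | (p.1 < p.2)%R].
      by apply/funext => p; rewrite indicE; congr (nat_of_bool _)%:R; apply/idP/idP; rewrite inE.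
    apply: measurable_indic.
    have -> : [set p : measurableTypeR R * measurableTypeR R | (p.1 < p.2)%R] =
      (fun p => (p.1 < p.2)%R) @^-1` [set true] by [].
    rewrite -[X in measurable X]setTI.
    have mlt : measurable_fun setT (fun p : measurableTypeR R * measurableTypeR R => ((p.1 : R) < (p.2 : R))%R).
      by apply: (@measurable_fun_ltr _ _ _ setT fst snd).
    exact: mlt.
  apply: (@measurable_comp _ _ _ _ _ _ I) => //; last exact: measurable_funTS.
  by move=> _ [p [Ip _] <-].
have f0 z : (I `*` I) z -> (0 <= f z)%E.
  move=> [/= I1 I2]; apply: mule_ge0; first by rewrite lee_fin mulr_ge0.
  by apply: dd0; move: I1; rewrite /I/= in_itv.
(* f is the integrand on the triangle tau < t, extended by zero to the square. *)
have H1 := tonelli21 mu mu mI mI mf f0.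
have H2 := tonelli12 mu mu mI mI mf f0.
have Eq t : 0 < t < T -> ((- dpsi t)%:E * \int[mu]_(tau in `]0%R, t[) dd tau =
    \int[mu]_(tau in I) f (tau, t))%E.
  move=> /andP[t_gt0 tT].
  have ms : measurable_fun (`]0, t[ : set (measurableTypeR R)) dd.
    apply: (measurable_funS mI _ mdd).
    by apply: subset_itvl; rewrite bnd_simp ltW.
  rewrite -ge0_integralZl_EFin//; last first.
    by move=> s; rewrite /= in_itv/= => /andP[s0 st]; apply: dd0; rewrite s0 (lt_trans st).
  rewrite integral_mkcond [RHS]integral_mkcond; apply: eq_integral => s _.
  rewrite !patchE /f/=.
  case: ifPn; case: ifPn => //; rewrite !(inE, notin_setE) /I/= !in_itv/=.
  - by move=> _ /andP[_ ->]; rewrite mulr1.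
  - by move=> N /andP[s0 st]; exfalso; apply: N; rewrite s0 (lt_trans st).
  - move=> /andP[s0 sT] N; rewrite (_ : (s < t) = false) ?mulr0 ?mul0e//.
    by apply/negP => st; apply: N; rewrite s0.
split.
  apply: eq_measurable_fun (measurable_tonelli21 mu mI mI mf f0) => t.
  by rewrite inE /I/= in_itv/= => It; rewrite Eq.
transitivity (\int[mu]_(t in I) \int[mu]_(tau in I) f (tau, t))%E.
  by apply: eq_integral => t; rewrite inE /I/= in_itv/= => It; exact: Eq.
apply: (etrans H1); apply: (etrans (esym H2)).
apply: eq_integral => s; rewrite inE /I/= in_itv/= => /andP[s0 sT].
have -> : (\int[mu]_(t in I) f (s, t) = \int[mu]_(t in `]s, T[) ((- dpsi t)%:E * dd s))%E.
  rewrite integral_mkcond [RHS]integral_mkcond; apply: eq_integral => t _.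
  rewrite !patchE /f/=.
  case: ifPn; case: ifPn => //; rewrite !(inE, notin_setE) /I/= !in_itv/=.
  - by move=> /andP[-> _] _; rewrite mulr1.
  - move=> N /andP[t_gt0 tT]; rewrite (_ : (s < t) = false) ?mulr0 ?mul0e//.
    by apply/negP => st; apply: N; rewrite st.
  - by move=> /andP[st tT] N; exfalso; apply: N; rewrite (lt_trans s0 st).
rewrite ge0_integralZr//.
- by rewrite integral_dpsi.
- by apply/measurable_EFinP; apply: measurable_funTS; exact: continuous_measurable_fun.
- by move=> t _; rewrite lee_fin.
- by apply: dd0; rewrite s0.
Qed.

End TimeWeight.

(** * Space-time cylinders *)

Section Cylinder.
Context {R : realType} {d : nat}.
Local Notation V := ('rV[R]_d * R)%type.
Local Notation VM := ('rV[R]_d * measurableTypeR R)%type.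
Local Notation m := (@lebVt R d).
Local Notation leb := (@lebV R d).
Local Notation dx j := ((delta_mx 0 j : 'rV[R]_d), (0 : R)).
Local Notation dt := ((0 : 'rV[R]_d), (1 : R)).
Variables (Omega : set 'rV[R]_d) (T : R).
Hypotheses (oOmega : open Omega) (bOmega : bounded_set Omega) (T_gt0 : 0 < T).
Let D : set V := Omega `*` `]0, T[.
Let E : set V := closure Omega `*` `[0, T].

Lemma cylinder_sub : D `<=` E.
Proof.
move=> [x t] [/= Ox]; rewrite /= in_itv/= => /andP[t0 tT].
by split => /=; [exact: subset_closure|rewrite in_itv/= !ltW].
Qed.

Lemma closed_cylinder_compact : compact E.
Proof. by apply: compact_setX; [exact: closure_bounded|exact: segment_compact]. Qed.

Lemma C1_cylinder_cbd (f : V -> R) : C1 D E f -> cbd D f /\ forall e, cbd D ('D_e f).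
Proof.
apply: C1_cbd; [exact: (@open_cylinder R d Omega T oOmega)|exact: cylinder_sub|].
exact: closed_cylinder_compact.
Qed.

Lemma continuous_pairl (x : 'rV[R]_d) : continuous (fun t : R => (x, t)).
Proof.
move=> t; apply: (@cvg_pair _ _ _ (nbhs t) (nbhs x) (nbhs t) _ _ _ (fun _ => x) id).
  exact: cvg_cst.
exact: cvg_id.
Qed.

Lemma continuous_pairr (t : R) : continuous (fun x : 'rV[R]_d => (x, t)).
Proof.
move=> x; apply: (@cvg_pair _ _ _ (nbhs x) (nbhs x) (nbhs t) _ _ _ id (fun _ => t)).
  exact: cvg_id.
exact: cvg_cst.
Qed.

Lemma pairl_diff (x : 'rV[R]_d) (t : R) :
  differentiable (fun r : R => ((x, r) : V)) t /\
  forall e : R, 'D_e (fun r : R => ((x, r) : V)) t = (0, e).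
Proof.
have lL : linear (fun e : R => ((0, e) : V)).
  by move=> c a b; apply/pair_equal_spec; rewrite /= scaler0 addr0.
have [dA DA] := affine_diff ((x, 0) : V) t lL (@continuous_pairl 0).
have AE : (fun y : R => ((0, y) : V) + (x, 0)) = (fun y => (x, y)).
  by apply/funext => y; rewrite -[(0, y) + _]/(0 + x, y + 0) addr0 add0r.
by rewrite AE in dA DA.
Qed.

Lemma time_slice (f : V -> R) x t : differentiable f (x, t) ->
  derive1 (fun r => f (x, r)) t = 'D_dt f (x, t).
Proof.
move=> df.
have [dA DA] := pairl_diff x t.
by rewrite derive1E (derive_comp_diff (f := f) (g := fun y : R => (x, y)) 1 dA df) DA.
Qed.

Lemma C1_space_slice (f : V -> R) t : 0 < t < T -> C1 D E f ->
  C1 Omega (closure Omega) (fun x => f (x, t)).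
Proof.
move=> /andP[t0 tT].
have [lL cL] := @slice_linear R d.
have AE : (fun y : 'rV[R]_d => (y, 0 : R) + (0, t)) = (fun y => (y, t)).
  by apply/funext => y; rewrite -[(y, 0) + _]/(y + 0, 0 + t) addr0 add0r.
apply: (C1_precomp (A := fun y : 'rV[R]_d => (y, t)) (L := fun e => (e, 0))).
- by move=> x; have [] := affine_diff ((0, t) : V) x lL cL; rewrite AE.
- by move=> x e; have [_ /(_ e)] := affine_diff ((0, t) : V) x lL cL; rewrite AE.
- by move=> x Ox; split => //=; rewrite in_itv/= t0.
- by move=> x Ox; split => //=; rewrite in_itv/= !ltW.
Qed.

Lemma slice_integrable (f : V -> R) t : 0 <= t <= T -> {within E, continuous f} ->
  leb.-integrable Omega (EFin \o (fun x => f (x, t))).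
Proof.
move=> tT cf.
have mO := measurable_open_rV oOmega.
have Et x : Omega x -> E (x, t).
  by move=> Ox; split => /=; [exact: subset_closure|rewrite in_itv].
have [C fC] := continuous_bounded_on closed_cylinder_compact cf.
apply: (integrable_bdd (M := C) mO) => //.
- exact: lebV_bounded_lty.
- apply: measurable_within_rV => //.
  apply: (within_continuous_precomp (B := E) (f := f) (g := fun x => (x, t))) => //.
  exact: continuous_pairr.
- by move=> x Ox; apply: fC; exact: Et.
Qed.

(** The derivative in time extends continuously to the closed cylinder, so the
    fundamental theorem applies on each vertical line. *)
Lemma time_ftc (f : V -> R) : C1 D E f -> (forall x, Omega x -> f (x, T) = 0) ->
  \int[m]_(z in D) 'D_dt f z = - \int[leb]_(x in Omega) f (x, 0).
Proof.
move=> Cf fT.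
have mO := measurable_open_rV oOmega.
have mD := measurable_cylinder T oOmega.
have Dlty := cylinder_lty T oOmega bOmega.
have [_ /(_ dt) cD] := C1_cylinder_cbd Cf.
have iD := cbd_integrable mD Dlty cD.
have mI : measurable (`]0, T[ : set (measurableTypeR R)) by exact: measurable_itv.
have [_ F] := @integrable_fubini12 _ _ _ _ _ leb (@lebesgue_measure R) _ _ mO mI _ iD.
have [cf df /(_ dt)[g cg gE]] := Cf.
have Ex x t : Omega x -> `[0, T]%classic t -> E (x, t).
  by move=> Ox It; split => //=; exact: subset_closure.
have inner x : Omega x -> \int[@lebesgue_measure R]_(t in `]0, T[) 'D_dt f (x, t) = - f (x, 0).
  move=> Ox; rewrite /Rintegral.
  have cgx : {within `[0, T], continuous (fun t => g (x, t))}.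
    exact: (within_continuous_precomp (B := E) (f := g) (@continuous_pairl x) (fun t => Ex x t Ox) cg).
  have cfx : {within `[0, T], continuous (fun t => f (x, t))}.
    exact: (within_continuous_precomp (B := E) (f := f) (@continuous_pairl x) (fun t => Ex x t Ox) cf).
  have -> : (\int[@lebesgue_measure R]_(t in `]0%R, T[) ('D_dt f (x, t))%:E =
      \int[@lebesgue_measure R]_(t in `]0%R, T[) (g (x, t))%:E)%E.
    by apply: eq_integral => t; rewrite inE/= => It; rewrite gE.
  rewrite -(@integral_itv_bndoo _ _ _ _ true false); last first.
    apply/measurable_EFinP; apply: (@measurable_funS _ _ _ _ `[0, T]%classic) => //.
      by apply: subset_itv; rewrite bnd_simp.
    exact: subspace_continuous_measurable_fun.
  rewrite (_ : integral _ _ _ = (f (x, T))%:E - (f (x, 0))%:E)%E.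
    by rewrite fT// sub0e.
  apply: (@continuous_FTC2 R (fun t => g (x, t)) (fun t => f (x, t)) 0 T T_gt0 cgx).
    have /(continuous_within_itvP _ T_gt0)[_ c0 cT] := cfx.
    split => // t It.
    have df' : differentiable f (x, t) by apply: df.
    have [cA _] := pairl_diff x t.
    apply: diff_derivable; exact: (differentiable_comp cA df').
  move=> t It; rewrite time_slice ?gE//; exact: df.
apply: (etrans (esym F)).
have -> : \int[leb]_(x in Omega) \int[@lebesgue_measure R]_(t in `]0, T[) 'D_dt f (x, t) =
   \int[leb]_(x in Omega) (- f (x, 0)).
  by apply: eq_Rintegral => x; rewrite inE => Ox; exact: inner.
apply: (RintegralN mO).
by apply: slice_integrable => //; rewrite lexx ltW.
Qed.

(** Outside the compact support the function and its derivatives vanish on an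
    open set. *)
Lemma C1c_cbd (f : V -> R) : C1c D D f -> cbd D f /\ forall e, cbd D ('D_e f).
Proof.
move=> [[cf df dg] [K [cK KD fK]]].
have oD : open D := @open_cylinder R d Omega T oOmega.
have clK : closed K by apply: compact_closed.
have bdd (h : V -> R) : {within D, continuous h} -> (forall z, D z -> ~ K z -> h z = 0) ->
    exists M, forall z, D z -> `|h z| <= M.
  move=> ch hK; have [C hC] := continuous_bounded_on cK (within_continuousS KD ch).
  exists (Num.max C 0) => z Dz; have [Kz|nKz] := pselect (K z).
    by rewrite le_max hC.
  by rewrite hK// normr0 le_max lexx orbT.
split.
  by split; [exact: within_open_continuous|apply: bdd => // z Dz nKz; exact: fK].
move=> e; have [g cg gE] := dg e; split => [z Dz|].
  have cgz := within_open_continuous oD cg Dz.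
  rewrite /prop_for /continuous_at gE//.
  apply: cvg_trans cgz; apply: near_eq_cvg.
  have nz : nbhs z D by apply: open_nbhs_nbhs; split.
  by apply: filterS nz => y Dy; rewrite gE.
have [M gM] : exists M, forall z, D z -> `|g z| <= M.
  apply: bdd => // z Dz nKz; rewrite -gE//.
  rewrite (@near_eq_derive _ _ _ _ (cst 0)) ?derive_cst//.
  have nz : nbhs z (D `&` ~` K).
    by apply: open_nbhs_nbhs; split => //; apply: openI => //; exact: closed_openC.
  by apply: filterS nz => y; exact: fK.
by exists M => z Dz; rewrite gE//; exact: gM.
Qed.

End Cylinder.

(** * Fields attached to the strong solution *)

Section StrongSolution.
Context {R : realType} {d n : nat}.
Local Notation V := ('rV[R]_d * R)%type.
Local Notation VM := ('rV[R]_d * measurableTypeR R)%type.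
Local Notation m := (@lebVt R d).
Local Notation leb := (@lebV R d).
Local Notation dx j := ((delta_mx 0 j : 'rV[R]_d), (0 : R)).
Local Notation dt := ((0 : 'rV[R]_d), (1 : R)).
Variables (Omega : set 'rV[R]_d) (T : R) (B : 'M[R]_n) (v : V -> 'cV[R]_n).
Hypotheses (lOmega : lipschitz_domain Omega) (T_gt0 : 0 < T)
  (Bsym : B^T = B) (v_sol : positive_weak_solution Omega B T v).
Let D : set V := Omega `*` `]0, T[.
Let E : set V := closure Omega `*` `[0, T].

Let oOmega : open Omega. Proof. by case: lOmega. Qed.
Let bOmega : bounded_set Omega. Proof. by case: lOmega. Qed.
Let mO : measurable Omega. Proof. exact: measurable_open_rV. Qed.

Definition space_grad (z : V) : 'M[R]_(n, d) :=
  \matrix_(i, j) 'D_(dx j) (fun y => v y i 0) z.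
Definition log_grad (z : V) : 'M[R]_(n, d) :=
  \matrix_(i, j) (space_grad z i j / v z i 0).
Definition time_deriv (i : 'I_n) (z : V) : R := 'D_dt (fun y => v y i 0) z.
(** The variational derivative of the sum of the two entropies. *)
Definition potential (i : 'I_n) (z : V) : R := ln (v z i 0) + \sum_k B i k * v z k 0.
(** The Legendre transform v . theta - (h_S(v) + 1/2 v . B v) of the total entropy,
    theta being the potential; its time derivative is v . d_t theta. *)
Definition energy (z : V) : R :=
  \sum_i (v z i 0 - 1) + 2^-1 * \sum_i v z i 0 * \sum_k B i k * v z k 0.
Definition pressure_grad (z : V) : 'M[R]_(n, d) := B *m space_grad z.
(** Its columns lie in the range of B. Formally its divergence is the source
    below, but v is only C^1 and the relation is meant weakly. *)
Definition flux (z : V) : 'M[R]_(n, d) :=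
  B *m \matrix_(i, j) (space_grad z i j + v z i 0 * pressure_grad z i j).
(** The time derivative of the potential, minus the term that is not a divergence. *)
Definition source (i : 'I_n) (z : V) : R :=
  time_deriv i z / v z i 0 - \sum_j pressure_grad z i j * log_grad z i j +
  \sum_k B i k * time_deriv k z.

Let C1v i : C1 D E (fun z => v z i 0). Proof. by case: v_sol. Qed.
Let v_gt0 z i : E z -> 0 < v z i 0. Proof. by case: v_sol => _ h _ Ez; exact: h. Qed.
Let DE z : D z -> E z. Proof. exact: cylinder_sub. Qed.
Let dv i z : D z -> differentiable (fun z => v z i 0) z.
Proof. by have [_ h _] := C1v i; exact: h. Qed.
Let CC (f : V -> R) : C1 D E f -> cbd D f /\ forall e, cbd D ('D_e f).
Proof. exact: (C1_cylinder_cbd oOmega bOmega). Qed.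

Lemma cbd_ext (f g : V -> R) : (forall z, f z = g z) -> cbd D g -> cbd D f.
Proof. by move=> /funext ->. Qed.

Lemma cbd_v i : cbd D (fun z => v z i 0). Proof. by have [] := CC (C1v i). Qed.

Lemma cbd_space_grad i j : cbd D (fun z => space_grad z i j).
Proof.
have [_ h] := CC (C1v i).
by apply: cbd_ext (h (dx j)) => z; rewrite mxE.
Qed.

Lemma cbd_time_deriv i : cbd D (time_deriv i).
Proof. by have [_ h] := CC (C1v i); exact: h. Qed.

Let C1vV i : C1 D E (fun z => (v z i 0)^-1).
Proof. by apply: C1_inv => // z Ez; exact: v_gt0. Qed.

Lemma cbd_log_grad i j : cbd D (fun z => log_grad z i j).
Proof.
have [h _] := CC (C1vV i).
by apply: cbd_ext (cbdM (cbd_space_grad i j) h) => z; rewrite mxE.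
Qed.

Lemma cbd_pressure_grad i j : cbd D (fun z => pressure_grad z i j).
Proof.
apply: (@cbd_ext _ (fun z => \sum_k B i k * space_grad z k j)).
  by move=> z; rewrite mxE.
by apply: cbd_sum => k; apply: cbdM; [exact: cbd_cst|exact: cbd_space_grad].
Qed.

Lemma fluxE z i j : flux z i j =
  pressure_grad z i j + \sum_k B i k * (v z k 0 * pressure_grad z k j).
Proof.
rewrite [LHS]mxE [pressure_grad z i j]mxE -big_split; apply: eq_bigr => k _ /=.
by rewrite mxE mulrDr.
Qed.

Lemma cbd_flux i j : cbd D (fun z => flux z i j).
Proof.
apply: (cbd_ext (fun z => fluxE z i j)); apply: cbdD; first exact: cbd_pressure_grad.
apply: cbd_sum => k; apply: cbdM; first exact: cbd_cst.
by apply: cbdM; [exact: cbd_v|exact: cbd_pressure_grad].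
Qed.

Lemma cbd_source i : cbd D (source i).
Proof.
have [h _] := CC (C1vV i).
apply: cbdD; last first.
  by apply: cbd_sum => k; apply: cbdM; [exact: cbd_cst|exact: cbd_time_deriv].
apply: cbdD; first by apply: cbdM => //; exact: cbd_time_deriv.
apply: cbdN; apply: cbd_sum => j; apply: cbdM; first exact: cbd_pressure_grad.
exact: cbd_log_grad.
Qed.

Lemma C1_Bv i : C1 D E (fun z => \sum_k B i k * v z k 0).
Proof.
by apply: C1_sum => k; apply: C1_mul => //; exact: C1_cst.
Qed.

Lemma derive_Bv i e z : D z ->
  'D_e (fun z => \sum_k B i k * v z k 0) z = \sum_k B i k * 'D_e (fun z => v z k 0) z.
Proof.
move=> Dz; have [|_ ->] := @derive_sum_seq R V _ (index_enum 'I_n) (fun k z => B i k * v z k 0) z e.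
  by move=> k; apply: differentiableM => //; exact: dv.
apply: eq_bigr => k _; rewrite derive_mul//; last exact: dv.
by rewrite derive_cst mulr0 addr0.
Qed.

Lemma C1_potential i : C1 D E (potential i).
Proof.
apply: C1_add; last exact: C1_Bv.
by apply: C1_ln => // z Ez; exact: v_gt0.
Qed.

Lemma derive_ln_v i e z : D z ->
  'D_e (fun z => ln (v z i 0)) z = 'D_e (fun z => v z i 0) z / v z i 0.
Proof.
move=> Dz; have v0 := v_gt0 i (DE Dz).
have [dl dlE] := is_derive1_ln v0.
rewrite (derive_comp1 (h := @ln R) (f := fun z => v z i 0) e (dv i Dz)).
  by rewrite derive1E dlE mulrC.
by apply/derivable1_diffP.
Qed.

Lemma derive_potential i e z : D z -> 'D_e (potential i) z =
  'D_e (fun z => v z i 0) z / v z i 0 + \sum_k B i k * 'D_e (fun z => v z k 0) z.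
Proof.
move=> Dz.
have [_ d1 _] : C1 D E (fun z => ln (v z i 0)).
  by apply: C1_ln => // y Ey; exact: v_gt0.
have [_ d2 _] := C1_Bv i.
rewrite -derive_ln_v// -derive_Bv//; apply: deriveD.
  exact: differentiable_derive (d1 z Dz).
exact: differentiable_derive (d2 z Dz).
Qed.

Lemma derive_potential_x i j z : D z ->
  'D_(dx j) (potential i) z = log_grad z i j + pressure_grad z i j.
Proof.
move=> Dz; rewrite derive_potential// !mxE; congr (_ + _).
by apply: eq_bigr => k _; rewrite mxE.
Qed.

Lemma derive_potential_t i z : D z ->
  'D_dt (potential i) z = source i z + \sum_j pressure_grad z i j * log_grad z i j.
Proof. by move=> Dz; rewrite derive_potential// /source /time_deriv; ring. Qed.

Lemma C1_energy : C1 D E energy.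
Proof.
have DE' : D `<=` E by exact: cylinder_sub.
apply: C1_add.
  by apply: C1_sum => i; apply: C1_add => //; exact: C1_cst.
apply: C1_mul => //; first exact: C1_cst.
by apply: C1_sum => i; apply: C1_mul => //; exact: C1_Bv.
Qed.

Lemma derive_energy z : D z ->
  'D_dt energy z = \sum_i v z i 0 * 'D_dt (potential i) z.
Proof.
move=> Dz; have DE' : D `<=` E by exact: cylinder_sub.
have [d1 E1] := @derive_sum_seq R V _ (index_enum 'I_n) (fun i z => v z i 0 - 1) z dt
  (fun i => differentiableB (dv i Dz) (differentiable_cst _ _)).
have dB i : differentiable (fun z => \sum_k B i k * v z k 0) z.
  by have [_ h _] := C1_Bv i; exact: h.
have [d2 E2] := @derive_sum_seq R V _ (index_enum 'I_n)
  (fun i z => v z i 0 * \sum_k B i k * v z k 0) z dt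
  (fun i => differentiableM (dv i Dz) (dB i)).
have -> : 'D_dt energy z = 'D_dt (fun z => \sum_i (v z i 0 - 1)) z +
    'D_dt (fun z => 2^-1 * \sum_i v z i 0 * \sum_k B i k * v z k 0) z.
  apply: deriveD; first exact: differentiable_derive.
  by apply: differentiable_derive; apply: differentiableM.
rewrite E1 derive_mul// E2 derive_cst mulr0 addr0.
have -> : \sum_i 'D_dt (fun z => v z i 0 - 1) z = \sum_i time_deriv i z.
  apply: eq_bigr => i _; rewrite deriveB ?derive_cst ?subr0//.
  exact: differentiable_derive (dv i Dz).
have -> : \sum_i 'D_dt (fun z => v z i 0 * \sum_k B i k * v z k 0) z =
    \sum_i (v z i 0 * \sum_k B i k * time_deriv k z) +
    \sum_i ((\sum_k B i k * v z k 0) * time_deriv i z).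
  rewrite -big_split; apply: eq_bigr => i _ /=.
  by rewrite derive_mul ?derive_Bv//; exact: dv.
have -> : \sum_i ((\sum_k B i k * v z k 0) * time_deriv i z) =
    \sum_i (v z i 0 * \sum_k B i k * time_deriv k z).
  under eq_bigr do rewrite mulr_suml.
  rewrite exchange_big; apply: eq_bigr => i _ /=; rewrite mulr_sumr.
  by apply: eq_bigr => k _; rewrite -{1}Bsym mxE; ring.
have -> : \sum_i v z i 0 * 'D_dt (potential i) z =
   \sum_i time_deriv i z + \sum_i (v z i 0 * \sum_k B i k * time_deriv k z).
  rewrite -big_split; apply: eq_bigr => i _ /=.
  rewrite derive_potential// mulrDr mulrCA divff ?mulr1//.
  by rewrite gt_eqF// v_gt0//; exact: DE.
lra.
Qed.

Lemma jac_slice (A : 'M[R]_n) z : D z ->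
  jac (fun y => A *m v (y, z.2)) z.1 = A *m space_grad z.
Proof.
case: z => x t Dz; apply/matrixP => i j; rewrite !mxE.
have E0 : (fun y => (A *m v (y, t)) i 0) = (fun y => \sum_k A i k * v (y, t) k 0).
  by apply/funext => y; rewrite mxE.
rewrite /= E0.
have dslice k : differentiable (fun y => v (y, t) k 0) x.
  have [_ _ _] := C1v k; have It : 0 < t < T by case: Dz => _; rewrite /= in_itv.
  have [_ h _] := C1_space_slice It (C1v k).
  by apply: h; case: Dz.
have [|_ ->] := @derive_sum_seq R 'rV[R]_d _ (index_enum 'I_n) (fun k y => A i k * v (y, t) k 0) x (delta_mx 0 j).
  by move=> k; apply: differentiableM.
apply: eq_bigr => k _; rewrite derive_mul// derive_cst mulr0 addr0 mxE.
by rewrite (@slice_diff R d (fun z => v z k 0))//; exact: dv.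
Qed.

Lemma v_bounds : exists M, forall z i, D z -> 0 < v z i 0 <= M.
Proof.
have h i : exists M, forall z, D z -> `|v z i 0| <= M by have [_] := cbd_v i.
have [M hM] := choice h.
exists (\big[Num.max/0]_i M i) => z i Dz; rewrite (v_gt0 i (DE Dz))/=.
apply: le_trans (ler_norm _) _; apply: le_trans (hM i z Dz) _.
exact: (le_bigmax_cond 0 M (P := xpredT)).
Qed.

Lemma drift_bound : exists N, forall z i j, D z ->
  `|log_grad z i j - pressure_grad z i j| <= N.
Proof.
have h (ij : 'I_n * 'I_d) : exists N, forall z, D z ->
    `|log_grad z ij.1 ij.2 - pressure_grad z ij.1 ij.2| <= N.
  by have [_] := cbdD (cbd_log_grad ij.1 ij.2) (cbdN (cbd_pressure_grad ij.1 ij.2)).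
have [N hN] := choice h.
exists (\big[Num.max/0]_ij N ij) => z i j Dz.
apply: le_trans (hN (i, j) z Dz) _.
exact: (le_bigmax_cond 0 N (P := xpredT)).
Qed.

(** Testing the i-th equation with phi / v_i replaces v_i grad (Bv)_i by
    grad (Bv)_i and produces the term grad (Bv)_i . grad log v_i; adding the
    equations tested with phi, weighted by the i-th row of B, gives the rest of the
    flux. *)
Lemma weak_div_source i : weak_div Omega T (source i) (fun j z => flux z i j).
Proof.
move=> t It phi Cphi.
have [_ _ veq] := v_sol.
have [cp cdp] := C1_cbd_Omega lOmega Cphi.
have sl (f : V -> R) : cbd D f -> cbd Omega (fun x => f (x, t)).
  by move=> cf; exact: (cbd_slice It cf).
have int (f : 'rV[R]_d -> R) : cbd Omega f -> leb.-integrable Omega (EFin \o f).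
  exact: (cbd_integrable_slice lOmega).
have Dxt x : Omega x -> D (x, t) by move=> Ox; split => //=; rewrite in_itv.
have Et x : closure Omega x -> E (x, t).
  by move=> Ox; split => //=; rewrite in_itv/= !ltW//; case/andP: It.
pose q (k : 'I_n) (f : 'rV[R]_d -> R) x :=
  \sum_j pressure_grad (x, t) k j * 'D_(delta_mx 0 j) f x.
have vq f (k : 'I_n) : C1 Omega (closure Omega) f ->
    \int[leb]_(x in Omega) (time_deriv k (x, t) * f x) =
    - \int[leb]_(x in Omega) (v (x, t) k 0 * q k f x).
  move=> Cf; apply: (etrans _ (etrans (veq t It f Cf k) _)).
    apply: eq_Rintegral => x; rewrite inE => Ox.
    by rewrite (time_slice (f := fun z => v z k 0) (dv k (Dxt _ Ox))).
  apply: (congr1 -%R); apply: eq_Rintegral => x; rewrite inE => Ox; congr (_ * _).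
  rewrite (jac_slice B (Dxt _ Ox)) /mxdot big_ord1; apply: eq_bigr => j _.
  by rewrite [row _ _ _ _]mxE [grad _ _ _ _]mxE.
have cq k : cbd Omega (q k phi).
  apply: cbd_sum => j; apply: cbdM; last exact: cdp.
  exact: (sl (fun z => pressure_grad z k j) (cbd_pressure_grad k j)).
have cvk k : cbd Omega (fun x => v (x, t) k 0) by exact: (sl _ (cbd_v k)).
have cdt k : cbd Omega (fun x => time_deriv k (x, t)) by exact: (sl _ (cbd_time_deriv k)).
have [civ _] := CC (C1vV i).
have civt : cbd Omega (fun x => (v (x, t) i 0)^-1) by exact: (sl _ civ).
pose ql x := phi x * \sum_j pressure_grad (x, t) i j * log_grad (x, t) i j.
have cql : cbd Omega ql.
  apply: cbdM => //; apply: cbd_sum => j; apply: cbdM.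
    exact: (sl (fun z => pressure_grad z i j) (cbd_pressure_grad i j)).
  exact: (sl (fun z => log_grad z i j) (cbd_log_grad i j)).
have Cslice : C1 Omega (closure Omega) (fun x => v (x, t) i 0) by exact: (C1_space_slice It (C1v i)).
have Cinv : C1 Omega (closure Omega) (fun x => (v (x, t) i 0)^-1).
  apply: C1_inv => // [|x Ox]; first exact: subset_closure.
  exact: v_gt0 (Et _ Ox).
have Cpv : C1 Omega (closure Omega) (fun x => phi x * (v (x, t) i 0)^-1).
  by apply: C1_mul => //; exact: subset_closure.
have E1 : \int[leb]_(x in Omega) (time_deriv i (x, t) * (phi x * (v (x, t) i 0)^-1)) =
    - (\int[leb]_(x in Omega) q i phi x - \int[leb]_(x in Omega) ql x).
  apply: (etrans (vq _ i Cpv)); apply: (congr1 -%R).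
  apply: (etrans _ (RintegralB mO (int _ (cq i)) (int _ cql))).
  apply: eq_Rintegral => x; rewrite inE => Ox.
  have v0 := v_gt0 i (DE (Dxt _ Ox)).
  rewrite /q /ql !mulr_sumr -sumrB; apply: eq_bigr => j _.
  have [_ dp _] := Cphi; have [_ dvi _] := Cinv; have [_ dvx _] := Cslice.
  rewrite derive_mul; [|exact: dp|exact: dvi].
  have dslice : 'D_(delta_mx 0 j) (fun x => (v (x, t) i 0)^-1) x =
      - (v (x, t) i 0) ^- 2 * space_grad (x, t) i j.
    rewrite deriveV ?gt_eqF//; last exact: differentiable_derive (dvx x Ox).
    rewrite mxE (slice_diff (f := fun z => v z i 0))//; exact: dv (Dxt _ Ox).
  rewrite dslice [log_grad _ _ _]mxE; field; exact: lt0r_neq0.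
have E3 k := vq phi k Cphi.
have iA : leb.-integrable Omega (EFin \o (fun x => time_deriv i (x, t) * (phi x * (v (x, t) i 0)^-1))).
  by apply: int; apply: cbdM => //; exact: cbdM.
have iB k : leb.-integrable Omega (EFin \o (fun x => B i k * (time_deriv k (x, t) * phi x))).
  by apply: int; apply: cbdM; [exact: cbd_cst|exact: cbdM].
have iC k : leb.-integrable Omega (EFin \o (fun x => B i k * (v (x, t) k 0 * q k phi x))).
  by apply: int; apply: cbdM; [exact: cbd_cst|exact: cbdM].
have iS := integrable_sumR mO (index_enum 'I_n) iB.
have iSC := integrable_sumR mO (index_enum 'I_n) iC.
have L : \int[leb]_(x in Omega) (source i (x, t) * phi x) =
   \int[leb]_(x in Omega) (time_deriv i (x, t) * (phi x * (v (x, t) i 0)^-1))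
   - \int[leb]_(x in Omega) ql x
   + \sum_k B i k * \int[leb]_(x in Omega) (time_deriv k (x, t) * phi x).
  transitivity (\int[leb]_(x in Omega)
     ((time_deriv i (x, t) * (phi x * (v (x, t) i 0)^-1) - ql x) +
      \sum_k B i k * (time_deriv k (x, t) * phi x))).
    apply: eq_Rintegral => x _; rewrite /source /ql mulrDl mulrBl mulr_suml.
    by congr (_ - _ + _); [ring|rewrite mulrC|apply: eq_bigr => k _; ring].
  apply: (etrans (RintegralD mO (integrable_subR mO iA (int _ cql)) iS)); congr (_ + _).
    exact: (RintegralB mO iA (int _ cql)).
  apply: (etrans (Rintegral_sum mO _ iB)); apply: eq_bigr => k _.
  by apply: (RintegralZl _ mO); apply: int; exact: cbdM.
have M : \int[leb]_(x in Omega) (\sum_j flux (x, t) i j * 'D_(delta_mx 0 j) phi x) =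
   \int[leb]_(x in Omega) q i phi x +
   \sum_k B i k * \int[leb]_(x in Omega) (v (x, t) k 0 * q k phi x).
  transitivity (\int[leb]_(x in Omega) (q i phi x + \sum_k B i k * (v (x, t) k 0 * q k phi x))).
    apply: eq_Rintegral => x _.
    have -> : \sum_k B i k * (v (x, t) k 0 * q k phi x) =
        \sum_j (\sum_k B i k * (v (x, t) k 0 * pressure_grad (x, t) k j)) * 'D_(delta_mx 0 j) phi x.
      under [RHS]eq_bigr do rewrite mulr_suml.
      rewrite exchange_big; apply: eq_bigr => k _ /=; rewrite /q !mulr_sumr.
      by apply: eq_bigr => j _; ring.
    by rewrite -big_split; apply: eq_bigr => j _ /=; rewrite fluxE mulrDl.
  apply: (etrans (RintegralD mO (int _ (cq i)) iSC)); congr (_ + _).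
  apply: (etrans (Rintegral_sum mO _ iC)); apply: eq_bigr => k _.
  by apply: (RintegralZl _ mO); apply: int; exact: cbdM.
apply: (etrans L); apply: (etrans _ (congr1 -%R (esym M))).
have -> : \sum_k B i k * \int[leb]_(x in Omega) (time_deriv k (x, t) * phi x) =
    - \sum_k B i k * \int[leb]_(x in Omega) (v (x, t) k 0 * q k phi x).
  by rewrite -sumrN; apply: eq_bigr => k _; rewrite E3 mulrN.
have arith (a b c e : R) : a = - (b - c) -> a - c + (- e) = - (b + e) by move=> ->; ring.
exact: arith E1.
Qed.

End StrongSolution.

(** * Growth of the integrands on the state space *)

Section EntropyDensity.
Context {R : realType}.

Lemma relent1 (s : R) : relent s 1 = s * (ln s - 1) + 1.
Proof. by rewrite /relent ln1 mulr0 subr0 subrr addr0. Qed.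

(** At zero the logarithm is compensated: log s = 2 log r with r the square root
    of s, and log r >= 1 - 1/r. *)
Lemma xlnx_small (s : R) : 0 <= s -> s <= 1 -> `|s * ln s| <= 2 * Num.sqrt s.
Proof.
rewrite le_eqVlt => /orP[/eqP<- _|s0 s1]; first by rewrite mul0r normr0 mulr_ge0.
have r0 : 0 < Num.sqrt s by rewrite sqrtr_gt0.
have ss : s = Num.sqrt s * Num.sqrt s by rewrite -expr2 sqr_sqrtr// ltW.
have l0 : ln s <= 0 by rewrite ln_le0.
rewrite ler0_norm ?mulr_ge0_le0 ?(ltW s0)//.
have -> : ln s = 2 * ln (Num.sqrt s) by rewrite {1}ss lnM ?posrE//; ring.
have := ln_ge1V r0; move: (Num.sqrt s) r0 ss => r r0 -> h.
have : r * r * (1 - r^-1) <= r * r * ln r by rewrite ler_wpM2l// mulr_ge0// ltW.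
have -> : r * r * (1 - r^-1) = r * r - r by field; rewrite gt_eqF.
have rr : 0 <= r * r by rewrite mulr_ge0// ltW.
nra.
Qed.

Lemma continuous_xlnx : continuous (fun s : R => s * ln s).
Proof.
move=> s; have [s0|s0|->] := ltgtP s 0.
- rewrite /continuous_at (ln0 (ltW s0)) mulr0.
  apply: cvg_near_cst; near=> r; rewrite ln0 ?mulr0//.
  by apply: ltW; near: r; exact: lt_nbhsl.
- by apply: cvgM; [exact: cvg_id|exact: continuous_ln].
- rewrite /continuous_at mul0r; apply/cvgrPdist_lt => e e0.
  have d0 : 0 < Num.min 1 ((e / 2) ^+ 2) by rewrite lt_min ltr01 exprn_gt0// divr_gt0.
  near=> r; rewrite sub0r normrN.
  have rd : `|r| < Num.min 1 ((e / 2) ^+ 2).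
    near: r; apply/nbhs_ballP; exists (Num.min 1 ((e / 2) ^+ 2)) => // y.
    by rewrite /ball/= sub0r normrN.
  have [r0|r0] := leP r 0; first by rewrite ln0// mulr0 normr0.
  move: rd; rewrite lt_min (gtr0_norm r0) => /andP[r1 re].
  apply: le_lt_trans (xlnx_small (ltW r0) (ltW r1)) _.
  have : Num.sqrt r < e / 2.
    have e20 : 0 <= e / 2 by rewrite divr_ge0// ltW.
    by rewrite -[ltRHS](ger0_norm e20) -sqrtr_sqr ltr_sqrt// exprn_gt0// divr_gt0.
  lra.
Unshelve. all: by end_near. Qed.

Lemma le_relent1 (s : R) : 0 <= s -> s <= 2 * relent s 1 + 2.
Proof.
move=> s0; have := relent_sqrt s0 ltr01; rewrite sqrtr1.
have := sqr_sqrtr s0; move: (Num.sqrt s) (relent s 1) => r h <- hr; have := sqr_ge0 (r - 2); nra.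
Qed.

End EntropyDensity.

Section Moments.
Context {R : realType} {d n : nat}.
Local Notation V := ('rV[R]_d * R)%type.
Local Notation VM := ('rV[R]_d * measurableTypeR R)%type.
Local Notation W := ('cV[R]_n * 'M[R]_(n, d))%type.
Local Notation m := (@lebVt R d).
Variables (B : 'M[R]_n).
Hypothesis (Bpsd : psd B).
Let Sp : set W := state_space B.

Definition dissipation (w : W) : R := mxdot w.2 (B *m w.2).
Definition mobility (i : 'I_n) (w : W) : R :=
  w.1 i 0 * mxdot (row i (B *m w.2)) (row i (B *m w.2)).
(** The moment of this function is controlled by the two entropy inequalities, and
    it dominates every integrand of the proof. *)
Definition weight (w : W) : R := 1 + hS w.1 + dissipation w + \sum_i mobility i w.

Lemma continuous_hS : continuous (fun w : W => hS w.1).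
Proof.
apply: continuous_sumR => i.
have c : continuous (fun w : W => w.1 i 0 * (ln (w.1 i 0) - 1)).
  have -> : (fun w : W => w.1 i 0 * (ln (w.1 i 0) - 1)) =
      (fun w : W => w.1 i 0 * ln (w.1 i 0) - w.1 i 0).
    by apply/funext => y; rewrite mulrBr mulr1.
  move=> w; apply: cvgD; last by apply: cvgN; exact: continuous_coord1.
  exact: (continuous_comp (@continuous_coord1 R d n i w) (@continuous_xlnx R (w.1 i 0))).
by move=> w; apply: cvgD; [exact: c|exact: cvg_cst].
Qed.

Lemma continuous_q i j : continuous (fun w : W => (B *m w.2) i j).
Proof.
have -> : (fun w : W => (B *m w.2) i j) = (fun w => \sum_k B i k * w.2 k j).
  by apply/funext => w; rewrite mxE.
apply: continuous_sumR => k w; apply: cvgM; first exact: cvg_cst.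
exact: continuous_coord2.
Qed.

Lemma continuous_dissipation : continuous dissipation.
Proof.
apply: continuous_sumR => i; apply: continuous_sumR => j w.
by apply: cvgM; [exact: continuous_coord2|exact: continuous_q].
Qed.

Lemma continuous_mobility i : continuous (mobility i).
Proof.
have c : continuous (fun w : W => mxdot (row i (B *m w.2)) (row i (B *m w.2))).
  apply: continuous_sumR => k; apply: continuous_sumR => j.
  have -> : (fun w : W => row i (B *m w.2) k j * row i (B *m w.2) k j) =
     (fun w => (B *m w.2) i j * (B *m w.2) i j).
    by apply/funext => y; rewrite !mxE.
  by move=> y; apply: cvgM; exact: continuous_q.
by move=> w; apply: cvgM; [exact: continuous_coord1|exact: c].
Qed.

Lemma continuous_weight : continuous weight.
Proof.
move=> w; apply: cvgD; last by apply: continuous_sumR => i; exact: continuous_mobility.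
apply: cvgD; last exact: continuous_dissipation.
by apply: cvgD; [exact: cvg_cst|exact: continuous_hS].
Qed.

Lemma hS_term_ge0 (s : 'cV[R]_n) i : 0 <= s i 0 -> 0 <= s i 0 * (ln (s i 0) - 1) + 1.
Proof. by move=> s0; rewrite -relent1 relent_ge0. Qed.

Lemma hS_ge0 w : Sp w -> 0 <= hS w.1.
Proof. by move=> [s0 _]; apply: sumr_ge0 => i _; apply: hS_term_ge0. Qed.

Lemma dissipation_ge0 w : 0 <= dissipation w.
Proof. exact: psd_mxdot_ge0. Qed.

Lemma mobility_ge0 i w : Sp w -> 0 <= mobility i w.
Proof. by move=> [s0 _]; rewrite mulr_ge0// mxdot_ge0. Qed.

Lemma mobility_sum_ge0 w : Sp w -> 0 <= \sum_i mobility i w.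
Proof. by move=> Sw; apply: sumr_ge0 => i _; exact: mobility_ge0. Qed.

Lemma weight_ge1 w : Sp w -> 1 <= weight w.
Proof.
move=> Sw; have := hS_ge0 Sw; have := dissipation_ge0 w; have := mobility_sum_ge0 Sw.
rewrite /weight; lra.
Qed.

Lemma hS_weight w : Sp w -> `|hS w.1| <= weight w.
Proof.
move=> Sw; have := hS_ge0 Sw; have := dissipation_ge0 w; have := mobility_sum_ge0 Sw.
move=> h1 h2 h3; rewrite ger0_norm// /weight; lra.
Qed.

Lemma dissipation_weight w : Sp w -> `|dissipation w| <= weight w.
Proof.
move=> Sw; have := hS_ge0 Sw; have := dissipation_ge0 w; have := mobility_sum_ge0 Sw.
move=> h1 h2 h3; rewrite ger0_norm// /weight; lra.
Qed.

Lemma mobility_weight i w : Sp w -> `|mobility i w| <= weight w.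
Proof.
move=> Sw; have := hS_ge0 Sw; have := dissipation_ge0 w.
have : mobility i w <= \sum_i mobility i w.
  by rewrite (bigD1 i)//= lerDl; apply: sumr_ge0 => k _; exact: mobility_ge0.
have := mobility_ge0 i Sw => h0 h1 h2 h3; rewrite ger0_norm// /weight; lra.
Qed.

Lemma density_weight i w : Sp w -> `|w.1 i 0| <= 2 * weight w.
Proof.
move=> Sw; have [s0 _] := Sw; rewrite ger0_norm//.
have := dissipation_ge0 w; have := mobility_sum_ge0 Sw.
have : relent (w.1 i 0) 1 <= hS w.1.
  rewrite relent1 /hS (bigD1 i)//= lerDl.
  by apply: sumr_ge0 => k _; exact: hS_term_ge0.
have := le_relent1 (s0 i) => h0 h1 h2 h3; rewrite /weight; lra.
Qed.

Lemma mx_entry_sqr k i j (M : 'M[R]_(k, d)) : M i j ^+ 2 <= mxdot (row i M) (row i M).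
Proof.
rewrite /mxdot big_ord1 (bigD1 j)//= !mxE -expr2 lerDl.
by apply: sumr_ge0 => l _; rewrite mxE -expr2 sqr_ge0.
Qed.

Lemma abs_le_sqr (x : R) : `|x| <= 1 + x ^+ 2.
Proof. by rewrite -(real_normK (num_real x)); have := normr_ge0 x; move: `|x| => y; nra. Qed.

(** Controlling B p is enough, since p is recovered linearly from B p on the
    range of B. *)
Lemma gradient_weight i j : exists2 C, 0 < C &
  forall w, Sp w -> `|w.2 i j| <= C * weight w.
Proof.
have [A HA] := @Lperp_recover R n B.
have Bkk k : 0 <= B k k.
  have := psd_mxdot_ge0 (delta_mx k (0 : 'I_1)) Bpsd.
  rewrite /mxdot (bigD1 k)//= big_ord1 big1 ?addr0 => [|l lk].
    rewrite !mxE (bigD1 k)//= big1 ?addr0 => [|l lk]; rewrite !mxE ?eqxx ?mul1r ?mulr1//.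
    by rewrite (negbTE lk) mulr0.
  by rewrite big_ord1 mxE (negbTE lk) mul0r.
exists (1 + \sum_k `|A i k| * (1 + B k k)).
  by rewrite ltr_wpDr// sumr_ge0// => k _; rewrite mulr_ge0// addr_ge0.
move=> w Sw; have [_ pL] := Sw; rewrite {1}(HA _ _ pL) mxE.
have w1 := weight_ge1 Sw.
apply: le_trans (ler_norm_sum _ _ _) _.
apply: (@le_trans _ _ ((\sum_k `|A i k| * (1 + B k k)) * weight w)); last first.
  by rewrite ler_wpM2r ?lerDr// (le_trans ler01).
rewrite mulr_suml; apply: ler_sum => k _; rewrite normrM -mulrA ler_wpM2l//.
apply: le_trans (abs_le_sqr _) _; rewrite mulrDl mul1r lerD//.
apply: le_trans (mx_entry_sqr _ _ _) _; apply: le_trans (psd_row_bound _ _ Bpsd) _.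
by rewrite ler_wpM2l//; have := dissipation_weight Sw; apply: le_trans; exact: ler_norm.
Qed.

Lemma flux_weight i j w : Sp w -> `|w.1 i 0 * (B *m w.2) i j| <= 3 * weight w.
Proof.
move=> Sw; have [s0 _] := Sw; rewrite normrM (ger0_norm (s0 i)).
apply: (@le_trans _ _ (w.1 i 0 * (1 + mxdot (row i (B *m w.2)) (row i (B *m w.2))))).
  rewrite ler_wpM2l//; apply: le_trans (abs_le_sqr _) _.
  by rewrite lerD2l mx_entry_sqr.
have := density_weight i Sw; have := mobility_weight i Sw.
rewrite !ger0_norm ?mobility_ge0// /mobility => h1 h2; lra.
Qed.

End Moments.

(** * Integrability of the moments *)

Section YoungMoments.
Context {R : realType} {d n : nat}.
Local Notation V := ('rV[R]_d * R)%type.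
Local Notation VM := ('rV[R]_d * measurableTypeR R)%type.
Local Notation W := ('cV[R]_n * 'M[R]_(n, d))%type.
Local Notation m := (@lebVt R d).
Variables (Omega : set 'rV[R]_d) (B : 'M[R]_n) (mu : V -> probability W R) (T : R).
Hypotheses (Bpsd : psd B) (oOmega : open Omega) (bOmega : bounded_set Omega)
  (young : young_measure Omega B mu).
Let Sp : set W := state_space B.
Let D : set VM := Omega `*` `]0, T[.
Let mD : measurable D. Proof. exact: measurable_cylinder. Qed.
Let mS : measurable Sp. Proof. exact: measurable_state_space. Qed.

Definition moment (f : W -> R) (z : V) : R := \int[mu z]_(w in Sp) f w.

Lemma measurable_moments (J : set (measurableTypeR R)) (f : W -> R) :
  measurable J -> J `<=` `[0, +oo[ -> continuous f ->
  measurable_fun (Omega `*` J : set VM) (fun z => \int[mu z]_(w in Sp) (f w)%:E)%E.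
Proof.
move=> mJ J0 cf; apply: measurable_funS (young_measurable_signed young cf).
  by apply: measurableX => //; exact: measurable_open_rV.
by move=> [x t] [/= Ox /J0].
Qed.

Let D_pos : `]0, T[%classic `<=` (`[0, +oo[%classic : set R).
Proof. by move=> t /=; rewrite !in_itv/= => /andP[/ltW -> _]. Qed.

Lemma measurable_moment_D (f : W -> R) : continuous f ->
  measurable_fun D (fun z => \int[mu z]_(w in Sp) (f w)%:E)%E.
Proof. by move=> cf; apply: measurable_moments => //; exact: measurable_itv. Qed.

Lemma continuous_measurable_Sp (f : W -> R) : continuous f -> measurable_fun Sp (EFin \o f).
Proof.
by move=> cf; apply/measurable_EFinP; apply: measurable_funTS; exact: continuousT_measurable_W.
Qed.

(** Entropy and dissipation have finite mean at z. *)
Definition good (z : V) : Prop := (mu z).-integrable Sp (EFin \o weight B).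

Hypothesis weight_lty :
  (\int[m]_(z in D) \int[mu z]_(w in Sp) (weight B w)%:E < +oo)%E.

Let wpos w : Sp w -> (0 <= (weight B w)%:E)%E.
Proof. by move=> Sw; rewrite lee_fin (le_trans ler01)// weight_ge1. Qed.

Let weight_int z : D z -> (0 <= \int[mu z]_(w in Sp) (weight B w)%:E)%E.
Proof. by move=> _; apply: integral_ge0 => w; exact: wpos. Qed.

Lemma integrable_weight :
  m.-integrable D (fun z => \int[mu z]_(w in Sp) (weight B w)%:E)%E.
Proof.
apply/integrableP; split; first by apply: measurable_moment_D; exact: continuous_weight.
rewrite (_ : integral _ _ _ = \int[m]_(z in D) \int[mu z]_(w in Sp) (weight B w)%:E)%E//.
by apply: eq_integral => z; rewrite inE => Dz; rewrite gee0_abs// weight_int.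
Qed.

Lemma goodP z : D z -> (\int[mu z]_(w in Sp) (weight B w)%:E < +oo)%E -> good z.
Proof.
move=> Dz h; apply/integrableP; split.
  by apply: continuous_measurable_Sp; exact: continuous_weight.
rewrite (_ : integral _ _ _ = \int[mu z]_(w in Sp) (weight B w)%:E)%E//.
by apply: eq_integral => w; rewrite inE => Sw; rewrite gee0_abs// wpos.
Qed.

Lemma ae_good : {ae m, forall z, D z -> good z}.
Proof.
have := integrable_ae mD integrable_weight.
apply: filterS => z h Dz; have := h Dz; rewrite ge0_fin_numE ?weight_int// => h'.
exact: goodP.
Qed.

Lemma good_integrable (f : W -> R) (C : R) z : continuous f ->
  (forall w, Sp w -> `|f w| <= C * weight B w) -> good z ->
  (mu z).-integrable Sp (EFin \o f).
Proof.
move=> cf fC gz; apply: (le_integrable_real mS _ fC).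
  by apply/measurable_EFinP; exact: continuous_measurable_Sp.
exact: (integrable_scaleR mS C gz).
Qed.

Lemma moment_integrable (f : W -> R) (C : R) : 0 < C -> continuous f ->
  (forall w, Sp w -> `|f w| <= C * weight B w) ->
  m.-integrable D (EFin \o (moment f : VM -> R)).
Proof.
move=> C0 cf fC.
have iw : m.-integrable D (fun z => C%:E * \int[mu z]_(w in Sp) (weight B w)%:E)%E.
  exact: (integrableZl mD C integrable_weight).
apply: (le_integrable mD _ _ iw).
  apply/measurable_EFinP.
  by apply: (measurableT_comp (f := fine)) => //; exact: measurable_moment_D.
move=> z Dz; rewrite [leRHS]gee0_abs; last first.
  by rewrite mule_ge0 ?weight_int// lee_fin ltW.
have [gz|] := ltP (\int[mu z]_(w in Sp) (weight B w)%:E)%E +oo%E; last first.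
  by rewrite leye_eq => /eqP ->; rewrite gt0_muley// leey.
have {}gz := goodP Dz gz.
rewrite /moment /Rintegral.
have ifz := good_integrable cf fC gz.
rewrite -[leLHS]/(`|(fine (\int[mu z]_(w in Sp) (f w)%:E))%:E|)%E fineK ?(integrable_fin_num mS ifz)//.
apply: (le_trans (le_abse_integral _ mS (continuous_measurable_Sp cf))).
have iz := good_integrable (f := weight B) (C := 1) (@continuous_weight _ _ _ B).
rewrite -ge0_integralZl_EFin//; last 2 first.
- by apply: continuous_measurable_Sp; exact: continuous_weight.
- exact: ltW.
apply: ge0_le_integral => //.
- by apply: measurableT_comp => //; exact: continuous_measurable_Sp.
- by apply: emeasurable_funM => //; exact: (continuous_measurable_Sp (@continuous_weight R d n B)).
Qed.

Lemma young_mass z : D z -> mu z Sp = 1%E.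
Proof. by move=> [Oz It]; case: young => h _; apply: h; split => //; exact: D_pos. Qed.

Lemma moment_cst (c : R) z : D z -> moment (fun _ => c) z = c.
Proof.
move=> Dz; apply: (etrans (Rintegral_cst (mu z) mS c)).
by apply: (etrans (congr1 (fun a => c * fine a) (young_mass Dz))); rewrite mulr1.
Qed.

End YoungMoments.

(** * Time-weighted entropy inequalities *)

Section WeightedEnergy.
Context {R : realType}.
Local Notation mu := (@lebesgue_measure R).
Variables (k : nat) (t0 T h : R) (S P : R -> \bar R).
Local Notation psi := (psi k t0).
Local Notation dpsi := (dpsi k t0).
Let J : set (measurableTypeR R) := `]0, +oo[%classic.
Let I : set (measurableTypeR R) := `]0, T[%classic.
Hypotheses (T_gt0 : 0 < T) (t0T : t0 < T) (h_ge0 : 0 <= h)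
  (mS : measurable_fun J S) (mP : measurable_fun J P)
  (S0 : forall t, 0 < t -> (0 <= S t)%E) (P0 : forall t, 0 < t -> (0 <= P t)%E)
  (SP : {ae mu, forall t, 0 < t -> (S t + \int[mu]_(tau in `]0%R, t[) P tau <= h%:E)%E}).

Let mI : measurable I. Proof. exact: measurable_itv. Qed.
Let mJ : measurable J. Proof. exact: measurable_itv. Qed.
Let IJ : I `<=` J.
Proof. by move=> t; rewrite /I /J/= !in_itv/= andbT => /andP[]. Qed.
Let I_gt0 t : I t -> 0 < t. Proof. by rewrite /I/= in_itv/= => /andP[]. Qed.
Let mSI : measurable_fun I S. Proof. exact: measurable_funS mS. Qed.
Let mPI : measurable_fun I P. Proof. exact: measurable_funS mP. Qed.
Let P_int0 t : (0 <= \int[mu]_(tau in `]0%R, t[) P tau)%E.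
Proof. by apply: integral_ge0 => s; rewrite /= in_itv/= => /andP[s0 _]; exact: P0. Qed.

Lemma state_lty : (\int[mu]_(t in I) S t < +oo)%E.
Proof.
apply: (@le_lt_trans _ _ (\int[mu]_(t in I) (cst h%:E) t)%E).
  apply: ae_ge0_le_integral => //.
  - by move=> t /I_gt0; exact: S0.
  - have [N [mN N0 HN]] := SP; exists N; split => // t nQ; apply: HN => H.
    apply: nQ => It; apply: le_trans (H (I_gt0 It)).
    by rewrite leeDl// P_int0.
rewrite integral_cst// lte_mul_pinfty ?lee_fin//.
have muI : mu I = T%:E.
  apply: (etrans (lebesgue_measure_itv `]0, T[)).
  by rewrite /= lte_fin T_gt0 -EFinB subr0.
have muI_lty : (mu I < +oo)%E by rewrite muI ltry.
exact: muI_lty.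
Qed.

(** The inequality at one time beyond T bounds the whole production on (0, T). *)
Lemma production_lty : (\int[mu]_(t in I) P t < +oo)%E.
Proof.
have [t1 [Tt1 H1]] : exists t1, T < t1 /\ (S t1 + \int[mu]_(tau in `]0%R, t1[) P tau <= h%:E)%E.
  have [N [mN N0 HN]] := SP.
  apply: contrapT => noT.
  have sub : `]T, T + 1[%classic `<=` (N : set R).
    move=> t; rewrite /= in_itv/= => /andP[Tt _]; apply: HN => H.
    by apply: noT; exists t; split => //; apply: H; exact: lt_trans Tt.
  pose J1 : set (measurableTypeR R) := `]T, T + 1[%classic.
  have mJ1 : measurable J1 by exact: measurable_itv.
  have muJ1 : mu J1 = 1%:E.
    apply: (etrans (lebesgue_measure_itv `]T, T + 1[)).
    by rewrite /= lte_fin ltrDl ltr01 -EFinB addrAC subrr add0r.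
  have : (mu J1 <= mu N)%E by apply: le_measure => //; rewrite inE.
  by rewrite N0 muJ1 lee_fin ler10.
apply: (@le_lt_trans _ _ h%:E); last exact: ltry.
apply: le_trans H1; apply: (@le_trans _ _ (\int[mu]_(tau in `]0%R, t1[) P tau)%E); last first.
  by rewrite leeDr// S0// (lt_trans T_gt0).
have mI1 : measurable (`]0, t1[%classic : set (measurableTypeR R)) by exact: measurable_itv.
apply: (ge0_subset_integral mu mI mI1).
- apply: (measurable_funS mJ _ mP).
  by move=> t; rewrite /J/= !in_itv/= andbT => /andP[].
- by move=> t; rewrite /= in_itv/= => /andP[s0 _]; exact: P0.
- by move=> t; rewrite /I/= !in_itv/= => /andP[-> tT]; exact: lt_trans Tt1.
Qed.

(** The production integrated up to t, averaged with the density - psi', is the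
    production weighted by psi. *)
Lemma weighted_energy :
  (\int[mu]_(t in I) ((- dpsi t)%:E * S t) + \int[mu]_(t in I) ((psi t)%:E * P t)
   <= (psi 0 * h)%:E)%E.
Proof.
have P0I t : 0 < t < T -> (0 <= P t)%E by move=> /andP[s0 _]; exact: P0.
have [mPP EP] := tonelli_time k t0T mPI P0I.
have mw : measurable_fun I (fun t => (- dpsi t)%:E).
  apply/measurable_EFinP; apply: measurable_funTS.
  by apply: continuous_measurable_fun => t; apply: cvgN; exact: continuous_dpsi.
have w0 t : (0 <= (- dpsi t)%:E)%E by rewrite lee_fin oppr_ge0 dpsi_le0.
have <- : (\int[mu]_(t in I) ((- dpsi t)%:E * h%:E) = (psi 0 * h)%:E)%E.
  rewrite (ge0_integralZr mu mI mw); [|by move=> t _; exact: w0|by rewrite lee_fin].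
  by rewrite EFinM (integral_dpsi k t0T T_gt0).
rewrite -EP -ge0_integralD//; last 3 first.
- by move=> t /I_gt0 s0; rewrite mule_ge0 ?S0.
- exact: emeasurable_funM.
- by move=> t _; rewrite mule_ge0.
apply: ae_ge0_le_integral => //.
- by move=> t /I_gt0 s0; rewrite adde_ge0// mule_ge0// S0.
- by apply: emeasurable_funD => //; exact: emeasurable_funM.
- by move=> t _; rewrite mule_ge0// lee_fin.
- exact: emeasurable_funM.
- have [N [mN N0 HN]] := SP; exists N; split => // t nQ; apply: HN => H.
  apply: nQ => It; rewrite -ge0_muleDr ?P_int0 ?S0 ?I_gt0//.
  by rewrite lee_wpmul2l// H// I_gt0.
Qed.

End WeightedEnergy.

Section EnergySplit.
Context {R : realType} {d : nat}.
Local Notation V := ('rV[R]_d * R)%type.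
Local Notation VM := ('rV[R]_d * measurableTypeR R)%type.
Local Notation m := (@lebVt R d).
Local Notation leb := (@lebV R d).
Local Notation mu := (@lebesgue_measure R).
Variables (Omega : set 'rV[R]_d) (k : nat) (t0 T h : R) (e1 e2 : VM -> \bar R).
Local Notation psi := (psi k t0).
Local Notation dpsi := (dpsi k t0).
Let J : set (measurableTypeR R) := `]0, +oo[%classic.
Let I : set (measurableTypeR R) := `]0, T[%classic.
Let D : set VM := Omega `*` I.
Hypotheses (oOmega : open Omega) (T_gt0 : 0 < T) (t0T : t0 < T) (h_ge0 : 0 <= h)
  (me1 : measurable_fun (Omega `*` J) e1) (me2 : measurable_fun (Omega `*` J) e2)
  (e10 : forall z, (Omega `*` J) z -> (0 <= e1 z)%E)
  (e20 : forall z, (Omega `*` J) z -> (0 <= e2 z)%E)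
  (e12 : {ae mu, forall t, 0 < t -> (\int[leb]_(x in Omega) e1 (x, t) +
     \int[mu]_(tau in `]0%R, t[) \int[leb]_(x in Omega) e2 (x, tau) <= h%:E)%E}).

Let mO : measurable Omega. Proof. exact: measurable_open_rV. Qed.
Let mI : measurable I. Proof. exact: measurable_itv. Qed.
Let mJ : measurable J. Proof. exact: measurable_itv. Qed.
Let IJ : I `<=` J.
Proof. by move=> t; rewrite /I /J/= !in_itv/= andbT => /andP[]. Qed.
Let DJ : D `<=` Omega `*` J. Proof. by move=> z [Oz /IJ]. Qed.
Let mOJ : measurable (Omega `*` J). Proof. exact: measurableX. Qed.
Let mD : measurable D. Proof. exact: measurableX. Qed.
Let J_gt0 t : 0 < t -> J t. Proof. by rewrite /J/= in_itv/= andbT. Qed.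

Let mS := measurable_tonelli21 leb mO mJ me1 e10.
Let mP := measurable_tonelli21 leb mO mJ me2 e20.
Let S0 t : 0 < t -> (0 <= \int[leb]_(x in Omega) e1 (x, t))%E.
Proof. by move=> t_gt0; apply: integral_ge0 => x Ox; apply: e10; split => //; exact: J_gt0. Qed.
Let P0 t : 0 < t -> (0 <= \int[leb]_(x in Omega) e2 (x, t))%E.
Proof. by move=> t_gt0; apply: integral_ge0 => x Ox; apply: e20; split => //; exact: J_gt0. Qed.

Let on_D (e : VM -> \bar R) : measurable_fun (Omega `*` J) e ->
  (forall z, (Omega `*` J) z -> (0 <= e z)%E) ->
  (\int[mu]_(t in I) \int[leb]_(x in Omega) e (x, t) = \int[m]_(z in D) e z)%E.
Proof.
move=> me e0; apply: (tonelli21 leb mu mO mI (f := e)).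
  exact: measurable_funS me.
by move=> z /DJ; exact: e0.
Qed.

Lemma energy_lty : (\int[m]_(z in D) e1 z < +oo)%E /\ (\int[m]_(z in D) e2 z < +oo)%E.
Proof.
split; rewrite -on_D//.
  exact: (state_lty T_gt0 h_ge0 mS S0 P0 e12).
exact: (production_lty T_gt0 mP S0 P0 e12).
Qed.

Let weighted_on_D (e : VM -> \bar R) (w : R -> R) : continuous w -> (forall t, 0 <= w t) ->
  measurable_fun (Omega `*` J) e -> (forall z, (Omega `*` J) z -> (0 <= e z)%E) ->
  (\int[mu]_(t in I) ((w t)%:E * \int[leb]_(x in Omega) e (x, t)) =
   \int[m]_(z in D) ((w z.2)%:E * e z))%E.
Proof.
move=> cw w0 me e0.
have mw : measurable_fun setT (fun z : VM => (w z.2)%:E).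
  apply/measurable_EFinP; apply: (measurableT_comp (f := w : measurableTypeR R -> R)) => //.
  exact: continuous_measurable_fun.
rewrite -(on_D (e := fun z => (w z.2)%:E * e z)%E); last 2 first.
- by apply: emeasurable_funM => //; exact: measurable_funTS.
- by move=> z Dz; rewrite mule_ge0 ?lee_fin ?e0.
apply: eq_integral => t; rewrite inE => It; apply: esym => /=.
apply: (@ge0_integralZl_EFin _ _ _ leb _ mO (fun x => e (x, t))).
- by move=> x Ox; apply: e0; split => //; exact: IJ.
- have mpt : measurable_fun Omega (fun x : 'rV[R]_d => ((x, t) : VM)).
    by apply: measurable_funTS; exact: pair2_measurable.
  apply: (measurable_comp mOJ _ me mpt).
  by move=> _ [x Ox <-]; split => //; exact: IJ.
- exact: w0.
Qed.

Lemma weighted_energy_cylinder :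
  (\int[m]_(z in D) ((- dpsi z.2)%:E * e1 z) + \int[m]_(z in D) ((psi z.2)%:E * e2 z)
   <= (psi 0 * h)%:E)%E.
Proof.
rewrite -(@weighted_on_D e1 (fun t => - dpsi t))//; last 2 first.
- by move=> t; apply: cvgN; exact: continuous_dpsi.
- by move=> t; rewrite oppr_ge0 dpsi_le0.
rewrite -(@weighted_on_D e2 psi)//; last 2 first.
- exact: continuous_pospow_sub.
- exact: psi_ge0.
exact: weighted_energy t0T h_ge0 mS mP S0 P0 e12.
Qed.

End EnergySplit.

(** * Entropies of the measure-valued solution *)

Section MvEntropy.
Context {R : realType} {d n : nat}.
Local Notation V := ('rV[R]_d * R)%type.
Local Notation VM := ('rV[R]_d * measurableTypeR R)%type.
Local Notation W := ('cV[R]_n * 'M[R]_(n, d))%type.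
Local Notation m := (@lebVt R d).
Local Notation leb := (@lebV R d).
Variables (Omega : set 'rV[R]_d) (B : 'M[R]_n) (uin : 'rV[R]_d -> 'cV[R]_n)
  (mu : V -> probability W R) (T hs hr : R).
Hypotheses (Bpsd : psd B) (oOmega : open Omega) (bOmega : bounded_set Omega)
  (T_gt0 : 0 < T) (young : young_measure Omega B mu)
  (entropy : dissipative_entropy Omega B uin mu)
  (hs_ge0 : 0 <= hs) (hr_ge0 : 0 <= hr)
  (hsE : HS Omega uin = hs%:E) (hrE : HR Omega B uin = hr%:E).
Let Sp : set W := state_space B.
Let D : set VM := Omega `*` `]0, T[.
Let J : set (measurableTypeR R) := `]0, +oo[%classic.
Let mD : measurable D. Proof. exact: measurable_cylinder. Qed.
Let Dlty : (m D < +oo)%E. Proof. exact: cylinder_lty. Qed.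
Let mS : measurable Sp. Proof. exact: measurable_state_space. Qed.
Let mO : measurable Omega. Proof. exact: measurable_open_rV. Qed.
Let mJ : measurable J. Proof. exact: measurable_itv. Qed.
Let J0 : J `<=` `[0, +oo[.
Proof. by move=> t; rewrite /J/= !in_itv/= !andbT => /ltW. Qed.
Let DJ : D `<=` Omega `*` J.
Proof. by move=> [x t] [Ox]; rewrite /J/= !in_itv/= andbT => /andP[]. Qed.

Definition quad (z : V) : R :=
  \sum_i \sum_j B i j * bary_s B mu z i 0 * bary_s B mu z j 0.

Lemma bary_sE z i : bary_s B mu z i 0 = moment B mu (fun w => w.1 i 0) z.
Proof. by rewrite mxE. Qed.

Lemma quad_form_ge0 (x : 'cV[R]_n) : 0 <= \sum_i \sum_j B i j * x i 0 * x j 0.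
Proof.
have := psd_mxdot_ge0 x Bpsd; rewrite /mxdot.
rewrite (_ : \sum_i \sum_j x i j * (B *m x) i j = \sum_i \sum_j B i j * x i 0 * x j 0)//.
apply: eq_bigr => i _; rewrite big_ord1 mxE mulr_sumr.
by apply: eq_bigr => j _; ring.
Qed.

Let ie (f : W -> R) (z : VM) : \bar R := (\int[mu z]_(w in Sp) (f w)%:E)%E.

Let mie f : continuous f -> measurable_fun (Omega `*` J) (ie f).
Proof. by move=> cf; exact: (measurable_moments oOmega young mJ J0 cf). Qed.

Let ie_ge0 f z : (forall w, Sp w -> 0 <= f w) -> (0 <= ie f z)%E.
Proof. by move=> f0; apply: integral_ge0 => w Sw; rewrite lee_fin f0. Qed.

Let mquad : measurable_fun (Omega `*` J) (fun z : VM => (2^-1 * quad z)%:E).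
Proof.
have mu_ i : measurable_fun (Omega `*` J) (fun z : VM => bary_s B mu z i 0).
  apply: (eq_measurable_fun (fun z : VM => fine (ie (fun w => w.1 i 0) z))).
    by move=> z _; rewrite bary_sE.
  by apply: (measurableT_comp (f := fine)) => //; apply: mie; exact: continuous_coord1.
apply/measurable_EFinP; apply: measurable_funM; first exact: measurable_cst.
apply: measurable_sum => i; apply: measurable_sum => j.
by apply: measurable_funM => //; apply: measurable_funM => //; exact: measurable_cst.
Qed.

Let diss_lem : (fun w : W => (enorm (psd_sqrt B *m w.2) ^+ 2)%:E) =
  (fun w => (dissipation B w)%:E).
Proof. by apply/funext => w; rewrite enorm_psd_sqrt. Qed.

Let mob_lem i : (fun w : W => (w.1 i 0 * enorm (row i (B *m w.2)) ^+ 2)%:E) =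
  (fun w => (mobility B i w)%:E).
Proof. by apply/funext => w; rewrite enorm2. Qed.

Let mob_sum (z : VM) : \bar R := (\sum_(i < n) ie (mobility B i) z)%E.

Let mmob_sum : measurable_fun (Omega `*` J) mob_sum.
Proof. by apply: emeasurable_sum => i; apply: mie; exact: continuous_mobility. Qed.

Let mob_sum_ge0 z : (0 <= mob_sum z)%E.
Proof. by apply: sume_ge0 => i _; apply: ie_ge0 => w Sw; exact: mobility_ge0 Sw. Qed.

Let boltzmann : {ae @lebesgue_measure R, forall t, 0 < t ->
  (\int[leb]_(x in Omega) ie (fun w => hS w.1) (x, t) +
   \int[@lebesgue_measure R]_(tau in `]0%R, t[) \int[leb]_(x in Omega)
     ie (dissipation B) (x, tau) <= hs%:E)%E}.
Proof.
have [N [mN N0 HN]] := entropy; exists N; split => // t nQ; apply: HN => H; apply: nQ => t_gt0.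
have [+ _] := H t_gt0; rewrite hsE; apply: le_trans; apply: leeD; first exact: lexx.
by rewrite le_eqVlt; apply/orP; left; apply/eqP; rewrite /ie -diss_lem.
Qed.

Let rao : {ae @lebesgue_measure R, forall t, 0 < t ->
  (\int[leb]_(x in Omega) (2^-1 * quad (x, t))%:E +
   \int[@lebesgue_measure R]_(tau in `]0%R, t[) \int[leb]_(x in Omega)
     mob_sum (x, tau) <= hr%:E)%E}.
Proof.
have [N [mN N0 HN]] := entropy; exists N; split => // t nQ; apply: HN => H; apply: nQ => t_gt0.
have [_ +] := H t_gt0; rewrite hrE; apply: le_trans; apply: leeD.
  rewrite /HR -ge0_integralZl_EFin//.
  - by move=> x Ox; rewrite lee_fin; exact: quad_form_ge0.
  - have mpt : measurable_fun Omega (fun x : 'rV[R]_d => ((x, t) : VM)).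
      by apply: measurable_funTS; exact: pair2_measurable.
    have mOJ : measurable (Omega `*` J) by exact: measurableX.
    have m2 : measurable_fun (Omega `*` J) (fun z : VM => (2%:E * (2^-1 * quad z)%:E)%E).
      by apply: emeasurable_funM => //; exact: measurable_cst.
    have := measurable_comp mOJ (_ : (fun x : 'rV[R]_d => ((x, t) : VM)) @` Omega `<=` _) m2 mpt.
    rewrite (_ : _ \o _ = (fun x => (\sum_i \sum_j B i j * bary_s B mu (x, t) i 0 * bary_s B mu (x, t) j 0)%:E)).
      by apply; move=> _ [x Ox <-]; split => //; rewrite /J/= in_itv/= andbT.
    by apply/funext => x /=; rewrite -EFinM /quad; congr EFin; field.
rewrite le_eqVlt; apply/orP; left; apply/eqP.
pose I : set (measurableTypeR R) := `]0, t[%classic.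
have mI : measurable I by exact: measurable_itv.
have IJ : I `<=` J by move=> s; rewrite /I /J/= !in_itv/= andbT => /andP[].
have slice (f : W -> R) s : continuous f -> J s -> measurable_fun Omega (fun x => ie f (x, s)).
  move=> cf Js; apply: (measurable_comp (measurableX mO mJ) _ (mie cf)).
    by move=> _ [x Ox <-]; split.
  by apply: measurable_funTS; exact: pair2_measurable.
transitivity (\int[@lebesgue_measure R]_(tau in I) \sum_(i < n) \int[leb]_(x in Omega)
     ie (mobility B i) (x, tau))%E.
  apply: eq_integral => s; rewrite inE => Is; rewrite /mob_sum.
  apply: (ge0_integral_sum leb mO).
    by move=> i; apply: slice; [exact: continuous_mobility|exact: IJ].
  by move=> i x Ox; apply: ie_ge0 => w Sw; exact: mobility_ge0 Sw.
rewrite (ge0_integral_sum (@lebesgue_measure R) mI).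
- by apply: eq_bigr => i _; rewrite /ie -mob_lem.
- move=> i; apply: (measurable_funS mJ IJ).
  apply: (measurable_tonelli21 leb mO mJ (mie (@continuous_mobility R d n B i))).
  by move=> z _; apply: ie_ge0 => w Sw; exact: mobility_ge0 Sw.
- move=> i s _; apply: integral_ge0 => x _.
  by apply: ie_ge0 => w Sw; exact: mobility_ge0 Sw.
Qed.

Let hS_e z : (Omega `*` J) z -> (0 <= ie (fun w => hS w.1) z)%E.
Proof. by move=> _; apply: ie_ge0 => w Sw; exact: hS_ge0 Sw. Qed.
Let diss_e z : (Omega `*` J) z -> (0 <= ie (dissipation B) z)%E.
Proof. by move=> _; apply: ie_ge0 => w _; exact: dissipation_ge0. Qed.
Let quad_e z : (Omega `*` J) z -> (0 <= (2^-1 * quad z)%:E)%E.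
Proof. by move=> _; rewrite lee_fin mulr_ge0 ?invr_ge0// quad_form_ge0. Qed.
Let mob_e z : (Omega `*` J) z -> (0 <= mob_sum z)%E. Proof. by []. Qed.

Lemma weight_lty : (\int[m]_(z in D) \int[mu z]_(w in Sp) (weight B w)%:E < +oo)%E.
Proof.
have [h1 h2] := energy_lty oOmega T_gt0 hs_ge0 (mie (@continuous_hS R d n))
  (mie (@continuous_dissipation R d n B)) hS_e diss_e boltzmann.
have [_ h3] := energy_lty oOmega T_gt0 hr_ge0 mquad mmob_sum quad_e mob_e rao.
have mDS (f : VM -> \bar R) : measurable_fun (Omega `*` J) f -> measurable_fun D f.
  by apply: measurable_funS => //; exact: measurableX.
have mW (f : W -> R) : continuous f -> measurable_fun Sp (EFin \o f).
  by move=> cf; exact: (continuous_measurable_Sp cf).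
have E z : D z -> (\int[mu z]_(w in Sp) (weight B w)%:E =
    cst 1 z + ie (fun w => hS w.1) z + ie (dissipation B) z + mob_sum z)%E.
  move=> Dz.
  have one : (\int[mu z]_(w in Sp) (1 : R)%:E = 1)%E.
    rewrite integral_cst// mul1e; exact: (young_mass young Dz).
  rewrite -[X in (X + _ + _ + _)%E]one /ie /mob_sum /ie.
  rewrite -(ge0_integral_sum (mu z) mS); last 2 first.
  - by move=> i; apply: mW; exact: continuous_mobility.
  - by move=> i w Sw; rewrite lee_fin; exact: mobility_ge0 Sw.
  rewrite -ge0_integralD//; last 2 first.
  - by move=> w Sw; rewrite lee_fin; exact: hS_ge0 Sw.
  - exact: (mW (fun w => hS w.1) (@continuous_hS R d n)).
  rewrite -ge0_integralD//; last 4 first.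
  - by move=> w Sw; rewrite adde_ge0// lee_fin; exact: hS_ge0 Sw.
  - by apply: emeasurable_funD => //; exact: (mW (fun w => hS w.1) (@continuous_hS R d n)).
  - by move=> w Sw; rewrite lee_fin; exact: dissipation_ge0.
  - by apply: mW; exact: continuous_dissipation.
  rewrite -ge0_integralD//; last 4 first.
  - by move=> w Sw; rewrite !adde_ge0// lee_fin ?dissipation_ge0//; exact: hS_ge0 Sw.
  - apply: emeasurable_funD; last by apply: mW; exact: continuous_dissipation.
    by apply: emeasurable_funD => //; exact: (mW (fun w => hS w.1) (@continuous_hS R d n)).
  - by move=> w Sw; apply: sume_ge0 => i _; rewrite lee_fin; exact: mobility_ge0 Sw.
  - by apply: emeasurable_sum => i; apply: mW; exact: continuous_mobility.
  by apply: eq_integral => w _; rewrite sumEFin -!EFinD.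
have -> : (\int[m]_(z in D) \int[mu z]_(w in Sp) (weight B w)%:E =
   \int[m]_(z in D) (cst 1 z + ie (fun w => hS w.1) z + ie (dissipation B) z + mob_sum z))%E.
  by apply: eq_integral => z; rewrite inE; exact: E.
have m1 := mDS _ (mie (@continuous_hS R d n)).
have m2 := mDS _ (mie (@continuous_dissipation R d n B)).
have m3 := mDS _ mmob_sum.
have mc : measurable_fun D (cst 1%E : VM -> \bar R) by exact: measurable_cst.
rewrite ge0_integralD//; last 2 first.
- move=> z /DJ Jz; apply: adde_ge0; last exact: diss_e.
  by apply: adde_ge0; last exact: hS_e.
- by apply: emeasurable_funD => //; exact: emeasurable_funD.
rewrite ge0_integralD//; last 3 first.
- by move=> z /DJ Jz; apply: adde_ge0; last exact: hS_e.
- exact: emeasurable_funD.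
- by move=> z /DJ; exact: diss_e.
rewrite ge0_integralD//; last by move=> z /DJ; exact: hS_e.
rewrite integral_cst// mul1e.
apply: lte_add_pinfty; last exact: h3.
apply: lte_add_pinfty; last exact: h2.
by apply: lte_add_pinfty; [exact: Dlty|exact: h1].
Qed.

Lemma quad_integrable : m.-integrable D (EFin \o (quad : VM -> R)).
Proof.
have [h _] := energy_lty oOmega T_gt0 hr_ge0 mquad mmob_sum quad_e mob_e rao.
have mDq : measurable_fun D (fun z : VM => (2^-1 * quad z)%:E).
  by apply: measurable_funS mquad => //; exact: measurableX.
have i2 : m.-integrable D (EFin \o (fun z : VM => 2^-1 * quad z)).
  apply/integrableP; split => //.
  rewrite (_ : integral _ _ _ = \int[m]_(z in D) (2^-1 * quad z)%:E)%E//.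
  by apply: eq_integral => z; rewrite inE => /DJ Jz; rewrite gee0_abs// quad_e.
have := integrable_scaleR mD 2 i2.
by rewrite (_ : (fun z : VM => 2 * (2^-1 * quad z)) = quad)//; apply/funext => z; field.
Qed.

Lemma cbd_time (w : R -> R) : continuous w -> cbd (D : set V) (fun z => w z.2).
Proof.
move=> cw; split.
  move=> [x t] _; apply: (@continuous_comp _ _ _ (fun z : V => z.2) w); last exact: cw.
  exact: (@cvg_snd _ _ (nbhs x) (nbhs t)).
have [C wC] := continuous_bounded_on (@segment_compact R 0 T) (continuous_subspaceT cw).
by exists C => -[x t] [_ It]; apply: wC; move: It; rewrite /= !in_itv/= => /andP[/ltW-> /ltW->].
Qed.

Section weighted.
Variables (k : nat) (t0 : R).
Hypothesis t0T : t0 < T.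
Local Notation psi := (psi k t0).
Local Notation dpsi := (dpsi k t0).

Let to_real (w : R -> R) (e : VM -> \bar R) (f : V -> R) : continuous w ->
  measurable_fun D e -> m.-integrable D (EFin \o (f : VM -> R)) ->
  {ae m, forall z, D z -> e z = (f z)%:E} ->
  (\int[m]_(z in D) ((w z.2)%:E * e z) = (\int[m]_(z in D) (w z.2 * f z))%:E)%E.
Proof.
move=> cw me if_ ef.
have iwf := cbd_mul_integrable mD (cbd_time cw) if_.
rewrite [in RHS]/Rintegral fineK ?(integrable_fin_num mD iwf)//.
have mw : measurable_fun D (fun z : VM => (w z.2)%:E).
  by apply/measurable_EFinP; exact: (cbd_measurable mD (cbd_time cw)).
apply: ae_eq_integral => //.
- exact: emeasurable_funM.
- by case/integrableP: iwf.
- by apply: filterS ef => z H Dz; rewrite H.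
Qed.

(** The two entropy inequalities added and averaged in time; infinite values are
    excluded outside a null set, so that the result is an inequality between
    real integrals. *)
Lemma entropy_weighted :
  \int[m]_(z in D) (- dpsi z.2 * (moment B mu (fun w => hS w.1) z + 2^-1 * quad z)) +
  \int[m]_(z in D) (psi z.2 * (moment B mu (dissipation B) z +
     \sum_i moment B mu (mobility B i) z)) <= psi 0 * (hs + hr).
Proof.
have H1 := weighted_energy_cylinder k oOmega T_gt0 t0T hs_ge0 (mie (@continuous_hS R d n))
  (mie (@continuous_dissipation R d n B)) hS_e diss_e boltzmann.
have H2 := weighted_energy_cylinder k oOmega T_gt0 t0T hr_ge0 mquad mmob_sum quad_e mob_e rao.
have cw : continuous (fun t => - dpsi t) by move=> t; apply: cvgN; exact: continuous_dpsi.
have cp : continuous psi by exact: continuous_pospow_sub.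
have mDS (f : VM -> \bar R) : measurable_fun (Omega `*` J) f -> measurable_fun D f.
  by apply: measurable_funS => //; exact: measurableX.
have good_ae := ae_good Bpsd oOmega young weight_lty.
have mint f C := @moment_integrable _ _ _ _ _ _ _ Bpsd oOmega young weight_lty f C.
have gint f C := @good_integrable _ _ _ B mu f C.
have bh w : Sp w -> `|hS w.1| <= 1 * weight B w by move=> Sw; rewrite mul1r; exact: hS_weight Sw.
have bd w : Sp w -> `|dissipation B w| <= 1 * weight B w.
  by move=> Sw; rewrite mul1r; exact: dissipation_weight Sw.
have bm i w : Sp w -> `|mobility B i w| <= 1 * weight B w.
  by move=> Sw; rewrite mul1r; exact: mobility_weight Sw.
have ih := mint _ _ ltr01 (@continuous_hS R d n) bh.
have id_ := mint _ _ ltr01 (@continuous_dissipation R d n B) bd.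
have im i := mint _ _ ltr01 (@continuous_mobility R d n B i) (bm i).
have ims := integrable_sumR mD (index_enum 'I_n) im.
have iq : m.-integrable D (EFin \o (fun z : VM => 2^-1 * quad z)).
  exact: (integrable_scaleR mD _ quad_integrable).
have momE f C z : continuous f -> (forall w, Sp w -> `|f w| <= C * weight B w) -> good B mu z ->
    ie f z = (moment B mu f z)%:E.
  move=> cf fC gz; rewrite /moment /Rintegral fineK//.
  exact: (integrable_fin_num mS (gint _ _ _ cf fC gz)).
have E1 := @to_real _ _ _ cw (mDS _ (mie (@continuous_hS R d n))) ih.
have {}E1 := E1 (filterS (fun z (H : D z -> good B mu z) Dz => momE _ _ z (@continuous_hS R d n) bh (H Dz)) good_ae).
have E2 := @to_real _ _ _ cp (mDS _ (mie (@continuous_dissipation R d n B))) id_.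
have {}E2 := E2 (filterS (fun z (H : D z -> good B mu z) Dz => momE _ _ z (@continuous_dissipation R d n B) bd (H Dz)) good_ae).
have E3 := @to_real _ _ _ cw (mDS _ mquad) iq.
have {}E3 := E3 (aeW _ (fun z Dz => erefl)).
have E4 := @to_real _ _ _ cp (mDS _ mmob_sum) ims.
have {}E4 := E4 (filterS (fun z (H : D z -> good B mu z) Dz => etrans (eq_bigr _ (fun i _ => momE _ _ z (@continuous_mobility R d n B i) (bm i) (H Dz))) (sumEFin _ _ _)) good_ae).
move: H1 H2.
rewrite E1 E2 E3 E4 -!EFinD !lee_fin => H1 H2.
have cbw := cbd_time cw; have cbp := cbd_time cp.
have L : \int[m]_(z in D) (- dpsi z.2 * (moment B mu (fun w => hS w.1) z + 2^-1 * quad z)) =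
   \int[m]_(z in D) (- dpsi z.2 * moment B mu (fun w => hS w.1) z) +
   \int[m]_(z in D) (- dpsi z.2 * (2^-1 * quad z)).
  apply: (etrans _ (RintegralD mD (cbd_mul_integrable mD cbw ih) (cbd_mul_integrable mD cbw iq))).
  by apply: eq_Rintegral => z _; rewrite mulrDr.
have M : \int[m]_(z in D) (psi z.2 * (moment B mu (dissipation B) z +
     \sum_i moment B mu (mobility B i) z)) =
   \int[m]_(z in D) (psi z.2 * moment B mu (dissipation B) z) +
   \int[m]_(z in D) (psi z.2 * \sum_i moment B mu (mobility B i) z).
  apply: (etrans _ (RintegralD mD (cbd_mul_integrable mD cbp id_) (cbd_mul_integrable mD cbp ims))).
  by apply: eq_Rintegral => z _; rewrite mulrDr.
apply: (@le_trans _ _ (psi 0 * hs + psi 0 * hr)); last by rewrite mulrDr.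
apply: le_trans (lerD H1 H2).
have arith (a b c e x y : R) : x = a + b -> y = c + e -> x + y <= a + c + (b + e).
  by move=> -> ->; rewrite addrACA.
exact: arith L M.
Qed.

End weighted.
End MvEntropy.

(** * The relative entropy inequality *)

Section HasInt.
Context {R : realType} dT (X : measurableType dT) (m : {measure set X -> \bar R}).
Variables (D : set X) (mD : measurable D).
Implicit Types (f g : X -> R) (a b c : R).

(** Integrability together with the value: an integral of a long sum is then
    computed by following the syntax of the integrand. *)
Definition has_int f a : Prop :=
  m.-integrable D (EFin \o f) /\ \int[m]_(x in D) f x = a.

Lemma has_intI f : m.-integrable D (EFin \o f) -> has_int f (\int[m]_(x in D) f x).
Proof. by []. Qed.

Lemma has_int_ext f g a : (forall x, D x -> f x = g x) -> has_int g a -> has_int f a.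
Proof.
move=> fg [ig <-]; split; last by apply: eq_Rintegral => x; rewrite inE => /fg.
by apply: eq_integrable ig => // x; rewrite inE => Dx /=; rewrite fg.
Qed.

Lemma has_intD f g a b : has_int f a -> has_int g b -> has_int (fun x => f x + g x) (a + b).
Proof.
by move=> [i1 <-] [i2 <-]; split; [exact: integrable_addR|exact: RintegralD].
Qed.

Lemma has_intB f g a b : has_int f a -> has_int g b -> has_int (fun x => f x - g x) (a - b).
Proof.
by move=> [i1 <-] [i2 <-]; split; [exact: integrable_subR|exact: RintegralB].
Qed.

Lemma has_intMl c f a : has_int f a -> has_int (fun x => c * f x) (c * a).
Proof.
by move=> [i1 <-]; split; [exact: integrable_scaleR|exact: RintegralZl].
Qed.

Lemma has_intMr c f a : has_int f a -> has_int (fun x => f x * c) (a * c).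
Proof.
move=> h; rewrite mulrC; apply: has_int_ext (has_intMl c h) => x _; exact: mulrC.
Qed.

Lemma has_intN f a : has_int f a -> has_int (fun x => - f x) (- a).
Proof.
move=> h; rewrite -mulN1r; apply: has_int_ext (has_intMl (-1) h) => x _.
by rewrite mulN1r.
Qed.

Lemma has_int_sum (I : Type) (s : seq I) (f : I -> X -> R) (a : I -> R) :
  (forall i, has_int (f i) (a i)) ->
  has_int (fun x => \sum_(i <- s) f i x) (\sum_(i <- s) a i).
Proof.
move=> h; have hi i := (h i).1; split; first exact: integrable_sumR.
by rewrite Rintegral_sum//; apply: eq_bigr => i _; case: (h i).
Qed.

Lemma has_int_ge0 f a : (forall x, D x -> 0 <= f x) -> has_int f a -> 0 <= a.
Proof.
move=> f0 [_ <-]; apply: fine_ge0; apply: integral_ge0 => x Dx.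
by rewrite lee_fin f0.
Qed.

Lemma has_int_eq0 f : (forall x, D x -> 0 <= f x) -> has_int f 0 ->
  {ae m, forall x, D x -> f x = 0}.
Proof.
move=> f0 [if_ h].
have fE : (\int[m]_(x in D) `|(EFin \o f) x| = 0)%E.
  transitivity (\int[m]_(x in D) (f x)%:E)%E.
    by apply: eq_integral => x; rewrite inE => Dx /=; rewrite ger0_norm// f0.
  have := integrable_fin_num mD if_; rewrite /comp => /fineK <-.
  by congr EFin.
have [mf _] := integrableP _ _ _ if_.
have := (ae_eq_integral_abs m mD mf).1 fE.
by apply: filterS => x H Dx; have := H Dx => -[].
Qed.

End HasInt.

Section WeakStrong.
Context {R : realType} {d n : nat}.
Local Notation V := ('rV[R]_d * R)%type.
Local Notation VM := ('rV[R]_d * measurableTypeR R)%type.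
Local Notation W := ('cV[R]_n * 'M[R]_(n, d))%type.
Local Notation m := (@lebVt R d).
Local Notation leb := (@lebV R d).
Local Notation dx j := ((delta_mx 0 j : 'rV[R]_d), (0 : R)).
Local Notation dt := ((0 : 'rV[R]_d), (1 : R)).
Variables (Omega : set 'rV[R]_d) (T : R) (B : 'M[R]_n) (v : V -> 'cV[R]_n)
  (uin : 'rV[R]_d -> 'cV[R]_n) (mu : V -> probability W R).
Hypotheses (lOmega : lipschitz_domain Omega) (T_gt0 : 0 < T) (Bpsd : psd B)
  (muin : measurable_fun Omega uin)
  (v_sol : positive_weak_solution Omega B T v)
  (v_init : {ae lebesgue_measure_rV R d, forall x, Omega x -> v (x, 0) = uin x})
  (young : young_measure Omega B mu)
  (weight_fin : (\int[m]_(z in Omega `*` `]0%R, T[)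
     \int[mu z]_(w in state_space B) (weight B w)%:E < +oo)%E).
Let Sp : set W := state_space B.
Let D : set VM := Omega `*` `]0, T[.
Let E : set V := closure Omega `*` `[0, T].
Let oOmega : open Omega. Proof. by case: lOmega. Qed.
Let bOmega : bounded_set Omega. Proof. by case: lOmega. Qed.
Let mO : measurable Omega. Proof. exact: measurable_open_rV. Qed.
Let mD : measurable D. Proof. exact: measurable_cylinder. Qed.
Let Dlty : (m D < +oo)%E. Proof. exact: cylinder_lty. Qed.
Let mS : measurable Sp. Proof. exact: measurable_state_space. Qed.
Let DE : (D : set V) `<=` E. Proof. exact: cylinder_sub. Qed.
Let mI : measurable (`]0, T[ : set (measurableTypeR R)). Proof. exact: measurable_itv. Qed.
Let C1v i : C1 (D : set V) E (fun z => v z i 0). Proof. by case: v_sol. Qed.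
Let v_gt0 z i : E z -> 0 < v z i 0. Proof. by case: v_sol => _ h _ Ez; exact: h. Qed.

Lemma iterated_integral (f : V -> R) (g : 'rV[R]_d -> R -> R) :
  m.-integrable D (EFin \o (f : VM -> R)) ->
  (forall x t, D (x, t) -> g x t = f (x, t)) ->
  \int[@lebesgue_measure R]_(t in `]0, T[) \int[leb]_(x in Omega) g x t =
  \int[m]_(z in D) f z.
Proof.
move=> if_ gf.
have [_ F] := @integrable_fubini21 _ _ _ _ _ leb (@lebesgue_measure R) _ _ mO mI _ if_.
apply: (etrans _ F); apply: eq_Rintegral => t; rewrite inE => It.
by apply: eq_Rintegral => x; rewrite inE => Ox; exact: gf.
Qed.

Lemma C1_energy_density : C1 (D : set V) E (fun z => hS (v z)).
Proof.
apply: C1_sum => i; apply: C1_add; last exact: C1_cst.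
apply: C1_mul => //; apply: C1_add; last exact: C1_cst.
by apply: C1_ln => // z; exact: v_gt0.
Qed.

Lemma C1_quad_v : C1 (D : set V) E (fun z => \sum_i \sum_j B i j * v z i 0 * v z j 0).
Proof.
apply: C1_sum => i; apply: C1_sum => j; apply: C1_mul => //.
by apply: C1_mul => //; exact: C1_cst.
Qed.

Let init_int (f : V -> R) : C1 (D : set V) E f ->
  leb.-integrable Omega (EFin \o (fun x => f (x, 0))).
Proof.
move=> [cf _ _]; apply: (@slice_integrable _ _ Omega T oOmega bOmega f 0 _ cf).
by rewrite lexx ltW.
Qed.

Let muin_i i : measurable_fun Omega (fun x => uin x i 0).
Proof. exact: (measurableT_comp (measurable_mx_entry (R := R) i 0) muin). Qed.

Lemma init_integral (f g : 'rV[R]_d -> R) : measurable_fun Omega f ->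
  leb.-integrable Omega (EFin \o g) ->
  (forall x, Omega x -> v (x, 0) = uin x -> f x = g x) ->
  (\int[leb]_(x in Omega) (f x)%:E = (\int[leb]_(x in Omega) g x)%:E)%E.
Proof.
move=> mf ig fg; rewrite [in RHS]/Rintegral fineK ?(integrable_fin_num mO ig)//.
apply: ae_eq_integral => //; first exact/measurable_EFinP.
  by case/integrableP: ig.
have [N [mN N0 HN]] := v_init; exists N; split => // x nQ; apply: HN => H; apply: nQ => Ox.
by rewrite /= fg// H.
Qed.

Lemma HS_init : HS Omega uin = (\int[leb]_(x in Omega) hS (v (x, 0)))%:E.
Proof.
apply: init_integral.
- apply: measurable_sum => i.
  have c : continuous (fun s : R => s * (ln s - 1) + 1).
    have -> : (fun s : R => s * (ln s - 1) + 1) = (fun s => s * ln s - s + 1).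
      by apply/funext => r; rewrite mulrBr mulr1.
    move=> s.
    apply: cvgD; last exact: cvg_cst.
    by apply: cvgD; [exact: continuous_xlnx|apply: cvgN; exact: cvg_id].
  exact: (measurableT_comp (continuous_measurable_fun c) (muin_i i)).
- exact: (init_int C1_energy_density).
- by move=> x _ ->.
Qed.

Lemma HR_init : HR Omega B uin =
  (2^-1 * \int[leb]_(x in Omega) (\sum_i \sum_j B i j * v (x, 0) i 0 * v (x, 0) j 0))%:E.
Proof.
rewrite EFinM /HR; congr (_ * _)%E; apply: init_integral.
- apply: measurable_sum => i; apply: measurable_sum => j.
  by apply: measurable_funM => //; apply: measurable_funM => //; exact: measurable_cst.
- exact: (init_int C1_quad_v).
- by move=> x _ ->.
Qed.

(** Pointwise h_S(v) + 1/2 v.Bv + energy = v . potential; this is why the initial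
    relative entropy vanishes. *)
Lemma init_energy_cancel :
  \int[leb]_(x in Omega) hS (v (x, 0)) +
  2^-1 * \int[leb]_(x in Omega) (\sum_i \sum_j B i j * v (x, 0) i 0 * v (x, 0) j 0) +
  \int[leb]_(x in Omega) energy B v (x, 0) =
  \sum_i \int[leb]_(x in Omega) (v (x, 0) i 0 * potential B v i (x, 0)).
Proof.
have Cp i : C1 (D : set V) E (fun z => v z i 0 * potential B v i z).
  by apply: C1_mul => //; exact: (C1_potential v_sol i).
have [i1 <-] := has_intD mO (has_intD mO (has_intI (init_int C1_energy_density))
  (has_intMl mO 2^-1 (has_intI (init_int C1_quad_v)))) (has_intI (init_int (C1_energy v_sol))).
have [i2 <-] := has_int_sum mO (index_enum 'I_n) (fun i => has_intI (init_int (Cp i))).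
apply: eq_Rintegral => x; rewrite inE => Ox.
have -> : \sum_i \sum_j B i j * v (x, 0) i 0 * v (x, 0) j 0 =
    \sum_i v (x, 0) i 0 * \sum_k B i k * v (x, 0) k 0.
  by apply: eq_bigr => i _; rewrite mulr_sumr; apply: eq_bigr => j _; ring.
have -> : \sum_i v (x, 0) i 0 * potential B v i (x, 0) =
   \sum_i v (x, 0) i 0 * ln (v (x, 0) i 0) + \sum_i v (x, 0) i 0 * \sum_k B i k * v (x, 0) k 0.
  by rewrite -big_split; apply: eq_bigr => i _ /=; rewrite mulrDr.
have -> : hS (v (x, 0)) = \sum_i v (x, 0) i 0 * ln (v (x, 0) i 0) - \sum_i (v (x, 0) i 0 - 1).
  by rewrite -sumrB; apply: eq_bigr => i _; ring.
rewrite /energy; move: (\sum_i _ * ln _) (\sum_i (_ - 1)) (\sum_i _ * \sum_k _) => a b c.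
by field.
Qed.

Section weighted.
Variables (k : nat) (t0 : R).
Hypothesis t0T : t0 < T.
Local Notation psi := (psi k t0).
Local Notation dpsi := (dpsi k t0).

Let cbp : cbd (D : set V) (fun z => psi z.2).
Proof. by apply: cbd_time; exact: continuous_pospow_sub. Qed.
Let cbdp : cbd (D : set V) (fun z => dpsi z.2).
Proof. by apply: cbd_time; exact: continuous_dpsi. Qed.

Lemma C1_psi : C1 (D : set V) E (fun z => psi z.2).
Proof.
have -> : (fun z : V => psi z.2) = (fun z : V => pospow k.+2 (- (z.2 - t0))).
  by apply/funext => z; rewrite opprB.
by apply: C1_pospow => //; apply: C1_opp => //; exact: C1_coord2.
Qed.

Lemma derive_psi (z e : V) : differentiable (fun z : V => psi z.2) z /\
  'D_e (fun z : V => psi z.2) z = dpsi z.2 * e.2.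
Proof.
have lL : linear (fun e : V => e.2) by move=> a x y.
have cL : continuous (fun e : V => e.2).
  by move=> [x t]; exact: (@cvg_snd _ _ (nbhs x) (nbhs t)).
have [+ Ds] := affine_diff (0 : R) z lL cL.
have E0 : (fun y : V => y.2 + 0) = (fun y => y.2) by apply/funext => y; rewrite addr0.
rewrite E0 in Ds * => ds.
have dps : differentiable psi z.2.
  by apply/derivable1_diffP; exact: (@ex_derive _ _ _ _ _ _ _ (psi_is_derive k t0 z.2)).
split; first exact: (differentiable_comp ds dps).
rewrite (derive_comp1 (h := psi) (f := fun y : V => y.2) e ds dps) Ds derive1E.
by rewrite (@derive_val _ _ _ _ _ _ _ (psi_is_derive k t0 z.2)).
Qed.

Lemma derive_psiM (f : V -> R) z e : differentiable f z ->
  'D_e (fun z => psi z.2 * f z) z = psi z.2 * 'D_e f z + f z * (dpsi z.2 * e.2).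
Proof. by move=> df; have [dp dpE] := derive_psi z e; rewrite derive_mul// dpE. Qed.

(** The time derivative of psi * energy integrates to its value at time 0. *)
Lemma energy_identity :
  \int[m]_(z in D) (dpsi z.2 * energy B v z) +
  \sum_i \int[m]_(z in D) (psi z.2 * (v z i 0 * source B v i z)) +
  \sum_i \int[m]_(z in D) (psi z.2 * (v z i 0 *
     \sum_j pressure_grad B v z i j * log_grad v z i j)) =
  - (psi 0 * \int[leb]_(x in Omega) energy B v (x, 0)).
Proof.
have Ce := C1_energy v_sol.
have Cf : C1 (D : set V) E (fun z => psi z.2 * energy B v z) by apply: C1_mul => //; exact: C1_psi.
have F := time_ftc oOmega bOmega T_gt0 Cf.
have {}F : \int[m]_(z in D) 'D_dt (fun z => psi z.2 * energy B v z) z =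
    - \int[leb]_(x in Omega) (psi 0 * energy B v (x, 0)).
  by apply: F => x Ox; rewrite /= psi_late ?mul0r// ltW.
rewrite -(RintegralZl _ mO (init_int Ce)); apply: (etrans _ F); apply: esym.
have [ce _] := C1_cylinder_cbd oOmega bOmega Ce.
have cv i := cbd_v lOmega v_sol i.
have csrc i := cbd_source lOmega v_sol i.
have cK i : cbd (D : set V) (fun z => \sum_j pressure_grad B v z i j * log_grad v z i j).
  apply: cbd_sum => j; apply: cbdM; first exact: (cbd_pressure_grad lOmega v_sol).
  exact: (cbd_log_grad lOmega v_sol).
have int (f : V -> R) : cbd (D : set V) f -> has_int m D f (\int[m]_(z in D) f z).
  by move=> cf; split => //; exact: cbd_integrable.
have h1 := int _ (cbdM cbdp ce).
have h2 i := int _ (cbdM cbp (cbdM (cv i) (csrc i))).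
have h3 i := int _ (cbdM cbp (cbdM (cv i) (cK i))).
have [_ <-] := has_intD mD (has_intD mD h1 (has_int_sum mD (index_enum 'I_n) h2))
  (has_int_sum mD (index_enum 'I_n) h3).
apply: eq_Rintegral => z; rewrite inE => Dz.
have [_ de _] := Ce.
rewrite (derive_psiM (f := energy B v) dt (de z Dz)) (derive_energy (proj1 Bpsd) v_sol Dz) mulr1.
have -> : psi z.2 * (\sum_i v z i 0 * 'D_dt (potential B v i) z) =
    \sum_i psi z.2 * (v z i 0 * source B v i z) + \sum_i psi z.2 * (v z i 0 *
      \sum_j pressure_grad B v z i j * log_grad v z i j).
  rewrite mulr_sumr -big_split; apply: eq_bigr => i _ /=.
  by rewrite (derive_potential_t v_sol i Dz); ring.
by rewrite addrC [energy _ _ _ * _]mulrC addrA.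
Qed.

Let flux_late (z : V) i j : psi z.2 * flux B v z i j != 0 -> z.2 < t0.
Proof. by apply: contra_neqT; rewrite -leNgt => /psi_late ->; rewrite mul0r. Qed.

Let weak_div_psi i : weak_div Omega T (fun z => psi z.2 * source B v i z)
  (fun j z => psi z.2 * flux B v z i j).
Proof.
move=> t It phi Cphi; have H := weak_div_source lOmega v_sol i It Cphi.
have [cp cdp] := C1_cbd_Omega lOmega Cphi.
have sl (f : V -> R) : cbd (D : set V) f -> cbd Omega (fun x => f (x, t)).
  by move=> cf; exact: (cbd_slice It cf).
have i1 : leb.-integrable Omega (EFin \o (fun x => source B v i (x, t) * phi x)).
  apply: (cbd_integrable_slice lOmega); apply: cbdM => //.
  exact: (sl _ (cbd_source lOmega v_sol i)).
have i2 : leb.-integrable Omega (EFin \o (fun x => \sum_j flux B v (x, t) i j * 'D_(delta_mx 0 j) phi x)).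
  apply: (cbd_integrable_slice lOmega); apply: cbd_sum => j; apply: cbdM; last exact: cdp.
  exact: (sl (fun z => flux B v z i j) (cbd_flux lOmega v_sol i j)).
transitivity (psi t * \int[leb]_(x in Omega) (source B v i (x, t) * phi x)).
  apply: (etrans _ (RintegralZl _ mO i1)); apply: eq_Rintegral => x _ /=; exact: esym (mulrA _ _ _).
rewrite H mulrN; apply: (congr1 -%R).
apply: (etrans (esym (RintegralZl _ mO i2))); apply: eq_Rintegral => x _ /=.
by rewrite mulr_sumr; apply: eq_bigr => j _; rewrite mulrA.
Qed.

(** The strong solution itself is an admissible test function at each time. *)
Lemma green_strong :
  \sum_i \int[m]_(z in D) (psi z.2 * (v z i 0 * source B v i z)) =
  - \sum_i \int[m]_(z in D) (psi z.2 * \sum_j flux B v z i j * space_grad v z i j).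
Proof.
rewrite -sumrN; apply: eq_bigr => i _.
have cv := cbd_v lOmega v_sol i; have csrc := cbd_source lOmega v_sol i.
have cfl j := cbd_flux lOmega v_sol i j; have cg j := cbd_space_grad lOmega v_sol i j.
have c1 := cbdM cbp (cbdM cv csrc).
have c2 : cbd (D : set V) (fun z => \sum_j flux B v z i j * space_grad v z i j).
  by apply: cbd_sum => j; exact: cbdM (cfl j) (cg j).
have i1 := cbd_integrable mD Dlty c1.
have i2 := cbd_integrable mD Dlty (cbdM cbp c2).
have [iF1 F1] := @integrable_fubini21 _ _ _ _ _ leb (@lebesgue_measure R) _ _ mO mI _ i1.
have [iF2 F2] := @integrable_fubini21 _ _ _ _ _ leb (@lebesgue_measure R) _ _ mO mI _ i2.
apply: (etrans (esym F1)); apply: (etrans _ (congr1 -%R F2)).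
apply: (etrans _ (RintegralN mI iF2)).
apply: eq_Rintegral => t; rewrite inE/= in_itv/= => It.
have Cv := C1_space_slice It (C1v i).
apply: (etrans _ (etrans (weak_div_psi i It Cv) _)).
  by apply: eq_Rintegral => x _ /=; ring.
apply: (congr1 -%R); apply: eq_Rintegral => x; rewrite inE => Ox /=.
rewrite mulr_sumr; apply: eq_bigr => j _; rewrite -mulrA; congr (_ * (_ * _)).
rewrite mxE (slice_diff (f := fun z => v z i 0))//.
by have [_ h _] := C1v i; apply: h; split => //=; rewrite in_itv.
Qed.

(** B P = B and the symmetry of B: pairing with the flux only sees the component
    in the range of B, for which a weak gradient is available. *)
Lemma flux_Lperp (z : V) j (w : 'I_n -> R) :
  \sum_i flux B v z i j * w i = \sum_i flux B v z i j * \sum_l projLperp B i l * w l.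
Proof.
pose M := \matrix_(i, j) (space_grad v z i j + v z i 0 * pressure_grad B v z i j).
pose c : 'cV[R]_n := \col_i w i.
have L (x : 'cV[R]_n) : \sum_i flux B v z i j * x i 0 = \sum_i M i j * (B *m x) i 0.
  transitivity (mxdot (B *m col j M) x).
    apply: eq_bigr => i _; rewrite big_ord1; congr (_ * _).
    rewrite /flux -/M [LHS]mxE [RHS]mxE; apply: eq_bigr => l _.
    by rewrite [col _ _ _ _]mxE.
  rewrite mxdot_mull (proj1 Bpsd); apply: eq_bigr => i _; rewrite big_ord1.
  by rewrite !mxE.
transitivity (\sum_i flux B v z i j * c i 0); first by apply: eq_bigr => i _; rewrite [c i 0]mxE.
rewrite L -[in LHS](mul_projLperp B) -mulmxA -L; apply: eq_bigr => i _; congr (_ * _).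
by rewrite mxE; apply: eq_bigr => l _; rewrite [c l 0]mxE.
Qed.

Hypothesis reg : dissipative_regularity Omega B mu T.

Let bs i (z : V) : R := moment B mu (fun w : W => w.1 i 0) z.
Let bp i j (z : V) : R := moment B mu (fun w : W => w.2 i j) z.

Lemma density_integrable i : m.-integrable D (EFin \o (bs i : VM -> R)).
Proof.
apply: (moment_integrable Bpsd oOmega young weight_fin (C := 2)) => //.
  exact: continuous_coord1.
by move=> w Sw; exact: density_weight Sw.
Qed.

Lemma gradient_integrable i j : m.-integrable D (EFin \o (bp i j : VM -> R)).
Proof.
have [C C0 HC] := @gradient_weight R d n B Bpsd i j.
apply: (moment_integrable Bpsd oOmega young weight_fin C0) => //.
exact: continuous_coord2.
Qed.

Lemma weak_grad_mv i :
  weak_grad Omega T (fun z => \sum_l projLperp B i l * bs l z) (fun j z => bp i j z).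
Proof.
move=> phi Cphi j; have [_ _ _ H _] := reg.
have [cp cdp] := C1c_cbd oOmega Cphi; have [[_ dp _] _] := Cphi.
have i1 : m.-integrable D (EFin \o (fun z : VM => (\sum_l projLperp B i l * bs l z) * 'D_(dx j) phi z)).
  have := cbd_mul_integrable mD (cdp (dx j)) (integrable_sumR mD (index_enum 'I_n)
    (fun l => integrable_scaleR mD (projLperp B i l) (density_integrable l))).
  by apply: eq_integrable => // z _ /=; rewrite mulrC.
have i2 : m.-integrable D (EFin \o (fun z : VM => bp i j z * phi z)).
  have := cbd_mul_integrable mD cp (gradient_integrable i j).
  by apply: eq_integrable => // z _ /=; rewrite mulrC.
apply: (etrans (esym (iterated_integral i1 (fun x t Dxt => erefl)))).
apply: (etrans _ (congr1 -%R (iterated_integral i2 (fun x t Dxt => erefl)))).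
apply: (etrans _ (etrans (H phi Cphi i j) _)).
  apply: eq_Rintegral => t; rewrite inE => It; apply: eq_Rintegral => x; rewrite inE => Ox.
  congr (_ * _).
    by rewrite mxE; apply: eq_bigr => l _; rewrite bary_sE.
  by rewrite mxE (slice_diff (f := phi))//; apply: dp; split.
apply: (congr1 -%R); apply: eq_Rintegral => t _; apply: eq_Rintegral => x _.
by rewrite mxE.
Qed.

(** The barycenter u is only integrable; what makes the integration by parts
    possible is that P u has the barycenter of p as weak gradient. *)
Lemma green_mv :
  \sum_i \int[m]_(z in D) (psi z.2 * (bs i z * source B v i z)) =
  - \sum_i \int[m]_(z in D) (psi z.2 * \sum_j flux B v z i j * bp i j z).
Proof.
have H := @green R d n Omega T lOmega (fun i z => psi z.2 * source B v i z) bs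
  (fun i j z => psi z.2 * flux B v z i j) bp (projLperp B) t0 t0T
  (fun i => cbdM cbp (cbd_source lOmega v_sol i))
  (fun i j => cbdM cbp (cbd_flux lOmega v_sol i j)) weak_div_psi density_integrable
  gradient_integrable weak_grad_mv.
apply: (etrans _ (etrans (H _ _) _)).
- by apply: eq_bigr => i _; apply: eq_Rintegral => z _; ring.
- move=> z Dz j w; under eq_bigr do rewrite -mulrA; under [RHS]eq_bigr do rewrite -mulrA.
  by rewrite -!mulr_sumr flux_Lperp.
- by move=> z i j _; exact: flux_late.
apply: (congr1 -%R); apply: eq_bigr => i _.
have ij j : m.-integrable D (EFin \o (fun z : VM => (psi z.2 * flux B v z i j) * bp i j z)).
  exact: (cbd_mul_integrable mD (cbdM cbp (cbd_flux lOmega v_sol i j)) (gradient_integrable i j)).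
apply: (etrans (esym (Rintegral_sum mD _ ij))); apply: eq_Rintegral => z _.
by rewrite mulr_sumr; apply: eq_bigr => j _; rewrite mulrA.
Qed.

Hypothesis equation : dissipative_equation Omega B uin mu T.

Let bf i j (z : V) : R := moment B mu (fun w : W => w.1 i 0 * (B *m w.2) i j) z.
Let K i (z : V) : R := \sum_j pressure_grad B v z i j * log_grad v z i j.

Let cbdK i : cbd (D : set V) (K i).
Proof.
apply: cbd_sum => j; apply: cbdM; first exact: (cbd_pressure_grad lOmega v_sol).
exact: (cbd_log_grad lOmega v_sol).
Qed.

Let cbd_pot i : cbd (D : set V) (potential B v i).
Proof. by have [] := C1_cylinder_cbd oOmega bOmega (C1_potential v_sol i). Qed.

Lemma momentum_integrable i j : m.-integrable D (EFin \o (bf i j : VM -> R)).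
Proof.
apply: (moment_integrable Bpsd oOmega young weight_fin (C := 3)) => //.
  by move=> w; apply: cvgM; [exact: continuous_coord1|exact: continuous_q].
by move=> w Sw; exact: flux_weight Sw.
Qed.

(** The potential times psi is an admissible test function: it vanishes from
    t0 < T on, but not on the boundary of Omega nor at time 0. *)
Lemma potential_tested i :
  \int[m]_(z in D) (dpsi z.2 * (potential B v i z * bs i z)) +
  \int[m]_(z in D) (psi z.2 * (bs i z * source B v i z)) +
  \int[m]_(z in D) (psi z.2 * (bs i z * K i z)) +
  psi 0 * \int[leb]_(x in Omega) (v (x, 0) i 0 * potential B v i (x, 0)) =
  \int[m]_(z in D) (psi z.2 *
     \sum_j bf i j z * (log_grad v z i j + pressure_grad B v z i j)).
Proof.
pose phi (z : V) := psi z.2 * potential B v i z.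
have Cp := C1_potential v_sol i.
have Cphi : C1 (D : set V) E phi by apply: C1_mul => //; exact: C1_psi.
have [cp cdp] := C1_cylinder_cbd oOmega bOmega Cphi.
have CphiK : C1c (Omega `*` `]0, T[) (closure Omega `*` `[0, T[) phi.
  split.
    apply: C1_subset Cphi => // -[x t] [/= Ox]; rewrite !in_itv/= => /andP[h0 h1].
    by split => //=; rewrite ?in_itv/= h0 ltW.
  exists (closure Omega `*` `[0, t0]); split.
  - by apply: compact_setX; [exact: closure_bounded|exact: segment_compact].
  - move=> [x t] [/= Ox]; rewrite !in_itv/= => /andP[h0 h1].
    by split => //=; rewrite ?in_itv/= h0 (le_lt_trans h1).
  - move=> [x t] [[/= Ox]]; rewrite in_itv/= => /andP[h0 _] nK.
    rewrite /phi/= psi_late ?mul0r//; apply: ltW; rewrite ltNge; apply/negP => tt0.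
    by apply: nK; split => //=; rewrite ?in_itv/= h0.
have [_ dphi _] := Cphi; have [_ dpot _] := Cp.
have i1 : m.-integrable D (EFin \o (fun z : VM => bs i z * 'D_dt phi z)).
  have := cbd_mul_integrable mD (cdp dt) (density_integrable i).
  by apply: eq_integrable => // z _ /=; rewrite mulrC.
have i2 : m.-integrable D (EFin \o (fun z : VM => \sum_j bf i j z * 'D_(dx j) phi z)).
  apply: (integrable_sumR mD) => j.
  have := cbd_mul_integrable mD (cdp (dx j)) (momentum_integrable i j).
  by apply: eq_integrable => // z _ /=; rewrite mulrC.
have eq := @equation i phi CphiK.
have E1 : \int[m]_(z in D) (bs i z * 'D_dt phi z) =
  \int[m]_(z in D) (dpsi z.2 * (potential B v i z * bs i z)) +
  \int[m]_(z in D) (psi z.2 * (bs i z * source B v i z)) +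
  \int[m]_(z in D) (psi z.2 * (bs i z * K i z)).
  have int (g h : V -> R) : cbd (D : set V) g -> (forall z, h z = g z * bs i z) ->
      has_int m D h (\int[m]_(z in D) h z).
    move=> cg hg; have -> : h = (fun z => g z * bs i z) by apply/funext.
    by split => //; exact: (cbd_mul_integrable mD cg (density_integrable i)).
  have h1 := int (fun z => dpsi z.2 * potential B v i z) (fun z => dpsi z.2 * (potential B v i z * bs i z))
    (cbdM cbdp (cbd_pot i)) (fun z => mulrA _ _ _).
  have h2 := int (fun z => psi z.2 * source B v i z) (fun z => psi z.2 * (bs i z * source B v i z))
    (cbdM cbp (cbd_source lOmega v_sol i)) (fun z => ltac:(cbv beta; ring)).
  have h3 := int (fun z => psi z.2 * K i z) (fun z => psi z.2 * (bs i z * K i z))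
    (cbdM cbp (cbdK i)) (fun z => ltac:(cbv beta; ring)).
  have [_ <-] := has_intD mD (has_intD mD h1 h2) h3.
  apply: eq_Rintegral => z; rewrite inE => Dz.
  rewrite (derive_psiM (f := potential B v i) dt (dpot z Dz)) (derive_potential_t v_sol i Dz).
  by rewrite -/(K i z) /=; ring.
have E2 : \int[leb]_(x in Omega) (uin x i 0 * phi (x, 0)) =
    psi 0 * \int[leb]_(x in Omega) (v (x, 0) i 0 * potential B v i (x, 0)).
  have Cvp : C1 (D : set V) E (fun z => v z i 0 * potential B v i z) by exact: C1_mul.
  have ig := init_int Cvp.
  apply: (etrans _ (RintegralZl (psi 0) mO ig)).
  have ig2 := integrable_scaleR mO (psi 0) ig.
  apply: (congr1 fine (@init_integral _ (fun x => psi 0 * (v (x, 0) i 0 * potential B v i (x, 0))) _ ig2 _)).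
    apply: measurable_funM => //.
    have [h _] := integrableP _ _ _ (init_int Cphi); exact/measurable_EFinP.
  by move=> x Ox vu; rewrite -vu /phi /=; ring.
have E3 : \int[m]_(z in D) (\sum_j bf i j z * 'D_(dx j) phi z) =
   \int[m]_(z in D) (psi z.2 * \sum_j bf i j z * (log_grad v z i j + pressure_grad B v z i j)).
  apply: eq_Rintegral => z; rewrite inE => Dz; rewrite mulr_sumr; apply: eq_bigr => j _.
  rewrite (derive_psiM (f := potential B v i) (dx j) (dpot z Dz)) (derive_potential_x v_sol i j Dz) /=.
  by ring.
rewrite -E1 -E2 -E3.
rewrite -(iterated_integral i1 (g := fun x t => bary_s B mu (x, t) i 0 * derive1 (fun r => phi (x, r)) t)); last first.
  move=> x t Dxt; rewrite bary_sE (time_slice (f := phi))//; exact: dphi.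
rewrite -(iterated_integral i2 (g := fun x t => mxdot (\row_j \int[mu (x, t)]_(w in Sp)
    (w.1 i 0 * (B *m w.2) i j)) (grad (fun a => phi (a, t)) x))); last first.
  move=> x t Dxt; rewrite /mxdot big_ord1; apply: eq_bigr => j _.
  by rewrite !mxE (slice_diff (f := phi))//; exact: dphi.
exact: eq.
Qed.

Hypothesis (quad_int : m.-integrable D (EFin \o (quad B mu : VM -> R)))
  (entropy : \int[m]_(z in D) (- dpsi z.2 * (moment B mu (fun w => hS w.1) z + 2^-1 * quad B mu z)) +
  \int[m]_(z in D) (psi z.2 * (moment B mu (dissipation B) z +
     \sum_i moment B mu (mobility B i) z)) <=
  psi 0 * (\int[leb]_(x in Omega) hS (v (x, 0)) + 2^-1 *
     \int[leb]_(x in Omega) (\sum_i \sum_j B i j * v (x, 0) i 0 * v (x, 0) j 0))).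

(** With u the barycenter, this is the mean of the relative entropy of s with
    respect to v plus 1/2 (u - v) . B (u - v). *)
Definition rel_energy (z : V) : R :=
  moment B mu (fun w => hS w.1) z + 2^-1 * quad B mu z -
  \sum_i bs i z * potential B v i z + energy B v z.

Definition mean_remainder (z : V) : R :=
  - moment B mu (dissipation B) z - \sum_i moment B mu (mobility B i) z
  + \sum_i \sum_j bf i j z * (log_grad v z i j + pressure_grad B v z i j)
  + \sum_i \sum_j flux B v z i j * (bp i j z - space_grad v z i j)
  - \sum_i (bs i z - v z i 0) * K i z.

(** Adding the averaged entropy inequalities, the equation tested with the
    potential, the energy identity of v and the two Green identities cancels the
    initial values and the sources. *)
Lemma rel_energy_inequality :
  exists2 a, a <= 0 & has_int m D
    (fun z => - dpsi z.2 * rel_energy z - psi z.2 * mean_remainder z) a.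
Proof.
have int (g h : V -> R) : cbd (D : set V) g -> m.-integrable D (EFin \o (h : VM -> R)) ->
    has_int m D (fun z => g z * h z) (\int[m]_(z in D) (g z * h z)).
  by move=> cg ih; split => //; exact: (cbd_mul_integrable mD cg ih).
have cbint (g : V -> R) : cbd (D : set V) g -> m.-integrable D (EFin \o (g : VM -> R)).
  by move=> cg; exact: cbd_integrable.
have mi (f : W -> R) : continuous f -> (forall w, Sp w -> `|f w| <= weight B w) ->
    m.-integrable D (EFin \o (moment B mu f : VM -> R)).
  move=> cf fC; apply: (moment_integrable Bpsd oOmega young weight_fin ltr01 cf).
  by move=> w Sw; rewrite mul1r; exact: fC.
have ih : m.-integrable D (EFin \o (fun z : VM => moment B mu (fun w => hS w.1) z + 2^-1 * quad B mu z)).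
  apply: (integrable_addR mD); last exact: integrable_scaleR.
  apply: mi; first exact: continuous_hS.
  by move=> w Sw; exact: hS_weight Sw.
have id_ : m.-integrable D (EFin \o (fun z : VM => moment B mu (dissipation B) z + \sum_i moment B mu (mobility B i) z)).
  apply: (integrable_addR mD).
    by apply: mi; [exact: continuous_dissipation|move=> w Sw; exact: dissipation_weight Sw].
  apply: (integrable_sumR mD) => i.
  by apply: mi; [exact: continuous_mobility|move=> w Sw; exact: mobility_weight Sw].
have cmul (g h : V -> R) : cbd (D : set V) g -> m.-integrable D (EFin \o (h : VM -> R)) ->
    m.-integrable D (EFin \o (fun z : VM => h z * g z)).
  move=> cg ih'; have := cbd_mul_integrable mD cg ih'.
  by apply: eq_integrable => // z _ /=; rewrite mulrC.
have clg i j : cbd (D : set V) (fun z => log_grad v z i j + pressure_grad B v z i j).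
  apply: cbdD; first exact: (cbd_log_grad lOmega v_sol).
  exact: (cbd_pressure_grad lOmega v_sol).
have cfl i j := cbd_flux lOmega v_sol i j.
have A1 := int _ _ (cbdN cbdp) ih.
have B1 i := int _ _ cbdp (cbd_mul_integrable mD (cbd_pot i) (density_integrable i)).
have D1 := int _ _ cbdp (cbint _ (C1_cylinder_cbd oOmega bOmega (C1_energy v_sol)).1).
have A2 := int _ _ cbp id_.
have C_ i := int _ _ cbp (integrable_sumR mD (index_enum 'I_d) (fun j => cmul _ _ (clg i j) (momentum_integrable i j))).
have F_ i := int _ _ cbp (integrable_sumR mD (index_enum 'I_d) (fun j => cbd_mul_integrable mD (cfl i j) (gradient_integrable i j))).
have G_ i := int _ _ cbp (integrable_sumR mD (index_enum 'I_d) (fun j => cbint _ (cbdM (cfl i j) (cbd_space_grad lOmega v_sol i j)))).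
have B3 i := int _ _ cbp (cmul _ _ (cbdK i) (density_integrable i)).
have D3 i := int _ _ cbp (cbint _ (cbdM (cbd_v lOmega v_sol i) (cbdK i))).
have S f a (h : forall i, has_int m D (f i) (a i)) := has_int_sum mD (index_enum 'I_n) h.
have HL := has_intB mD (has_intD mD A1 (S _ _ B1)) D1.
have HR := has_intD mD (has_intB mD (has_intB mD (has_intD mD (has_intD mD
  (has_intN mD A2) (S _ _ C_)) (S _ _ F_)) (S _ _ G_)) (S _ _ B3)) (S _ _ D3).
have H := has_intB mD HL HR.
eexists; last first.
  apply: (has_int_ext mD _ H) => z Dz /=.
  have -> : \sum_i dpsi z.2 * (potential B v i z * bs i z) =
      dpsi z.2 * \sum_i bs i z * potential B v i z.
    by rewrite mulr_sumr; apply: eq_bigr => i _; ring.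
  rewrite -!mulr_sumr /rel_energy /mean_remainder.
  have -> : \sum_i \sum_j flux B v z i j * (bp i j z - space_grad v z i j) =
    \sum_i \sum_j flux B v z i j * bp i j z -
    \sum_i \sum_j flux B v z i j * space_grad v z i j.
    rewrite -sumrB; apply: eq_bigr => i _; rewrite -sumrB; apply: eq_bigr => j _; exact: mulrBr.
  have -> : \sum_i (bs i z - v z i 0) * K i z =
    \sum_i bs i z * K i z - \sum_i v z i 0 * K i z.
    by rewrite -sumrB; apply: eq_bigr => i _; exact: mulrBl.
  ring.
have II : \sum_i (\int[m]_(z in D) (dpsi z.2 * (potential B v i z * bs i z)) +
  \int[m]_(z in D) (psi z.2 * (bs i z * source B v i z)) +
  \int[m]_(z in D) (psi z.2 * (bs i z * K i z)) +
  psi 0 * \int[leb]_(x in Omega) (v (x, 0) i 0 * potential B v i (x, 0))) =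
  \sum_i \int[m]_(z in D) (psi z.2 *
     \sum_j bf i j z * (log_grad v z i j + pressure_grad B v z i j)).
  by apply: eq_bigr => i _; exact: potential_tested.
rewrite !big_split/= -mulr_sumr -init_energy_cancel in II.
have III := energy_identity; have IV := green_mv; have IV' := green_strong.
rewrite IV in II; rewrite IV' in III.
have arith (p h e a b c dd f g x y zz : R) : a + b <= p * h ->
  x + - f + y + p * (h + e) = c -> zz + - g + dd = - (p * e) ->
  a + x - zz - (- b + c + f - g - y + dd) <= 0.
  by rewrite mulrDr => h1 h2 h3; lra.
exact: arith entropy II III.
Qed.

End weighted.
End WeakStrong.

(** * Concentration at a point of space-time *)

Section Concentration.
Context {R : realType} {d n : nat}.
Local Notation V := ('rV[R]_d * R)%type.
Local Notation VM := ('rV[R]_d * measurableTypeR R)%type.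
Local Notation W := ('cV[R]_n * 'M[R]_(n, d))%type.
Local Notation m := (@lebVt R d).
Variables (Omega : set 'rV[R]_d) (T : R) (B : 'M[R]_n) (v : V -> 'cV[R]_n)
  (mu : V -> probability W R) (z : V).
Let Sp : set W := state_space B.
Hypotheses (Bpsd : psd B) (young : young_measure Omega B mu)
  (Dz : (Omega `*` `]0, T[) z) (gz : good B mu z).
Hypotheses (v_gt0 : forall i, 0 < v z i 0).
Let mS : measurable Sp. Proof. exact: measurable_state_space. Qed.
Local Notation hi := (has_int (mu z) Sp).

Let gi (f : W -> R) C : continuous f -> (forall w, Sp w -> `|f w| <= C * weight B w) ->
  hi f (moment B mu f z).
Proof. by move=> cf fC; split => //; exact: good_integrable cf fC gz. Qed.

Let gi1 (f : W -> R) : continuous f -> (forall w, Sp w -> `|f w| <= weight B w) ->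
  hi f (moment B mu f z).
Proof. by move=> cf fC; apply: (gi (C := 1)) => // w Sw; rewrite mul1r fC. Qed.

Let cst_int (c : R) : hi (fun _ => c) c.
Proof.
rewrite -[X in has_int _ _ _ X](moment_cst young c Dz); apply: (gi (C := `|c|)).
  by move=> w; exact: cvg_cst.
by move=> w Sw; rewrite ler_peMr// weight_ge1.
Qed.

Let density_int i : hi (fun w => w.1 i 0) (moment B mu (fun w => w.1 i 0) z).
Proof.
apply: (gi (C := 2)); first exact: continuous_coord1.
by move=> w Sw; exact: density_weight Sw.
Qed.

Let gradient_int i j : hi (fun w => w.2 i j) (moment B mu (fun w => w.2 i j) z).
Proof.
have [C _ HC] := @gradient_weight R d n B Bpsd i j.
by apply: (gi (C := C)) => //; exact: continuous_coord2.
Qed.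

(** The remainder is affine in each integrand whose mean enters the definition of
    mean_remainder. *)
Lemma remainder_int :
  hi (fun w => remainder B (v z) (space_grad v z) (log_grad v z) w.1 w.2)
     (mean_remainder B v mu z).
Proof.
apply: has_intB => //.
  apply: has_intD => //.
    apply: has_intD => //.
      apply: has_intB => //.
        apply: has_intN => //; apply: gi1; first exact: continuous_dissipation.
        by move=> w Sw; exact: dissipation_weight Sw.
      apply: has_int_sum => // i; apply: gi1; first exact: continuous_mobility.
      by move=> w Sw; exact: mobility_weight Sw.
    apply: has_int_sum => // i; apply: has_int_sum => // j; apply: has_intMr => //.
    apply: (gi (C := 3)).
      by move=> w; apply: cvgM; [exact: continuous_coord1|exact: continuous_q].
    by move=> w Sw; exact: flux_weight Sw.
  apply: has_int_sum => // i; apply: has_int_sum => // j; apply: has_intMl => //.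
  by apply: has_intB.
apply: has_int_sum => // i; apply: has_intMr => //.
by apply: has_intB.
Qed.

Definition mean_relent : R :=
  moment B mu (fun w => hS w.1) z - \sum_i moment B mu (fun w => w.1 i 0) z * ln (v z i 0) +
  \sum_i (v z i 0 - 1).

Lemma relent_int : hi (fun w => \sum_i relent (w.1 i 0) (v z i 0)) mean_relent.
Proof.
have h : hi (fun w => hS w.1 - \sum_i w.1 i 0 * ln (v z i 0) + \sum_i (v z i 0 - 1)) mean_relent.
  apply: has_intD => //.
  apply: has_intB => //.
    by apply: gi1; [exact: continuous_hS|move=> w Sw; exact: hS_weight Sw].
  by apply: has_int_sum => // i; exact: (has_intMr mS _ (density_int i)).
by apply: (has_int_ext mS _ h) => w _; rewrite /hS -sumrB -big_split.
Qed.

Lemma rel_energyE : rel_energy B v mu z = mean_relent +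
  2^-1 * \sum_i \sum_j B i j * (bary_s B mu z - v z) i 0 * (bary_s B mu z - v z) j 0.
Proof.
rewrite /rel_energy /mean_relent /quad /energy.
set u := bary_s B mu z; set hh := moment _ _ _ _.
have -> : \sum_i moment B mu (fun w => w.1 i 0) z * potential B v i z =
   \sum_i moment B mu (fun w => w.1 i 0) z * ln (v z i 0) +
   \sum_i u i 0 * \sum_k B i k * v z k 0.
  by rewrite -big_split; apply: eq_bigr => i _ /=; rewrite /potential mulrDr /u bary_sE.
have -> : \sum_i \sum_j B i j * (u - v z) i 0 * (u - v z) j 0 =
   \sum_i \sum_j B i j * u i 0 * u j 0 - 2 * (\sum_i u i 0 * \sum_k B i k * v z k 0) +
   \sum_i v z i 0 * \sum_k B i k * v z k 0.
  have Bs i j : B i j = B j i by rewrite -{1}(proj1 Bpsd) mxE.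
  have sym : \sum_i u i 0 * (\sum_k B i k * v z k 0) = \sum_i v z i 0 * (\sum_k B i k * u k 0).
    under eq_bigr do rewrite mulr_sumr; under [RHS]eq_bigr do rewrite mulr_sumr.
    rewrite exchange_big; apply: eq_bigr => i _; apply: eq_bigr => j _ /=.
    by rewrite (Bs i j); ring.
  have dbl (a b : R) : a = b -> 2 * a = a + b by move=> <-; ring.
  rewrite (dbl _ _ sym) -big_split -sumrB -big_split.
  apply: eq_bigr => i _ /=; rewrite !mulr_sumr -big_split -sumrB -big_split.
  apply: eq_bigr => j _ /=.
  have sub k : (u - v z) k 0 = u k 0 - v z k 0 by rewrite mxE [(- v z) k 0]mxE.
  by rewrite !sub; ring.
by field.
Qed.

Variables (C p q : R).
Hypothesis (C_ge0 : 0 <= C) (bound : forall (s : 'cV[R]_n) (w2 : 'M[R]_(n, d)),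
    (forall i, 0 <= s i 0) ->
    let X := w2 - projLperp B *m space_grad v z in
    remainder B (v z) (space_grad v z) (log_grad v z) s w2 <=
      C * (\sum_i relent (s i 0) (v z i 0)) - 2^-1 * mxdot X (B *m X))
  (p_gt0 : 0 < p) (qp : C * p < q).

Let relent_pos (w : W) : Sp w -> 0 <= \sum_i relent (w.1 i 0) (v z i 0).
Proof. by move=> [s0 _]; apply: sumr_ge0 => i _; exact: relent_ge0. Qed.

Let gap (w : W) : R := C * (\sum_i relent (w.1 i 0) (v z i 0)) -
  remainder B (v z) (space_grad v z) (log_grad v z) w.1 w.2.

Let gap_pos (w : W) : Sp w -> let X := w.2 - projLperp B *m space_grad v z in
  2^-1 * mxdot X (B *m X) <= gap w.
Proof. by move=> [s0 _] /=; rewrite /gap; have /= := bound w.2 s0; lra. Qed.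

Let gap_ge0 (w : W) : Sp w -> 0 <= gap w.
Proof.
move=> Sw; apply: le_trans (gap_pos Sw).
by rewrite mulr_ge0 ?invr_ge0// psd_mxdot_ge0.
Qed.

Let gap_int : hi gap (C * mean_relent - mean_remainder B v mu z).
Proof.
by apply: has_intB => //; [apply: has_intMl => //; exact: relent_int|exact: remainder_int].
Qed.

Let mean_relent_ge0 : 0 <= mean_relent.
Proof. exact: (has_int_ge0 relent_pos relent_int). Qed.
Let mean_gap_ge0 : 0 <= C * mean_relent - mean_remainder B v mu z.
Proof. exact: (has_int_ge0 gap_ge0 gap_int). Qed.
Let le_rel_energy : mean_relent <= rel_energy B v mu z.
Proof. by rewrite rel_energyE lerDl mulr_ge0 ?invr_ge0// quad_form_ge0. Qed.

Let q_gt0 : 0 < q. Proof. by apply: le_lt_trans qp; rewrite mulr_ge0// ltW. Qed.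

Let split_lb : (q - C * p) * mean_relent + p * (C * mean_relent - mean_remainder B v mu z) <=
  q * rel_energy B v mu z - p * mean_remainder B v mu z.
Proof.
have : q * mean_relent <= q * rel_energy B v mu z by rewrite ler_wpM2l// ltW.
lra.
Qed.

Let part1 : 0 <= (q - C * p) * mean_relent.
Proof. by rewrite mulr_ge0// subr_ge0 ltW. Qed.
Let part2 : 0 <= p * (C * mean_relent - mean_remainder B v mu z).
Proof. by rewrite mulr_ge0// ltW. Qed.

(** With eta the mean relative entropy and g >= 0 the mean gap, the integrand is at
    least (q - C p) eta + p g. *)
Lemma integrand_ge0 : 0 <= q * rel_energy B v mu z - p * mean_remainder B v mu z.
Proof. by apply: le_trans split_lb; rewrite addr_ge0. Qed.

(** If both nonnegative means vanish, the relative entropy and the form of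
    p - P grad v vanish almost surely. *)
Lemma concentration : q * rel_energy B v mu z - p * mean_remainder B v mu z = 0 ->
  {ae mu z, forall w, Sp w -> w = (v z, projLperp B *m space_grad v z)}.
Proof.
move=> r0; have := split_lb; rewrite r0 => le0.
have e0 : mean_relent = 0.
  have : (q - C * p) * mean_relent = 0.
    by apply/eqP; rewrite eq_le part1 andbT; have := part2; lra.
  by move/eqP; rewrite mulf_eq0 gt_eqF ?subr_gt0//= => /eqP.
have g0 : C * mean_relent - mean_remainder B v mu z = 0.
  have : p * (C * mean_relent - mean_remainder B v mu z) = 0.
    by apply/eqP; rewrite eq_le part2 andbT; have := part1; lra.
  by move/eqP; rewrite mulf_eq0 gt_eqF//= => /eqP.
have h1 := relent_int; rewrite e0 in h1; have h2 := gap_int; rewrite g0 in h2.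
have a1 := has_int_eq0 mS relent_pos h1; have a2 := has_int_eq0 mS gap_ge0 h2.
apply: filterS2 a1 a2 => w H1 H2 Sw; have [s0 pL] := Sw.
have rel_i i : relent (w.1 i 0) (v z i 0) = 0.
  have : \sum_i relent (w.1 i 0) (v z i 0) == 0 by rewrite H1.
  rewrite psumr_eq0; last by move=> k _; exact: relent_ge0.
  by move/allP => /(_ i (mem_index_enum i)) /eqP.
case: w H1 H2 Sw s0 pL rel_i => s w2 /= H1 H2 Sw s0 pL rel_i.
congr pair.
  apply/matrixP => i j; rewrite (ord1 j); apply: relent_eq0 => //.
  by rewrite rel_i.
apply/eqP; rewrite -subr_eq0; apply/eqP; apply: (Lperp_form_eq0 Bpsd).
  rewrite linearB /= addmx_sub//.
  by rewrite (eqmxMr _ (eqmx_opp _)) || rewrite eqmx_opp; exact: projLperp_sub.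
apply/eqP; rewrite eq_le psd_mxdot_ge0// andbT.
by have := gap_pos Sw; rewrite /= H2// pmulr_rle0 ?invr_gt0.
Qed.

(** A probability that gives full mass to one point; singletons need not be
    discussed, the complement of a measurable set avoiding the point being null. *)
Lemma dirac_product (a : 'cV[R]_n) (b : 'M[R]_(n, d)) :
  {ae mu z, forall w, Sp w -> w = (a, b)} ->
  forall A : set W, measurable A -> mu z A = (\d_a \x \d_b)%E A.
Proof.
move=> conc A mA.
have mSp : mu z Sp = 1%E by exact: (young_mass young Dz).
have NS : (mu z).-negligible (~` Sp).
  apply/(negligibleP (mu z) (measurableC mS)).
  apply: (etrans (probability_setC (mu z) mS)).
  by apply: (etrans (congr1 (fun a => 1 - a)%E mSp)); rewrite subee.
have N1 : (mu z).-negligible [set w | w <> (a, b)].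
  have := negligibleU conc NS; apply: negligibleS => w /= nw.
  have [Sw|nSw] := pselect (Sp w); last by right.
  by left => H; apply: nw; exact: H.
have -> : (\d_a \x \d_b)%E A = \d_(a, b) A :> \bar R.
  have mx : measurable_fun setT (\d_b \o xsection A : _ -> \bar R).
    exact: measurable_fun_xsection.
  have E1 : (\d_a \x \d_b)%E A = (\int[\d_a]_x (\d_b \o xsection A) x)%E :> \bar R by [].
  have E2 := integral_dirac a (D := setT) measurableT mx.
  apply: (etrans E1); apply: (etrans E2).
  rewrite diracT mul1e /= !diracE; congr (_%:R%:E); congr nat_of_bool.
  by apply/idP/idP; rewrite !inE /xsection/= ?inE.
have [Aab|nAab] := pselect (A (a, b)).
  have N2 : (mu z).-negligible (~` A).
    by apply: negligibleS N1 => w nA /= wE; apply: nA; rewrite wE.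
  have := measure_negligible (measurableC mA) N2.
  move/(etrans (esym (probability_setC (mu z) mA))) => h.
  rewrite diracE mem_set//=.
  have fA : mu z A \is a fin_num by exact: fin_num_measure.
  move: h; rewrite -(fineK fA) -EFinB => -[h]; congr EFin; lra.
rewrite diracE memNset//=; apply: measure_negligible => //.
by apply: negligibleS N1 => w Aw /= wE; apply: nAab; rewrite -wE.
Qed.

End Concentration.

(** * Uniqueness *)

Section Uniqueness.
Context {R : realType} {d n : nat}.
Local Notation V := ('rV[R]_d * R)%type.
Local Notation VM := ('rV[R]_d * measurableTypeR R)%type.
Local Notation W := ('cV[R]_n * 'M[R]_(n, d))%type.
Local Notation m := (@lebVt R d).
Local Notation leb := (@lebV R d).
Variables (Omega : set 'rV[R]_d) (T : R) (B : 'M[R]_n) (v : V -> 'cV[R]_n)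
  (uin : 'rV[R]_d -> 'cV[R]_n) (mu : V -> probability W R).
Hypotheses (lOmega : lipschitz_domain Omega) (T_gt0 : 0 < T) (Bpsd : psd B)
  (muin : measurable_fun Omega uin)
  (v_sol : positive_weak_solution Omega B T v)
  (v_init : {ae lebesgue_measure_rV R d, forall x, Omega x -> v (x, 0) = uin x})
  (mu_sol : dissipative_mv_solution Omega B uin mu).
Let Sp : set W := state_space B.
Let D : set VM := Omega `*` `]0, T[.
Let oOmega : open Omega. Proof. by case: lOmega. Qed.
Let bOmega : bounded_set Omega. Proof. by case: lOmega. Qed.
Let mD : measurable D. Proof. exact: measurable_cylinder. Qed.
Let young : young_measure Omega B mu. Proof. by case: mu_sol. Qed.
Let reg : dissipative_regularity Omega B mu T. Proof. by case: mu_sol => _ /(_ T T_gt0) []. Qed.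
Let ent : dissipative_entropy Omega B uin mu. Proof. by case: mu_sol => _ /(_ T T_gt0) []. Qed.
Let eqn : dissipative_equation Omega B uin mu T. Proof. by case: mu_sol => _ /(_ T T_gt0) []. Qed.
Let v_gt0 z i : (closure Omega `*` `[0, T]) z -> 0 < v z i 0.
Proof. by case: v_sol => _ h _ Ez; exact: h. Qed.

Let hs := \int[leb]_(x in Omega) hS (v (x, 0)).
Let hr := 2^-1 * \int[leb]_(x in Omega) (\sum_i \sum_j B i j * v (x, 0) i 0 * v (x, 0) j 0).

Let hs_ge0 : 0 <= hs.
Proof.
apply: fine_ge0; apply: integral_ge0 => x Ox; rewrite lee_fin; apply: sumr_ge0 => i _.
apply: hS_term_ge0; apply: ltW; apply: v_gt0; split => /=; first exact: subset_closure.
by rewrite in_itv/= lexx ltW.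
Qed.

Let hr_ge0 : 0 <= hr.
Proof.
rewrite mulr_ge0 ?invr_ge0//; apply: fine_ge0; apply: integral_ge0 => x Ox.
by rewrite lee_fin; exact: quad_form_ge0.
Qed.

Let hsE : HS Omega uin = hs%:E. Proof. exact: (HS_init lOmega T_gt0 muin v_sol v_init). Qed.
Let hrE : HR Omega B uin = hr%:E. Proof. exact: (HR_init lOmega T_gt0 muin v_sol v_init). Qed.

Let w_lty := weight_lty Bpsd oOmega bOmega T_gt0 young ent hs_ge0 hr_ge0 hsE hrE.
Let q_int := quad_integrable Bpsd oOmega T_gt0 young ent hr_ge0 hrE.

(** The rate C depends only on bounds for v and its derivatives, so the exponent of
    the weight can be fixed in terms of C and T. The integrand of the relative
    entropy inequality is then nonnegative with nonpositive integral. *)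
Lemma concentration_before (t0 : R) : t0 < T ->
  {ae m, forall z, D z -> z.2 < t0 ->
    {ae mu z, forall w, Sp w -> w = (v z, projLperp B *m space_grad v z)}}.
Proof.
move=> t0T.
have [M0 hM0] := v_bounds lOmega v_sol; have [N0 hN0] := drift_bound lOmega v_sol.
pose M := Num.max M0 0; pose N := Num.max N0 0.
have M_ge0 : 0 <= M by rewrite le_max lexx orbT.
have Nn_ge0 : 0 <= N by rewrite le_max lexx orbT.
have [C C_ge0 HC] := @remainder_bound R d n B Bpsd M N M_ge0 Nn_ge0.
(* The exponent k + 2 exceeds C t0, as dpsi_beats requires. *)
pose k := Num.truncn (C * T).
have Ck : C * t0 < k.+2%:R.
  have CT : C * t0 <= C * T by rewrite ler_wpM2l// ltW.
  apply: (le_lt_trans CT); apply: (lt_trans (truncnS_gt _)); by rewrite ltr_nat.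
have bound z : D z -> forall (s : 'cV[R]_n) (w2 : 'M[R]_(n, d)),
    (forall i, 0 <= s i 0) ->
    let X := w2 - projLperp B *m space_grad v z in
    remainder B (v z) (space_grad v z) (log_grad v z) s w2 <=
      C * (\sum_i relent (s i 0) (v z i 0)) - 2^-1 * mxdot X (B *m X).
  move=> Dz s w2 s0; apply: HC => //.
  - move=> i j; rewrite [log_grad _ _ _ _]mxE mulrC divfK// gt_eqF//.
    by have /andP[] := hM0 z i Dz.
  - by move=> i; have /andP[-> h] := hM0 z i Dz; rewrite le_max h.
  - by move=> i j; have h := hN0 z i j Dz; rewrite le_max h.
have vpos z : D z -> forall i, 0 < v z i 0 by move=> Dz i; have /andP[] := hM0 z i Dz.
have [a a_le0 [ir_ ra_]] := rel_energy_inequality lOmega T_gt0 Bpsd muin v_sol v_init young w_lty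
  t0T reg eqn q_int
  (entropy_weighted Bpsd oOmega bOmega T_gt0 young ent hs_ge0 hr_ge0 hsE hrE k t0T).
pose r1 (z : VM) : R :=
  - dpsi k t0 z.2 * rel_energy B v mu z - psi k t0 z.2 * mean_remainder B v mu z.
have ir : m.-integrable D (EFin \o r1) by exact: ir_.
have ra : \int[m]_(z in D) r1 z = a by exact: ra_.
have gae := ae_good Bpsd oOmega young w_lty.
have early z : D z -> z.2 < t0 -> C * psi k t0 z.2 < - dpsi k t0 z.2.
  move=> [_ It] zt0; have /andP[z0 _] : 0 < z.2 < T by move: It; rewrite /= in_itv.
  exact: dpsi_beats.
have r_ge0 z : D z -> good B mu z -> 0 <= r1 z.
  move=> Dz gz; have [zt0|t0z] := ltP z.2 t0.
    exact: (integrand_ge0 Bpsd young Dz gz (vpos z Dz) C_ge0 (bound z Dz) (psi_early k zt0) (early z Dz zt0)).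
  have dp0 : dpsi k t0 z.2 = 0.
    by rewrite /dpsi /pospow max_l ?subr_le0// expr0n/= mulr0 oppr0.
  by rewrite /r1 (psi_late k t0z) dp0 oppr0 !mul0r subrr.
have iabs : m.-integrable D (EFin \o (fun z => `|r1 z|)).
  exact: (@integrable_norm _ _ _ _ _ r1).
have absE : \int[m]_(z in D) `|r1 z| = \int[m]_(z in D) r1 z.
  rewrite /Rintegral; congr fine; apply: ae_eq_integral => //.
  - by case/integrableP: iabs.
  - by case/integrableP: ir.
  - by apply: filterS gae => z H Dz; rewrite ger0_norm// r_ge0//; exact: H.
have h0 : has_int m D (fun z => `|r1 z|) 0.
  split => //; apply/eqP; rewrite eq_le absE ra a_le0/= -ra -absE.
  by apply: fine_ge0; apply: integral_ge0 => z _; rewrite lee_fin.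
have abs0 := has_int_eq0 mD (fun z _ => normr_ge0 (r1 z)) h0.
apply: filterS2 gae abs0 => z Hg H0 Dz zt0.
apply: (concentration Bpsd young Dz (Hg Dz) (vpos z Dz) C_ge0 (bound z Dz) (psi_early k zt0) (early z Dz zt0)).
by apply/eqP; rewrite -normr_eq0; apply/eqP; exact: H0.
Qed.

Lemma mv_solution_dirac :
  {ae m, forall z, D z -> forall A : set W, measurable A ->
    mu z A = (\d_(v z) \x \d_(projLperp B *m space_grad v z))%E A}.
Proof.
(* The conclusion before t0 < T is exhausted along t0 tending to T. *)
pose t0 l : R := T - T / l.+2%:R.
have t0T l : t0 l < T by rewrite ltrBlDr ltrDl divr_gt0.
have H : {ae m, forall z, forall l, D z -> z.2 < t0 l ->
    {ae mu z, forall w, Sp w -> w = (v z, projLperp B *m space_grad v z)}}.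
  by apply/ae_foralln => l; exact: concentration_before.
apply: filterS H => z Hz Dz.
have zT : 0 < T - z.2 by case: Dz => _; rewrite /= in_itv/= subr_gt0 => /andP[].
pose l := Num.truncn (T / (T - z.2)).
have zl : z.2 < t0 l.
  have h : T / (T - z.2) < l.+2%:R.
    by apply: (lt_trans (truncnS_gt _)); rewrite ltr_nat.
  rewrite ltrBrDr addrC -ltrBrDr ltr_pdivrMr// mulrC.
  by move: h; rewrite ltr_pdivrMr.
exact: (dirac_product young Dz (Hz l Dz zl)).
Qed.

End Uniqueness.

Theorem theorem7 (R : realType) (d n : nat) (d_gt0 : (0 < d)%N)
    (Omega : set 'rV[R]_d) (hOmega : lipschitz_domain Omega)
    (T : R) (T_gt0 : 0 < T)
    (B : 'M[R]_n) (B_ge0 : forall i j, 0 <= B i j) (B_psd : psd B)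
    (B_diag : forall i, 0 < B i i)
    (uin : 'rV[R]_d -> 'cV[R]_n)
    (uin_L2 : inLp (lebesgue_measure_rV R d) Omega 2 uin)
    (uin_ge0 : {ae lebesgue_measure_rV R d, forall x, Omega x ->
                 forall i, 0 <= uin x i 0})
    (v : 'rV[R]_d * R -> 'cV[R]_n)
    (v_sol : positive_weak_solution Omega B T v)
    (v_init : {ae lebesgue_measure_rV R d, forall x, Omega x ->
                v (x, 0) = uin x /\ forall i, 0 < uin x i 0})
    (mu : 'rV[R]_d * R -> probability ('cV[R]_n * 'M[R]_(n, d))%type R)
    (mu_sol : dissipative_mv_solution Omega B uin mu) :
  {ae (lebesgue_measure_rV R d \x @lebesgue_measure R)%E,
    forall z, (Omega `*` `]0, T[) z ->
    forall A : set ('cV[R]_n * 'M[R]_(n, d)), measurable A ->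
      mu z A =
      (\d_(v z)
       \x \d_(jac (fun y => projLperp B *m v (y, z.2)) z.1))%E A}.
Proof.
have init : {ae lebesgue_measure_rV R d, forall x, Omega x -> v (x, 0) = uin x}.
  by apply: filterS v_init => x H Ox; have [] := H Ox.
have H := mv_solution_dirac hOmega T_gt0 B_psd uin_L2.1 v_sol init mu_sol.
apply: filterS H => z Hz Dz A mA.
by rewrite (jac_slice v_sol (projLperp B) Dz); exact: Hz.
Qed.
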